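(* Let $\bullet\in\{*,ш\}$ and let $\mathbf k=(k_1,\dots,k_r)$ be an index ($r\ge1$) with weight $k=\mathrm{wt}(\mathbf k)>r$. Then in $\mathcal Z[T_1,T_2][[s,t]]$, \begin{align*} &\sum_{i=1}^{r}\sum_{j=0}^{k_i-1}\zeta^{s,t,\star,\bullet}_{\widehat{\mathcal S}}(j+1,\mathbf k^{[i]},\mathbf k_{[i-1]},k_i-j;T_1,T_2)\\ &=\sum_{i=1}^{r}\sum_{j=0}^{\infty}\Bigl(\zeta^{s,t,\star,\bullet}_{\widehat{\mathcal S}}(j+1,\mathbf k^{[i]},\mathbf k_{[i]};T_1,T_2)\,t^j+\zeta^{s,t,\star,\bullet}_{\widehat{\mathcal S}}(\mathbf k^{[i]},\mathbf k_{[i]},j+1;T_1,T_2)\,s^j\Bigr)+k\,\zeta^{s,t,\star,\bullet}_{\widehat{\mathcal S}}(k+1;T_1,T_2). \end{align*}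
   Context: $s,t,T,T_1,T_2$ are commuting indeterminates. An index is a finite tuple $\mathbf{k}=(k_1,\dots,k_r)$ of positive integers ($r\ge0$; empty $\varnothing$), $\mathrm{dep}(\mathbf k)=r$, $\mathrm{wt}(\mathbf k)=\sum k_i$; $\mathbf{k}_{[i]}=(k_1,\dots,k_i)$, $\mathbf{k}^{[i]}=(k_{i+1},\dots,k_r)$ ($0\le i\le r$), $\overleftarrow{\mathbf{k}}=(k_r,\dots,k_1)$; commas inside arguments denote concatenation; $\oplus$ is componentwise sum and $b\binom{\mathbf{k}}{\mathbf{l}}=\prod_{i}\binom{k_i+l_i-1}{l_i}$. MZVs $\zeta(\mathbf k)$ for admissible $\mathbf k$ (empty or $k_r\ge2$), $\mathcal Z$ the $\mathbb Q$-algebra they generate. $\zeta^{\bullet}(\mathbf k;T)$ ($\bullet\in\{*,ш\}$): with $\mathfrak H=\mathbb Q\langle e_0,e_1\rangle$, $e_{\mathbf{k}}=e_1e_0^{k_1-1}\cdots e_1e_0^{k_r-1}$, $Z^\bullet_T$ the unique $\mathbb Q$-algebra homomorphism $(\mathbb Q+e_1\mathfrak H,\bullet)\to\mathbb R[T]$ (harmonic product $*$ resp. shuffle product $ш$) with $Z^\bullet_T(e_{\mathbf k})=(-1)^{\mathrm{dep}}\zeta(\mathbf k)$ for admissible $\mathbf k$ and $Z^\bullet_T(e_1)=-T$; $\zeta^\bullet(\mathbf k;T)=(-1)^{\mathrm{dep}(\mathbf k)}Z^\bullet_T(e_{\mathbf k})$. Shifted values $\zeta^{t,\bullet}_{\mathrm{shift}}(\mathbf{k};T)=\sum_{\mathbf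 n\in\mathbb Z_{\ge0}^{\mathrm{dep}(\mathbf k)}}b\binom{\mathbf k}{\mathbf n}\zeta^{\bullet}(\mathbf k\oplus\mathbf n;T)(-t)^{\mathrm{wt}(\mathbf n)}$ (also with $s$ or $-t$ in place of $t$). $\zeta^{s,t,\bullet}_{\widehat{\mathcal S}}(\mathbf k;T_1,T_2)=\sum_{i=0}^{r}(-1)^{\mathrm{wt}(\mathbf k^{[i]})}\zeta^{s,\bullet}_{\mathrm{shift}}(\mathbf k_{[i]};T_1)\zeta^{-t,\bullet}_{\mathrm{shift}}(\overleftarrow{\mathbf k^{[i]}};T_2)$. Star values: $\mathbf l\preceq\mathbf k$ if $\mathbf l$ is obtained from $(k_1\circ\cdots\circ k_r)$ by replacing each $\circ$ by a comma or a plus sign ($\varnothing\preceq\varnothing$); $\zeta^{s,t,\star,\bullet}_{\widehat{\mathcal S}}(\mathbf k;T_1,T_2)=\sum_{\mathbf l\preceq\mathbf k}\zeta^{s,t,\bullet}_{\widehat{\mathcal S}}(\mathbf l;T_1,T_2)$. *)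

(* Defs.v *)
From HB Require Import structures.
From mathcomp Require Import all_boot all_order all_algebra.
From mathcomp Require Import boolp classical_sets reals topology normedtype sequences.
Set Implicit Arguments. Unset Strict Implicit. Unset Printing Implicit Defensive.
Import Order.TTheory GRing.Theory Num.Theory numFieldNormedType.Exports.
Local Open Scope ring_scope.

Definition is_index (k : seq nat) : bool := all (fun x => 0 < x)%N k.
Definition wt (k : seq nat) : nat := sumn k.
Definition admissible (k : seq nat) : bool :=
  is_index k && ((k == [::]) || (1 < last 0%N k)%N).

(* partial sums over 0 < n_1 < ... < n_r < N, given the REVERSED index *)
Fixpoint mzv_partial_rev (R : realType) (l : seq nat) (N : nat) : R :=
  match l with
  | [::] => 1
  | a :: l' => \sum_(1 <= m < N) mzv_partial_rev R l' m / (m%:R ^+ a)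
  end.
Definition mzv_partial (R : realType) (k : seq nat) (N : nat) : R :=
  mzv_partial_rev R (rev k) N.
Definition mzv (R : realType) (k : seq nat) : R := limn (mzv_partial R k).

Fixpoint stuffle (k l : seq nat) : seq (seq nat) :=
  match k with
  | [::] => [:: l]
  | a :: k' =>
    let fix aux (l : seq nat) : seq (seq nat) :=
      match l with
      | [::] => [:: k]
      | b :: l' => map (cons a) (stuffle k' l) ++ map (cons b) (aux l')
                   ++ map (cons (a + b)%N) (stuffle k' l')
      end in aux l
  end.

(* ---------- shuffle product of words in e_0 (false), e_1 (true) ---------- *)
Fixpoint shuffle (u v : seq bool) : seq (seq bool) :=
  match u with
  | [::] => [:: v]
  | a :: u' =>
    let fix aux (v : seq bool) : seq (seq bool) :=
      match v with
      | [::] => [:: u]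
      | b :: v' => map (cons a) (shuffle u' v) ++ map (cons b) (aux v')
      end in aux v
  end.
Definition word_of_index (k : seq nat) : seq bool :=
  flatten [seq true :: nseq x.-1 false | x <- k].
(* inverse on words starting with e_1 *)
Definition index_of_word (w : seq bool) : seq nat :=
  (foldr (fun b zl => if b then (0%N, zl.1.+1 :: zl.2) else (zl.1.+1, zl.2))
         (0%N, [::]) w).2.
Definition shuffle_index (k l : seq nat) : seq (seq nat) :=
  map index_of_word (shuffle (word_of_index k) (word_of_index l)).

Inductive bullet := Harmonic | Shuffle.
Definition bprod (bl : bullet) : seq nat -> seq nat -> seq (seq nat) :=
  match bl with Harmonic => stuffle | Shuffle => shuffle_index end.

(* zr k plays the role of zeta^bullet(k;T) = (-1)^dep(k) Z^bullet_T(e_k).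
   Z^bullet_T being the (unique) algebra homomorphism with the prescribed values
   is equivalent to the following properties of zr (the sign (-1)^dep is
   absorbed: the products below are the usual stuffle / shuffle). *)
Definition is_reg_zeta (R : realType) (bl : bullet) (zr : seq nat -> {poly R}) : Prop :=
  [/\ zr [::] = 1,
      zr [:: 1%N] = 'X,
      (forall k, admissible k -> zr k = (mzv R k)%:P) &
      (forall k l, is_index k -> is_index l ->
         zr k * zr l = \sum_(m <- bprod bl k l) zr m)].

Fixpoint comps (r a : nat) : seq (seq nat) :=
  match r with
  | 0 => if a == 0%N then [:: [::]] else [::]
  | r'.+1 => flatten [seq map (cons i) (comps r' (a - i)) | i <- iota 0 a.+1]
  end.
Definition binomb (k n : seq nat) : nat :=
  \prod_(x <- zip k n) 'C(x.1 + x.2 - 1, x.2).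
Definition oplus (k n : seq nat) : seq nat := [seq (x.1 + x.2)%N | x <- zip k n].

(* sum_{wt n = a} b(k;n) zeta^bullet(k + n; T) : the coefficient of (-x)^a in
   zeta^{x,bullet}_shift(k;T) *)
Definition shift_coef (R : realType) (zr : seq nat -> {poly R}) (k : seq nat) (a : nat)
  : {poly R} :=
  \sum_(n <- comps (size k) a) (binomb k n)%:R * zr (oplus k n).

(* Power series in s,t over R[T1,T2]: coefficient functions  a b |-> [s^a t^b].
   R[T1,T2] is {poly {poly R}}: inner variable T1, outer variable T2.
   A polynomial p(T1) embeds as p%:P, a polynomial q(T2) as q^:P. *)
Definition pseries (R : realType) := nat -> nat -> {poly {poly R}}.

Definition zetaS (R : realType) (zr : seq nat -> {poly R}) (k : seq nat) : pseries R :=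
  fun a b =>
    \sum_(0 <= i < (size k).+1)
      (-1) ^+ (wt (drop i k)) *
      (((-1) ^+ a * shift_coef zr (take i k) a)%:P *
       (shift_coef zr (rev (drop i k)) b)^:P).

Fixpoint coarsenings (k : seq nat) : seq (seq nat) :=
  match k with
  | [::] => [:: [::]]
  | a :: k' =>
    match k' with
    | [::] => [:: [:: a]]
    | _ :: _ => flatten [seq (match l with
                              | [::] => [:: [:: a]]
                              | b :: l' => [:: a :: l; (a + b)%N :: l']
                              end) | l <- coarsenings k']
    end
  end.

Definition zetaSstar (R : realType) (zr : seq nat -> {poly R}) (k : seq nat) : pseries R :=
  fun a b => \sum_(l <- coarsenings k) zetaS zr l a b.

(* Main.v *)
(* Write u = 1/x.  For an increasing finite sequence of points x, partial fractions turn
   [\sum_j u_p^(j+1) u_q^(c-j)] into [(u_p^c - u_q^c) / (x_q - x_p)], so the left-hand side of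
   the cyclic sum formula for star sums over chains [n_1 <= ... <= n_r] telescopes over the
   rotations of the index: what remains is the diagonal term and, for every chain, the weight
   [\sum_(q >= n_r) 1/(x_q - x_(n_1)) - \sum_(p <= n_1) 1/(x_(n_r) - x_p)].

   On the points [1 + s < ... < m + s < - m' + t < ... < - 1 + t], with s and t formal, the star
   sums are the truncations of the two-variable zeta star values, and the series in t and s on
   the right-hand side amount to the weight
   [\sum_(p <= n_1) 1/(x_p - t) + \sum_(q >= n_r) 1/(x_q - s)].  The two weights agree when the
   chain starts at a positive and ends at a negative point.  Otherwise they differ by
   O(n (1/(m+1-n) + 1/(m'+1))), n being the smallest absolute value on the chain (or with m, m'
   exchanged); since some exponent is at least 2, the formula holds for truncated values up to
   powers of logarithms times 1/m + 1/m'.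

   To pass to regularized values, note that the truncated sums satisfy the harmonic product
   exactly, and the shuffle product up to (log m)^q/m when one factor is admissible.  Hence the
   recursion which expresses a regularized value through the values at (1, ..., 1) also gives,
   with the same coefficients, the expansion of the truncated sum, for both products.  The
   difference of the two sides is bilinear in the values in T_1 and in T_2, and the products of
   truncated values at (1, ..., 1) are linearly independent modulo such error terms, so all the
   coefficients of the difference vanish. *)
Require Import Defs.
From HB Require Import structures.
From mathcomp Require Import all_boot all_order all_algebra.
From mathcomp Require Import boolp classical_sets reals topology normedtype sequences.
From mathcomp Require Import qpoly ring lra zify.
Set Implicit Arguments. Unset Strict Implicit. Unset Printing Implicit Defensive.
Import Order.TTheory GRing.Theory Num.Theory numFieldNormedType.Exports.
Local Open Scope ring_scope.

(** * Truncated power series in two variables *)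

Definition trunc_poly (R : comNzRingType) (n : nat) : Type := {poly_n.+1 R}.

Section TruncPoly.
Variables (R : comNzRingType) (n : nat).
Local Notation S := (trunc_poly R n).

HB.instance Definition _ := GRing.Zmodule.on S.

Definition tp_of (p : {poly R}) : S := npolyp n.+1 p.
Definition tp_val (f : S) : {poly R} := f.

Lemma coef_tp_of p i : (i <= n)%N -> (tp_val (tp_of p))`_i = p`_i.
Proof. by move=> le_in; rewrite /tp_val coef_npolyp ltnS le_in. Qed.

Lemma tp_eq (f g : S) : (forall i, (i <= n)%N -> (tp_val f)`_i = (tp_val g)`_i) -> f = g.
Proof.
move=> eq_fg; apply/npolyP => i; have [le_in | lt_ni] := leqP i n; first exact: eq_fg.
by rewrite !big_coef_npoly.
Qed.

Definition tp_mul (f g : S) : S := tp_of (tp_val f * tp_val g).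
Definition tp_one : S := tp_of 1.

Lemma coef_tp_mul f g i : (i <= n)%N ->
  (tp_val (tp_mul f g))`_i = (tp_val f * tp_val g)`_i.
Proof. exact: coef_tp_of. Qed.

(** The coefficient of degree [i] of a product sees its factors only up to degree [i], so truncating
    early is harmless; the ring axioms below rest on this. *)
Lemma coefM_congr (p q p' q' : {poly R}) i :
    (forall j, (j <= i)%N -> p`_j = p'`_j) -> (forall j, (j <= i)%N -> q`_j = q'`_j) ->
  (p * q)`_i = (p' * q')`_i.
Proof.
move=> eqp eqq; rewrite !coefM; apply: eq_bigr => j _.
by rewrite eqp ?eqq ?leq_subr // -ltnS.
Qed.

Lemma tp_mulC : commutative tp_mul.
Proof. by move=> f g; rewrite /tp_mul mulrC. Qed.

Lemma tp_mulA : associative tp_mul.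
Proof.
move=> f g h; apply: tp_eq => i le_in; rewrite !coef_tp_mul //.
transitivity (tp_val f * (tp_val g * tp_val h))`_i.
  by apply: coefM_congr => // j le_ji; rewrite coef_tp_mul // (leq_trans le_ji).
rewrite mulrA; apply: coefM_congr => // j le_ji.
by rewrite coef_tp_mul // (leq_trans le_ji).
Qed.

Lemma tp_mul1 : left_id tp_one tp_mul.
Proof.
move=> f; apply: tp_eq => i le_in; rewrite coef_tp_mul //.
rewrite (@coefM_congr _ _ 1 (tp_val f)) ?mul1r // => j le_ji.
by rewrite coef_tp_of // (leq_trans le_ji).
Qed.

Lemma tp_mulD : left_distributive tp_mul +%R.
Proof.
move=> f g h; apply: tp_eq => i le_in.
by rewrite [in RHS]/tp_val [in RHS]coefD !coef_tp_mul //= mulrDl coefD.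
Qed.

Lemma tp_one_neq0 : tp_one != 0.
Proof.
apply/eqP => /(congr1 (fun f => (tp_val f)`_0)).
rewrite coef_tp_of // coef1 /tp_val /= coef0 => /eqP; exact/negP/oner_neq0.
Qed.

HB.instance Definition _ := GRing.Zmodule_isComNzRing.Build S
  tp_mulA tp_mulC tp_mul1 tp_mulD tp_one_neq0.

Lemma tp_of_is_additive : zmod_morphism tp_of.
Proof.
move=> p q; apply: tp_eq => i le_in.
by rewrite coef_tp_of // [in RHS]/tp_val coefB [in RHS]coefB !coef_tp_of.
Qed.

Lemma tp_of_is_multiplicative : monoid_morphism tp_of.
Proof.
split=> // p q; apply: tp_eq => i le_in; rewrite coef_tp_of // coef_tp_mul //.
by apply: coefM_congr => j le_ji; rewrite coef_tp_of // (leq_trans le_ji).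
Qed.

HB.instance Definition _ := GRing.isZmodMorphism.Build {poly R} S tp_of tp_of_is_additive.
HB.instance Definition _ := GRing.isMonoidMorphism.Build {poly R} S tp_of
  tp_of_is_multiplicative.

Definition tp_var : S := tp_of 'X.

Lemma tp_var_nilp : tp_var ^+ n.+1 = 0.
Proof.
rewrite -rmorphXn; apply: tp_eq => i le_in.
by rewrite coef_tp_of // coefXn ltn_eqF // /tp_val /= coef0.
Qed.

Lemma coefD_tp (f g : S) i : (tp_val (f + g))`_i = (tp_val f)`_i + (tp_val g)`_i.
Proof. exact: coefD. Qed.

End TruncPoly.

Definition submult_norm (K : numDomainType) (S : comNzRingType) (nu : S -> K) :=
  [/\ forall x, 0 <= nu x, nu 0 = 0, forall x, nu (- x) = nu x,
      forall x y, nu (x + y) <= nu x + nu y & forall x y, nu (x * y) <= nu x * nu y].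

Definition tp_norm (K : numDomainType) (R : comNzRingType) (n : nat) (nu : R -> K)
  (f : trunc_poly R n) : K := \sum_(i < n.+1) nu (tp_val f)`_i.

Lemma submult_norm_sum (K : numDomainType) (S : comNzRingType) (nu : S -> K) I (r : seq I)
    (P : pred I) (F : I -> S) :
  submult_norm nu -> nu (\sum_(i <- r | P i) F i) <= \sum_(i <- r | P i) nu (F i).
Proof.
case=> _ nu0 _ nuD _; elim/big_ind2: _ => [|x a y b le_xa le_yb|//]; first by rewrite nu0.
exact: le_trans (nuD _ _) (lerD _ _).
Qed.

Lemma tp_norm_const (K : numDomainType) (R : comNzRingType) n (nu : R -> K) c :
  nu 0 = 0 -> @tp_norm K R n nu (tp_of n c%:P) = nu c.
Proof.
move=> nu0; rewrite /tp_norm big_ord_recl coef_tp_of // coefC eqxx big1 ?addr0 // => i _.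
by rewrite coef_tp_of ?ltn_ord // coefC.
Qed.

Lemma tp_norm_submult (K : numDomainType) (R : comNzRingType) n (nu : R -> K) :
  submult_norm nu -> submult_norm (@tp_norm K R n nu).
Proof.
move=> nuP; have [nu_ge0 nu0 nuN nuD nuM] := nuP; split.
- by move=> f; apply: sumr_ge0.
- by rewrite /tp_norm big1 // => i _; rewrite /tp_val /= coef0.
- by move=> f; apply: eq_bigr => i _; rewrite {1}/tp_val /= coefN nuN.
- by move=> f g; rewrite -big_split; apply: ler_sum => i _; rewrite coefD_tp.
move=> f g; rewrite /tp_norm.
apply: (@le_trans _ _ (\sum_(i < n.+1) \sum_(j < i.+1)
    nu (tp_val f)`_j * nu (tp_val g)`_(i - j))).
  apply: ler_sum => i _; rewrite coef_tp_mul -1?ltnS // coefM.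
  apply: le_trans (submult_norm_sum _ _ _ nuP) _.
  by apply: ler_sum => j _; apply: nuM.
(* The coefficients of F G sum to F(1) G(1), and dropping the nonnegative ones of degree above [n]
   only lowers the sum. *)
pose F := \poly_(i < n.+1) nu (tp_val f)`_i; pose G := \poly_(i < n.+1) nu (tp_val g)`_i.
have eF i : (i < n.+1)%N -> nu (tp_val f)`_i = F`_i by rewrite coef_poly => ->.
have eG i : (i < n.+1)%N -> nu (tp_val g)`_i = G`_i by rewrite coef_poly => ->.
have F_ge0 i : 0 <= F`_i by rewrite coef_poly; case: ifP.
have G_ge0 i : 0 <= G`_i by rewrite coef_poly; case: ifP.
have eval1 (p : {poly K}) : (size p <= n.+1)%N -> \sum_(i < n.+1) p`_i = p.[1].
  by move=> sp; rewrite (horner_coef_wide _ sp); apply: eq_bigr => i _; rewrite expr1n mulr1.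
under [leLHS]eq_bigr => i _.
  under eq_bigr => j _.
    rewrite eF ?eG ?(leq_ltn_trans (leq_subr _ _)) //; last first.
      by rewrite (leq_trans (ltn_ord j)).
    over.
  rewrite -coefM; over.
under [X in _ <= X * _]eq_bigr => i _ do rewrite eF //.
under [X in _ <= _ * X]eq_bigr => i _ do rewrite eG //.
rewrite (eval1 F) ?(eval1 G) ?size_poly // -hornerM (horner_coef (F * G)) /=.
under [leRHS]eq_bigr => i _ do rewrite expr1n mulr1.
have FG_ge0 i : 0 <= (F * G)`_i by rewrite coefM sumr_ge0 // => j _; rewrite mulr_ge0.
have [le_sz | lt_sz] := leqP (size (F * G)%R) n.+1.
  rewrite -(subnKC le_sz) big_split_ord /= [X in _ + X <= _]big1 ?addr0 // => i _.
  by rewrite nth_default // leq_addr.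
by rewrite -(subnKC (ltnW lt_sz)) big_split_ord /= lerDl sumr_ge0.
Qed.

(* [R[s,t]/(s^(a+1), t^(b+1))] with its embedding of scalars, a submultiplicative
   norm, and the functional extracting the coefficient of the top monomial. *)
Record trunc_alg (R : realFieldType) (a b : nat) := TruncAlg {
  ta_ring : comNzRingType;
  ta_in : {rmorphism R -> ta_ring};
  ta_s : ta_ring;
  ta_t : ta_ring;
  ta_norm : ta_ring -> R;
  ta_top : {additive ta_ring -> R};
  ta_s_nilp : ta_s ^+ a.+1 = 0;
  ta_t_nilp : ta_t ^+ b.+1 = 0;
  ta_normP : submult_norm ta_norm;
  ta_norm_in : forall c, ta_norm (ta_in c) <= `|c|;
  ta_top_le : forall x, `|ta_top x| <= ta_norm x;
  ta_top_monom : forall c i j,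
    ta_top (ta_in c * ta_s ^+ i * ta_t ^+ j) = if (i == a) && (j == b) then c else 0
}.

Section TopCoef.
Variables (K : zmodType) (R : comNzRingType) (n : nat) (phi : {additive R -> K}).

Definition tp_top (f : trunc_poly R n) : K := phi (tp_val f)`_n.

Lemma tp_top_additive : zmod_morphism tp_top.
Proof.
by move=> f g; rewrite /tp_top -raddfB; congr (phi _); apply: coefB.
Qed.
HB.instance Definition _ := GRing.isZmodMorphism.Build (trunc_poly R n) K tp_top
  tp_top_additive.

Lemma tp_top_monom c i : tp_top (tp_of n c%:P * tp_var R n ^+ i) = if i == n then phi c else 0.
Proof.
rewrite -rmorphXn -rmorphM /tp_top coef_tp_of // coefCM coefXn eq_sym.
by case: eqP; rewrite ?mulr1 ?mulr0 ?raddf0.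
Qed.

End TopCoef.

Lemma tp_top_le (K : numDomainType) (R : comNzRingType) n (phi : {additive R -> K})
    (nu : R -> K) (f : trunc_poly R n) :
  submult_norm nu -> (forall x, `|phi x| <= nu x) -> `|tp_top phi f| <= tp_norm nu f.
Proof.
case=> nu_ge0 _ _ _ _ le_phi; rewrite /tp_norm (bigD1 (@ord_max n)) //=.
by rewrite (le_trans (le_phi _)) // lerDl sumr_ge0.
Qed.

(** Two truncations in a row: [s] is the variable of the inner ring, [t] that of the outer one, and
    the norm and the top functional are iterated likewise. *)
Lemma trunc_alg_exists (R : realFieldType) (a b : nat) : inhabited (trunc_alg R a b).
Proof.
pose S1 : comNzRingType := trunc_poly R a; pose S2 : comNzRingType := trunc_poly S1 b.
pose emb1 : {rmorphism R -> S1} := tp_of a \o polyC.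
pose emb2 : {rmorphism S1 -> S2} := tp_of b \o polyC.
have nrm0 : submult_norm (fun x : R => `|x|).
  by split=> *; rewrite ?normr_ge0 ?normr0 ?normrN ?normrM ?ler_normD.
have nrm1 : submult_norm (tp_norm Num.norm : S1 -> R) := tp_norm_submult a nrm0.
have nrm2 : submult_norm (tp_norm (tp_norm Num.norm) : S2 -> R) := tp_norm_submult b nrm1.
pose top1 : {additive S1 -> R} := tp_top (idfun : {additive R -> R}).
pose top2 : {additive S2 -> R} := tp_top top1.
constructor.
apply: (@TruncAlg R a b S2 (emb2 \o emb1) (emb2 (tp_var R a)) (tp_var S1 b) _ top2
  _ _ nrm2).
- by rewrite -rmorphXn tp_var_nilp rmorph0.
- exact: tp_var_nilp.
- move=> c; have nrm1_0 := let: And5 _ h _ _ _ := nrm1 in h.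
  have e1 := @tp_norm_const R R a Num.norm c (normr0 _).
  have e2 := @tp_norm_const R S1 b _ (tp_of a c%:P) nrm1_0.
  by rewrite -[leRHS]e1 -[leRHS]e2; apply: lexx.
- by move=> x; apply: tp_top_le => // y; apply: tp_top_le.
move=> c i j.
have -> : (emb2 \o emb1) c * emb2 (tp_var R a) ^+ i * tp_var S1 b ^+ j
    = tp_of b (emb1 c * tp_var R a ^+ i)%:P * tp_var S1 b ^+ j.
  by rewrite !(rmorphM, rmorphXn).
apply: etrans (tp_top_monom b top1 _ j) _; rewrite andbC; case: eqP => // _.
exact: tp_top_monom.
Qed.

(** * Chain sums *)

(** The monomial quasi-symmetric function of index [k] at the points [X]: a strictly increasing
    chain either skips the first point or uses it for the first exponent. *)
Fixpoint qsum (S : comNzRingType) (X : seq S) (k : seq nat) : S :=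
  match X with
  | [::] => if k is [::] then 1 else 0
  | x :: X' => if k is a :: k' then qsum X' k + x ^+ a * qsum X' k' else 1
  end.

Section Qsum.
Variable S : comNzRingType.
Implicit Types (X Y : seq S) (k l : seq nat).

Lemma qsum_nil X : qsum X [::] = 1. Proof. by case: X. Qed.

(** A strict chain is cut where it passes from [X] to [Y]; this deconcatenation becomes the sum over
    [i] in the two-sided zeta values. *)
Lemma qsum_cat X Y k :
  qsum (X ++ Y) k = \sum_(0 <= i < (size k).+1) qsum X (take i k) * qsum Y (drop i k).
Proof.
elim: X k => [|x X IHX] k /=.
  rewrite big_nat_recl // take0 drop0 mul1r big_nat big1 ?addr0 // => i /andP[_ lt_ik].
  by case: k lt_ik => // a k _; rewrite mul0r.
case: k => [|a k]; first by rewrite big_nat1 /= qsum_nil mulr1.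
rewrite !IHX /= big_nat_recl // [RHS]big_nat_recl // !take0 !drop0 qsum_nil /=.
rewrite -addrA; congr (_ + _); rewrite mulr_sumr -big_split; apply: eq_bigr => i _ /=.
by rewrite mulrDl mulrA.
Qed.

Lemma qsum_rcons X x k a :
  qsum (rcons X x) (rcons k a) = qsum X (rcons k a) + qsum X k * x ^+ a.
Proof.
elim: X k => [|y X IHX] [|b k] //=; rewrite ?mul1r ?qsum_nil ?mulr1 ?add0r //.
- by case: k => [|c k] /=; rewrite ?mulr0 ?mul0r.
- by have /= -> := IHX [::]; rewrite qsum_nil mul1r addrAC.
by rewrite -rcons_cons !IHX /=; ring.
Qed.

Lemma qsum_rev X k : qsum (rev X) (rev k) = qsum X k.
Proof.
elim: X k => [|x X IHX] [|a k] //=; rewrite ?qsum_nil //.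
  by rewrite rev_cons; case: (rev k).
by rewrite !rev_cons qsum_rcons -rev_cons !IHX mulrC.
Qed.

Lemma qsum_scale (c : S) X k : qsum [seq c * x | x <- X] k = c ^+ wt k * qsum X k.
Proof.
elim: X k => [|x X IHX] [|a k] /=; rewrite ?mulr1 ?mulr0 //.
by rewrite !IHX exprMn /wt /= exprD; ring.
Qed.

#[local] Arguments stuffle : simpl never.

Lemma stuffle_nill l : stuffle [::] l = [:: l]. Proof. by []. Qed.

Lemma stuffle_nilr k : stuffle k [::] = [:: k]. Proof. by case: k. Qed.

Lemma stuffle_cons a k b l : stuffle (a :: k) (b :: l) =
  map (cons a) (stuffle k (b :: l)) ++ map (cons b) (stuffle (a :: k) l)
    ++ map (cons (a + b)%N) (stuffle k l).
Proof. by []. Qed.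

(** Quasi-shuffle: expand both factors according to whether they use the first point [x]. When both
    do, their exponents add, which is the third kind of term in [stuffle]. *)
Lemma sum_stuffle_qsum X k l : \sum_(w <- stuffle k l) qsum X w = qsum X k * qsum X l.
Proof.
elim: X k l => [|x X IHX] [|a k] [|b l];
  rewrite ?stuffle_nill ?stuffle_nilr ?big_seq1 //= ?mulr1 ?mul1r //.
  by rewrite stuffle_cons !big_cat !big_map /= !big1_eq !addr0 mulr0.
rewrite stuffle_cons !big_cat !big_map /=.
rewrite !big_split /= -!mulr_sumr !IHX.
have := IHX (a :: k) (b :: l); rewrite stuffle_cons !big_cat !big_map /= => IHab.
transitivity (qsum X (a :: k) * qsum X (b :: l) + x ^+ a * (qsum X k * qsum X (b :: l))
  + x ^+ b * (qsum X (a :: k) * qsum X l) + x ^+ (a + b) * (qsum X k * qsum X l)).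
  by rewrite -IHab; ring.
by rewrite exprD; ring.
Qed.

End Qsum.

(* [lsum M u k p G] sums [G n_r * \prod_i u n_i ^+ k_i] over [p <= n_1 <= ... <= n_r < M],
   with [n_r := p] for the empty chain. *)
Fixpoint lsum (S : comNzRingType) (M : nat) (u : nat -> S) (k : seq nat) (p : nat)
    (G : nat -> S) : S :=
  if k is a :: k' then \sum_(p <= n < M) u n ^+ a * lsum M u k' n G else G p.

(** Unlike in [lsum], the weight depends on both ends of the chain; the value at the empty index,
    which has no ends, is a default. *)
Definition wsum (S : comNzRingType) (M : nat) (u : nat -> S) (k : seq nat)
    (F : nat -> nat -> S) : S :=
  if k is a :: k' then \sum_(0 <= n < M) u n ^+ a * lsum M u k' n (F n) else 0.

Section Lsum.
Variables (S : comNzRingType) (M : nat) (u : nat -> S).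
Implicit Types (k : seq nat) (G : nat -> S).
Local Notation lsum := (lsum M u).
Local Notation wsum := (wsum M u).

Lemma lsum_cat k1 k2 p G : lsum (k1 ++ k2) p G = lsum k1 p (fun q => lsum k2 q G).
Proof. by elim: k1 p => //= a k1 IHk p; apply: eq_bigr => n _; rewrite IHk. Qed.

Lemma eq_lsum k p G G' : (p < M)%N ->
  (forall n, (p <= n < M)%N -> G n = G' n) -> lsum k p G = lsum k p G'.
Proof.
elim: k p => /= [|a k IHk] p lt_pM eqG; first by rewrite eqG // leqnn.
apply: eq_big_nat => n /andP[le_pn lt_nM]; rewrite (IHk n) // => j /andP[le_nj lt_jM].
by rewrite eqG // (leq_trans le_pn).
Qed.

Lemma lsum_sum I (r : seq I) (P : pred I) k p (G : I -> nat -> S) :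
  lsum k p (fun n => \sum_(i <- r | P i) G i n) = \sum_(i <- r | P i) lsum k p (G i).
Proof.
elim: k p => //= a k IHk p; rewrite exchange_big; apply: eq_bigr => n _.
by rewrite IHk mulr_sumr.
Qed.

Lemma lsumD k p G G' : lsum k p (fun n => G n + G' n) = lsum k p G + lsum k p G'.
Proof.
elim: k p => //= a k IHk p; rewrite -big_split; apply: eq_bigr => n _.
by rewrite IHk mulrDr.
Qed.

Lemma lsumZ k p c G : lsum k p (fun n => c * G n) = c * lsum k p G.
Proof.
elim: k p => //= a k IHk p; rewrite mulr_sumr; apply: eq_bigr => n _.
by rewrite IHk mulrCA.
Qed.

(** A chain that starts at or after [p] and ends at [p] is constant. *)
Lemma lsum_delta k p c : (p < M)%N ->
  lsum k p (fun n => if n == p then c else 0) = u p ^+ wt k * c.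
Proof.
move=> lt_pM; suff H q : (p <= q < M)%N ->
    lsum k q (fun n => if n == p then c else 0) = if q == p then u p ^+ wt k * c else 0.
  by rewrite H ?leqnn // eqxx.
elim: k q => /= [|a k IHk] q /andP[le_pq lt_qM]; first by rewrite mul1r.
rewrite big_ltn // IHk ?le_pq // big_nat big1 => [|n /andP[lt_qn lt_nM]]; last first.
  by rewrite IHk ?(leq_trans le_pq (ltnW lt_qn)) // gtn_eqF ?mulr0 // (leq_ltn_trans le_pq).
by case: eqP => [->|_]; rewrite ?mulr0 addr0 // /wt /= exprD mulrA.
Qed.

Lemma eq_wsum k F F' :
  (forall a b, (a <= b < M)%N -> F a b = F' a b) -> wsum k F = wsum k F'.
Proof.
case: k => //= a k eqF; apply: eq_big_nat => n /andP[_ lt_nM].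
by congr (_ * _); apply: eq_lsum => // b; apply: eqF.
Qed.

Lemma wsum_sum I (r : seq I) (P : pred I) k (F : I -> nat -> nat -> S) :
  wsum k (fun a b => \sum_(i <- r | P i) F i a b) = \sum_(i <- r | P i) wsum k (F i).
Proof.
case: k => [|a k] /=; first by rewrite big1_eq.
by rewrite exchange_big; apply: eq_bigr => n _; rewrite lsum_sum mulr_sumr.
Qed.

Lemma wsumD k F F' : wsum k (fun a b => F a b + F' a b) = wsum k F + wsum k F'.
Proof.
case: k => [|a k] /=; first by rewrite addr0.
by rewrite -big_split; apply: eq_bigr => n _; rewrite lsumD mulrDr.
Qed.

Lemma wsumZ k c F : wsum k (fun a b => c * F a b) = c * wsum k F.
Proof.
case: k => [|a k] /=; first by rewrite mulr0.
by rewrite mulr_sumr; apply: eq_bigr => n _; rewrite lsumZ mulrCA.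
Qed.

Lemma coarsenings_cons_neq0 a k l : l \in coarsenings (a :: k) -> l != [::].
Proof.
case: k => [|b k]; first by rewrite inE => /eqP->.
case/flatten_mapP => l' _; case: l' => [|d l']; rewrite !inE; first by move/eqP->.
by case/orP => /eqP->.
Qed.

(** A coarsening records which consecutive exponents share a point. A weak chain either avoids [x],
    or uses it for [a] and goes on as a weak chain that may still use [x]. *)
Lemma sum_coarsenings_qsum_cons x X a k :
  \sum_(l <- coarsenings (a :: k)) qsum (x :: X) l
  = \sum_(l <- coarsenings (a :: k)) qsum X l
    + x ^+ a * \sum_(l <- coarsenings k) @qsum S (x :: X) l.
Proof.
case: k => [|b k]; first by rewrite !big_seq1 /= qsum_nil.
rewrite [coarsenings (a :: _)]/= -/(coarsenings (b :: k)) !big_flatten !big_map /=.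
rewrite mulr_sumr -big_split; apply: eq_big_seq => l l_in.
have := coarsenings_cons_neq0 l_in.
case: l {l_in} => // c l _.
by rewrite !big_cons !big_nil /= exprD; ring.
Qed.

Lemma sum_coarsenings_qsum k p : (p <= M)%N ->
  \sum_(l <- coarsenings k) qsum [seq u n | n <- iota p (M - p)] l = lsum k p (fun=> 1).
Proof.
elim: k p => [|a k IHk] p; first by rewrite big_seq1 qsum_nil.
(* With the index fixed, a second induction on the number of points left. *)
move: {-2}(M - p)%N (erefl (M - p)%N) => m; elim: m p => [|m IHm] p eqm le_pM.
  rewrite /= big_geq -?subn_eq0 -?eqm //.
  by rewrite big_seq big1 // => l /coarsenings_cons_neq0; case: l.
have lt_pM : (p < M)%N by rewrite -subn_gt0 -eqm.
rewrite [iota _ _]/= [map _ _]/= sum_coarsenings_qsum_cons [RHS]/= big_ltn // addrC.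
rewrite IHm //; last by rewrite subnS -eqm.
by rewrite -IHk // -eqm.
Qed.

End Lsum.

(** * The cyclic sum identity for finite chains *)

Lemma triangular_swap (S : nmodType) M (F : nat -> nat -> S) :
  \sum_(0 <= p < M) \sum_(p <= n < M) F p n = \sum_(0 <= n < M) \sum_(0 <= p < n.+1) F p n.
Proof.
elim: M => [|M IHM]; first by rewrite !big_nil.
rewrite big_nat_recr //= [RHS]big_nat_recr //= big_nat1 -IHM.
rewrite [X in _ = _ + X]big_nat_recr //= addrA -big_split; congr (_ + _).
by apply: eq_big_nat => p /andP[_ /ltnW le_pM]; rewrite big_nat_recr.
Qed.

Section CyclicSum.
Variables (S : comNzRingType) (M : nat) (u x : nat -> S) (v : nat -> nat -> S).
Hypothesis ux : forall n, (n < M)%N -> u n * x n = 1.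
Hypothesis vx : forall p n, (p < n < M)%N -> v p n * (x n - x p) = 1.
Hypothesis vpp : forall p, v p p = 0.

Local Notation lsum := (lsum M u).
Local Notation wsum := (wsum M u).

(** Rests on u_p u_n = v_pn (u_p - u_n), that is 1/(x y) = (1/x - 1/y)/(y - x), and on the geometric
    factorization of u_p^c - u_n^c. *)
Lemma partial_fraction p n c : (p < n < M)%N ->
  \sum_(0 <= j < c) u p ^+ j.+1 * u n ^+ (c - j) = v p n * (u p ^+ c - u n ^+ c).
Proof.
move=> lt_pnM; have /andP[lt_pn lt_nM] := lt_pnM; have lt_pM := ltn_trans lt_pn lt_nM.
have uu : u p * u n = v p n * (u p - u n).
  transitivity (v p n * (u p * (u n * x n) - u n * (u p * x p))); last by rewrite !ux ?mulr1.
  by rewrite -[LHS]mul1r -(vx lt_pnM); ring.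
rewrite -opprB subrXX -[X in - (X * _)]opprB mulNr opprK mulrA -uu mulr_sumr big_mkord.
apply: eq_bigr => j _; have -> : (c - j = (c.-1 - j).+1)%N by have := ltn_ord j; lia.
by rewrite !exprS; ring.
Qed.

Lemma sum_lsum_start k (G : nat -> nat -> S) : (0 < size k)%N ->
  \sum_(0 <= p < M) lsum k p (G p) = wsum k (fun a b => \sum_(0 <= p < a.+1) G p b).
Proof.
case: k => //= h k _; rewrite triangular_swap; apply: eq_bigr => n _.
by rewrite -mulr_sumr lsum_sum.
Qed.

Lemma lsum_cons_point j k : (0 < size k)%N ->
  lsum (j :: k) 0 (fun=> 1) = wsum k (fun a _ => \sum_(0 <= p < a.+1) u p ^+ j).
Proof.
move=> k_gt0; rewrite -(sum_lsum_start (fun p _ => u p ^+ j)) //=;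
  apply: eq_big_nat => n /andP[_ lt_nM].
by rewrite -(lsumZ _ _ _ _ (u n ^+ j)); apply: eq_lsum => // q _; rewrite mulr1.
Qed.

Lemma lsum_rcons_point j k : (0 < size k)%N ->
  lsum (k ++ [:: j]) 0 (fun=> 1) = wsum k (fun _ b => \sum_(b <= n < M) u n ^+ j).
Proof.
case: k => //= h k _; apply: eq_big_nat => n /andP[_ lt_nM].
congr (_ * _); rewrite lsum_cat; apply: eq_lsum => // b _ /=.
by apply: eq_bigr => q _; rewrite mulr1.
Qed.

Definition upper_ends a b : S := \sum_(b <= n < M) v a n.
Definition lower_ends a b : S := \sum_(0 <= p < a.+1) v p b.

(** Sum over [j] first, with the end points p <= n fixed. For p = n the [c] summands coincide; for p
    < n partial fractions leave the whole exponent [c] on one end, while the other becomes a free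
    point weighted by [v]. *)
Lemma cyclic_sum_term c mid :
  \sum_(0 <= j < c) lsum (j.+1 :: mid ++ [:: c - j]%N) 0 (fun=> 1)
  = wsum (c :: mid) upper_ends - wsum (mid ++ [:: c]) lower_ends
    + c%:R * \sum_(0 <= p < M) u p ^+ (c + wt mid).+1.
Proof.
rewrite /= exchange_big /=.
under eq_bigr => p _.
  under eq_bigr => j _ do rewrite lsum_cat -lsumZ.
  rewrite -lsum_sum; over.
(* As v p p = 0, one formula covers both n = p and n > p. *)
have K p n : (p <= n < M)%N -> \sum_(0 <= j < c) u p ^+ j.+1 * u n ^+ (c - j)
   = (if n == p then c%:R * u p ^+ c.+1 else 0) + u p ^+ c * v p n + - 1 * (u n ^+ c * v p n).
  case/andP; rewrite leq_eqVlt => /orP[/eqP<- _ | lt_pn lt_nM]; last first.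
    by rewrite partial_fraction ?lt_pn // gtn_eqF //; ring.
  rewrite eqxx vpp !mulr0 !addr0 big_mkord.
  under eq_bigr => j _.
    rewrite -exprD addSn subnKC; last exact/ltnW/ltn_ord.
    over.
  by rewrite sumr_const card_ord mulr_natl.
have inner p q : (p < M)%N -> (p <= q < M)%N ->
    \sum_(0 <= j < c) u p ^+ j.+1 * lsum [:: (c - j)%N] q (fun=> 1)
  = (if q == p then c%:R * u p ^+ c.+1 else 0) + u p ^+ c * upper_ends p q
    + - 1 * lsum [:: c] q (v p).
  move=> lt_pM /andP[le_pq lt_qM] /=.
  under eq_bigr => j _ do rewrite mulr_sumr.
  rewrite exchange_big /=.
  transitivity (\sum_(q <= n < M) ((if n == p then c%:R * u p ^+ c.+1 else 0)
      + u p ^+ c * v p n + - 1 * (u n ^+ c * v p n))).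
    apply: eq_big_nat => n /andP[le_qn lt_nM]; rewrite -K ?(leq_trans le_pq) //.
    by apply: eq_bigr => j _; rewrite mulr1.
  rewrite !big_split /= -!mulr_sumr; congr (_ + _ + _).
  rewrite big_ltn // big_nat big1 ?addr0 // => n /andP[lt_qn _].
  by rewrite gtn_eqF // (leq_ltn_trans le_pq).
rewrite big_nat; under eq_bigr => p /andP[_ lt_pM].
  rewrite (eq_lsum _ _ lt_pM (fun q => inner p q lt_pM)) !lsumD !lsumZ lsum_delta // -lsum_cat.
  over.
rewrite -big_nat !big_split /= -mulr_sumr sum_lsum_start ?size_cat ?addn1 //.
rewrite mulN1r -addrA addrC; congr (_ + _).
by rewrite mulr_sumr; apply: eq_bigr => p _; rewrite mulrCA -exprD addnS addnC.
Qed.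

Lemma rot_cons_mid k i : (i < size k)%N ->
  nth 0%N k i :: drop i.+1 k ++ take i k = rot i k.
Proof. by move=> lt_ik; rewrite /rot (drop_nth 0%N lt_ik). Qed.

Lemma rot_rcons_mid k i : (i < size k)%N ->
  (drop i.+1 k ++ take i k) ++ [:: nth 0%N k i] = rot i.+1 k.
Proof. by move=> lt_ik; rewrite /rot (take_nth 0%N lt_ik) -cats1 catA. Qed.

Lemma wt_rot i k : wt (rot i k) = wt k.
Proof. exact/perm_sumn/permPl/perm_rot. Qed.

(** Each term yields upper ends on one rotation of [k] and lower ends on the next, so summing over
    all rotations pairs them. *)
Lemma cyclic_sum_identity k : (0 < size k)%N ->
  \sum_(1 <= i < (size k).+1) \sum_(0 <= j < nth 0%N k i.-1)
    lsum (j.+1 :: drop i k ++ take i.-1 k ++ [:: nth 0%N k i.-1 - j]%N) 0 (fun=> 1)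
  = \sum_(1 <= i < (size k).+1) wsum (rot i k) (fun a b => upper_ends a b - lower_ends a b)
    + (wt k)%:R * lsum [:: (wt k).+1] 0 (fun=> 1).
Proof.
move=> k_gt0; rewrite !big_add1 /=.
under eq_big_nat => i /andP[_ lt_ik].
  under eq_bigr => j _ do rewrite catA.
  rewrite cyclic_sum_term rot_rcons_mid // rot_cons_mid //.
  have -> : (nth 0 k i + wt (drop i.+1 k ++ take i k) = wt k)%N.
    by rewrite -(wt_rot i k) -rot_cons_mid.
  over.
rewrite !big_split /= sumrN -mulr_suml -natr_sum; congr (_ + _); last first.
  congr (_ * _); last by apply: eq_bigr => p _; rewrite mulr1.
  by rewrite /wt sumnE [in RHS](big_nth 0%N).
under [RHS]eq_bigr => i _.
  rewrite (@eq_wsum _ _ _ _ _ (fun a b => upper_ends a b + - 1 * lower_ends a b)); last first.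
    by move=> a b _; rewrite mulN1r.
  rewrite wsumD wsumZ mulN1r; over.
rewrite big_split /= sumrN; congr (_ - _).
(* The upper ends are summed over the rotations 0, ..., r and wanted over 1, ..., r+1; rotations 0
   and r+1 are both [k] itself. *)
case: (size k) k_gt0 (rot_size k) => // r _ rot_r.
by rewrite big_nat_recl // [RHS]big_nat_recr //= rot0 rot_r addrC.
Qed.

End CyclicSum.

(** * Chains on the points n + s and - n + t *)

Section PartialSums.
Variables (S : zmodType) (f : nat -> S).

Definition psum n : S := \sum_(0 <= i < n) f i.

Lemma sum_psum b c : (b <= c)%N -> \sum_(b <= n < c) f n = psum c - psum b.
Proof. by move=> le_bc; rewrite /psum (big_cat_nat (leq0n b) le_bc) /= addrAC subrr add0r. Qed.

End PartialSums.

Lemma sum_addr_psum (S : zmodType) (f : nat -> S) d b c : (b <= c)%N ->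
  \sum_(b <= n < c) f (n + d)%N = psum f (c + d) - psum f (b + d).
Proof.
by move=> le_bc; rewrite -sum_psum ?leq_add2r // big_addn addnK; apply: eq_bigr.
Qed.

Lemma sum_subr_psum (S : zmodType) (f : nat -> S) a b c : (a <= b <= c)%N ->
  \sum_(b <= n < c) f (n - a)%N = psum f (c - a) - psum f (b - a).
Proof.
case/andP=> le_ab le_bc.
rewrite -sum_psum ?leq_sub2r // -{1}(subnK le_ab) big_addn.
by apply: eq_bigr => i _; rewrite addnK.
Qed.

Lemma sum_rev_psum (S : zmodType) (f : nat -> S) d M b c : (b <= c <= M.+1)%N ->
  \sum_(b <= n < c) f (M - n + d)%N = psum f (M.+1 - b + d) - psum f (M.+1 - c + d).
Proof.
case/andP=> le_bc le_cM; rewrite -sum_addr_psum ?leq_sub2l //.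
elim: c le_bc le_cM => [|c IHc] le_bc le_cM.
  by rewrite big_geq // big_geq ?leq_sub2l.
move: le_bc; rewrite leq_eqVlt ltnS => /predU1P[-> | le_bc]; first by rewrite !big_geq.
rewrite big_nat_recr //= IHc ?(ltnW le_cM) // [RHS]big_ltn; last by lia.
by rewrite addrC subSS subSn // -ltnS.
Qed.

Section Points.
Variables (R : realFieldType) (a b : nat) (T : trunc_alg R a b) (m m' : nat).
Local Notation S := (ta_ring T).
Local Notation inj := (ta_in T).
Local Notation s := (ta_s T).
Local Notation t := (ta_t T).
Local Notation M := (m + m')%N.

(* the inverse of [c + e] for a nilpotent [e] *)
Definition ninv (e : S) (c : R) : S :=
  \sum_(0 <= i < (a + b).+2) (- e) ^+ i * inj (c^-1 ^+ i.+1).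

Lemma ninvP e c : e ^+ (a + b).+2 = 0 -> c != 0 -> ninv e c * (inj c + e) = 1.
Proof.
move=> e_nilp c_neq0; have injV : inj c^-1 * inj c = 1.
  by rewrite -rmorphM mulVf ?rmorph1.
have -> : inj c + e = inj c * (1 - (- e * inj c^-1)).
  by rewrite mulrBr mulr1 mulrCA [inj c * _]mulrC injV mulr1 opprK.
have -> : ninv e c = inj c^-1 * \sum_(i < (a + b).+2) (- e * inj c^-1) ^+ i.
  rewrite mulr_sumr /ninv big_mkord; apply: eq_bigr => i _.
  by rewrite exprMn exprS rmorphM rmorphXn mulrCA.
rewrite mulrACA injV mul1r mulrC.
rewrite -[1 - _]opprB -[- (_ - 1)]mulN1r -mulrA -subrX1 exprMn exprNn e_nilp.
by rewrite !mulr0 mul0r sub0r mulrNN mulr1.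
Qed.

Lemma s_nilp : s ^+ (a + b).+2 = 0.
Proof. by rewrite -addSn -addnS exprD ta_s_nilp mul0r. Qed.

Lemma t_nilp : t ^+ (a + b).+2 = 0.
Proof. by rewrite -addSn -addnS exprD (ta_t_nilp T) mulr0. Qed.

(** In each binomial term the exponent of [s] exceeds [a] or that of [t] exceeds [b]. One exponent
    of nilpotency, hence one [ninv], thus serves s, t and s - t. *)
Lemma sBt_nilp : (s - t) ^+ (a + b).+2 = 0.
Proof.
rewrite exprBn big1 // => i _; have [le_ia | lt_ai] := leqP i b.
  have -> : ((a + b).+2 - i = a.+1 + (b.+1 - i))%N by have := ltn_ord i; lia.
  by rewrite exprD ta_s_nilp mul0r mulr0 mul0r mul0rn.
have -> : t ^+ i = 0 by rewrite -(subnKC lt_ai) exprD ta_t_nilp mul0r.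
by rewrite mulr0 mul0rn.
Qed.

(** Two points of the same sign differ by an integer, two points of opposite signs by n + s - t up
    to sign; [hinv] and [winv] invert these two kinds of difference. *)
Definition hinv (n : nat) : S := inj n%:R^-1.
Definition winv (n : nat) : S := ninv (s - t) n%:R.

(* The positions [0, m) carry the values [1 + s, ..., m + s] and the positions
   [m, m + m') the values [- m' + t, ..., - 1 + t]. *)
Definition pt n : S := if (n < m)%N then inj n.+1%:R + s else inj (- (M - n)%:R) + t.
Definition pt_inv n : S := if (n < m)%N then ninv s n.+1%:R else ninv t (- (M - n)%:R).
(* vanishes for [p = n], as [hinv 0 = 0] *)
Definition pt_diff_inv p n : S :=
  if (p < m <= n)%N then - winv (M - n + p.+1) else hinv (n - p).

Lemma hinvP n : (0 < n)%N -> hinv n * inj n%:R = 1.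
Proof. by move=> n_gt0; rewrite -rmorphM mulVf ?rmorph1 // pnatr_eq0 -lt0n. Qed.

Lemma winvP n : (0 < n)%N -> winv n * (inj n%:R + s - t) = 1.
Proof. by move=> n_gt0; rewrite -addrA ninvP ?sBt_nilp // pnatr_eq0 -lt0n. Qed.

Lemma pt_invP n : (n < M)%N -> pt_inv n * pt n = 1.
Proof.
rewrite /pt_inv /pt; case: ifP => [_ _ | _ lt_nM]; apply: ninvP; rewrite ?s_nilp ?t_nilp //.
  by rewrite pnatr_eq0.
by rewrite oppr_eq0 pnatr_eq0 subn_eq0 -ltnNge.
Qed.

Lemma pt_diff_invP p n : (p < n < M)%N -> pt_diff_inv p n * (pt n - pt p) = 1.
Proof.
case/andP=> lt_pn lt_nM; rewrite /pt_diff_inv /pt.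
case: ltnP => [lt_pm | le_mp] /=; case: ltnP => [lt_nm | le_mn].
- rewrite -(@hinvP (n - p)) ?subn_gt0 // opprD addrACA subrr addr0 -rmorphB natrB ?(ltnW lt_pn) //.
  by congr (_ * inj _); rewrite (mulrS _ n) (mulrS _ p); ring.
- rewrite -(@winvP (M - n + p.+1)) ?addnS // mulNr -mulrN; congr (_ * _).
  by rewrite -addnS natrD rmorphN rmorphD /=; ring.
- by have := ltn_trans lt_pn lt_nm; rewrite ltnNge le_mp.
rewrite -(@hinvP (n - p)) ?subn_gt0 // opprD addrACA subrr addr0 -rmorphB.
congr (_ * inj _); rewrite !natrB ?(ltnW lt_pn) //; [ring | lia | lia].
Qed.

Lemma pt_diff_inv0 p : pt_diff_inv p p = 0.
Proof.
rewrite /pt_diff_inv; case: ifP => [/andP[lt_pm le_mp] | _]; first by lia.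
by rewrite subnn /hinv invr0 rmorph0.
Qed.

Lemma inv_uniq (x y z : S) : x * y = 1 -> z * y = 1 -> x = z.
Proof. by move=> xy zy; rewrite -[x]mul1r -zy mulrAC -mulrA xy mulr1. Qed.

Lemma geometric_inv (e x y : S) n : e ^+ n = 0 -> y * x = 1 ->
  (\sum_(0 <= j < n) e ^+ j * y ^+ j.+1) * (x - e) = 1.
Proof.
move=> e_nilp yx.
have -> : x - e = x * (1 - e * y) by rewrite mulrBr mulr1 mulrCA [x * y]mulrC yx mulr1.
have -> : \sum_(0 <= j < n) e ^+ j * y ^+ j.+1 = y * \sum_(j < n) (e * y) ^+ j.
  by rewrite mulr_sumr big_mkord; apply: eq_bigr => j _; rewrite exprMn exprS mulrCA.
rewrite mulrACA yx mul1r mulrC.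
rewrite -[1 - _]opprB -[- (_ - 1)]mulN1r -mulrA -subrX1 exprMn e_nilp mul0r.
by rewrite sub0r mulrNN mulr1.
Qed.

(** Geometric series, finite since t^(b+1) = 0 and s^(a+1) = 0: [alpha p] is 1/(x_p - t) and
    [beta p] is 1/(x_p - s). *)
Definition alpha p : S := \sum_(0 <= j < b.+1) t ^+ j * pt_inv p ^+ j.+1.
Definition beta p : S := \sum_(0 <= j < a.+1) s ^+ j * pt_inv p ^+ j.+1.

Lemma hinvN n : (0 < n)%N -> - hinv n * inj (- n%:R) = 1.
Proof. by move=> n_gt0; rewrite rmorphN mulrNN hinvP. Qed.

Lemma winvN n : (0 < n)%N -> - winv n * (inj (- n%:R) + t - s) = 1.
Proof. by move=> n_gt0; rewrite -(winvP n_gt0) rmorphN mulNr -mulrN; congr (_ * _); ring. Qed.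

Lemma alphaE p : (p < M)%N -> alpha p = if (p < m)%N then winv p.+1 else - hinv (M - p).
Proof.
move=> lt_pM; have H := geometric_inv (ta_t_nilp T) (pt_invP lt_pM).
apply: (inv_uniq H); rewrite /pt; case: ifP => _; first exact: winvP.
by rewrite addrK hinvN ?subn_gt0.
Qed.

Lemma betaE p : (p < M)%N -> beta p = if (p < m)%N then hinv p.+1 else - winv (M - p).
Proof.
move=> lt_pM; have H := geometric_inv (ta_s_nilp T) (pt_invP lt_pM).
apply: (inv_uniq H); rewrite /pt; case: ifP => _; last by rewrite winvN ?subn_gt0.
by rewrite addrK hinvP.
Qed.

Lemma sum_alpha i : (i < M)%N -> \sum_(0 <= p < i.+1) alpha p =
  if (i < m)%N then psum winv i.+2 - psum winv 1
  else psum winv m.+1 - psum winv 1 - (psum hinv m'.+1 - psum hinv (M - i)).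
Proof.
move=> lt_iM; rewrite (eq_big_nat _ _ (fun p H => alphaE _)); last by move=> p; lia.
have head q : (q <= m)%N -> \sum_(0 <= p < q) (if (p < m)%N then winv p.+1 else - hinv (M - p))
    = psum winv q.+1 - psum winv 1.
  move=> le_qm; rewrite -addn1 -(sum_addr_psum winv 1 (leq0n q)).
  by apply: eq_big_nat => p lt_p; rewrite addn1 ifT //; lia.
case: ltnP => [lt_im | le_mi]; first exact: head.
rewrite (big_cat_nat (n := m)) //= ?(leqW le_mi) // head //; congr (_ + _).
rewrite (eq_big_nat _ _ (F2 := fun p => - hinv (M - p + 0))); last first.
  by move=> p lt_p; rewrite addn0 ifF //; lia.
rewrite sumrN sum_rev_psum; last by lia.
by rewrite !addn0; congr (- (psum _ _ - psum _ _)); lia.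
Qed.

Lemma sum_beta j : (j < M)%N -> \sum_(j <= n < M) beta n =
  if (j < m)%N then psum hinv m.+1 - psum hinv j.+1 - (psum winv m'.+1 - psum winv 1)
  else - (psum winv (M.+1 - j) - psum winv 1).
Proof.
move=> lt_jM; rewrite (eq_big_nat _ _ (fun p H => betaE _)); last by move=> p; lia.
have tail q : (m <= q <= M)%N ->
    \sum_(q <= n < M) (if (n < m)%N then hinv n.+1 else - winv (M - n))
    = - (psum winv (M.+1 - q) - psum winv 1).
  move=> le_q; rewrite (eq_big_nat _ _ (F2 := fun p => - winv (M - p + 0))); last first.
    by move=> p lt_p; rewrite addn0 ifF //; lia.
  rewrite sumrN sum_rev_psum; last by lia.
  by rewrite !addn0; congr (- (psum _ _ - psum _ _)); lia.
case: ltnP => [lt_jm | le_mj]; last by rewrite tail // le_mj ltnW.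
rewrite (big_cat_nat (n := m)) ?leq_addr ?(ltnW lt_jm) //= tail ?leqnn ?leq_addr //.
congr (_ + _); last by congr (- (psum _ _ - _)); lia.
rewrite -(addn1 m) -(addn1 j) -(sum_addr_psum hinv 1 (ltnW lt_jm)).
by apply: eq_big_nat => p lt_p; rewrite addn1 ifT //; lia.
Qed.

Lemma upper_endsE i j : (i <= j < M)%N -> upper_ends M pt_diff_inv i j =
  if (j < m)%N then psum hinv (m - i) - psum hinv (j - i)
                    - (psum winv (m'.+1 + i.+1) - psum winv i.+2)
  else if (i < m)%N then - (psum winv (M.+1 - j + i.+1) - psum winv i.+2)
  else psum hinv (M - i) - psum hinv (j - i).
Proof.
case/andP=> le_ij lt_jM; rewrite /upper_ends /pt_diff_inv.
have tail q : (i < m <= q)%N -> (q <= M)%N ->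
    \sum_(q <= n < M) (if (i < m <= n)%N then - winv (M - n + i.+1) else hinv (n - i))
    = - (psum winv (M.+1 - q + i.+1) - psum winv i.+2).
  move=> lt_i le_qM; rewrite (eq_big_nat _ _ (F2 := fun p => - winv (M - p + i.+1))); last first.
    by move=> p lt_p; rewrite ifT //; lia.
  rewrite sumrN sum_rev_psum; last by lia.
  by congr (- (psum _ _ - psum _ _)); lia.
have [lt_jm | le_mj] := ltnP j m.
  rewrite (big_cat_nat (n := m)) ?leq_addr ?(ltnW lt_jm) //=.
  rewrite tail ?(leq_ltn_trans le_ij lt_jm) ?leqnn ?leq_addr //.
  congr (_ + _); last by congr (- (psum _ _ - _)); lia.
  rewrite -sum_subr_psum ?le_ij ?(ltnW lt_jm) //.
  by apply: eq_big_nat => p lt_p; rewrite ifF //; lia.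
have /orP[lt_im | le_mi] : (i < m)%N || (m <= i)%N by case: ltnP.
  by rewrite tail ?lt_im ?(ltnW lt_jM).
rewrite ltnNge le_mi /=.
by rewrite -sum_subr_psum ?le_ij ?(ltnW lt_jM).
Qed.

Lemma lower_endsE i j : (i <= j < M)%N -> lower_ends pt_diff_inv i j =
  if (j < m)%N then psum hinv j.+1 - psum hinv (j - i)
  else if (i < m)%N then - (psum winv (M - j + i.+2) - psum winv (M - j).+1)
  else - (psum winv (M - j + m.+1) - psum winv (M - j).+1)
       + (psum hinv (j.+1 - m) - psum hinv (j - i)).
Proof.
case/andP=> le_ij lt_jM; rewrite /lower_ends /pt_diff_inv.
have head q : (q <= m <= j)%N ->
    \sum_(0 <= p < q) (if (p < m <= j)%N then - winv (M - j + p.+1) else hinv (j - p))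
    = - (psum winv (M - j + q.+1) - psum winv (M - j).+1).
  move=> le_q; rewrite (eq_big_nat _ _ (F2 := fun p => - winv (p + (M - j).+1))); last first.
    by move=> p lt_p; rewrite ifT; [rewrite addnC addSnnS | lia].
  by rewrite sumrN sum_addr_psum // add0n addnC addSnnS.
have tail q : (q <= i.+1)%N -> (j < m)%N || (m <= q)%N ->
    \sum_(q <= p < i.+1) (if (p < m <= j)%N then - winv (M - j + p.+1) else hinv (j - p))
    = psum hinv (j.+1 - q) - psum hinv (j - i).
  move=> le_q cond; rewrite (eq_big_nat _ _ (F2 := fun p => hinv (j - p + 0))); last first.
    by move=> p lt_p; rewrite addn0 ifF //; lia.
  by rewrite sum_rev_psum ?le_q // !addn0 subSS.
have /orP[lt_jm | le_mj] : (j < m)%N || (m <= j)%N by case: ltnP.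
  by rewrite lt_jm tail ?lt_jm // subn0.
rewrite [X in _ = X]ifF; last by lia.
have /orP[lt_im | le_mi] : (i < m)%N || (m <= i)%N by case: ltnP.
  by rewrite lt_im head // lt_im.
rewrite [X in _ = X]ifF; last by lia.
rewrite (big_cat_nat (n := m)) ?(leqW le_mi) //=.
by rewrite head ?leqnn // tail ?(leqW le_mi) // leqnn orbT.
Qed.

Definition ends_error i j : S :=
  upper_ends M pt_diff_inv i j - lower_ends pt_diff_inv i j
  - \sum_(0 <= p < i.+1) alpha p - \sum_(j <= n < M) beta n.

(** The weights cancel on chains going from positive to negative points. Otherwise there remain sums
    of [hinv] and [winv] over i + 1, respectively M - j, consecutive integers; this number is the
    absolute value at the end of the chain closest to 0. *)
Lemma ends_errorE i j : (i <= j < M)%N -> ends_error i j =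
  if (j < m)%N then psum hinv (m - i) - psum hinv m.+1
                    + (psum winv m'.+1 - psum winv (m'.+1 + i.+1))
  else if (i < m)%N then 0
  else psum hinv m'.+1 - psum hinv (j.+1 - m)
       + (psum winv (M - j + m.+1) - psum winv m.+1).
Proof.
move=> lt_ijM; have [le_ij lt_jM] := andP lt_ijM; have lt_iM := leq_ltn_trans le_ij lt_jM.
rewrite /ends_error upper_endsE // lower_endsE // sum_alpha // sum_beta //.
have [lt_jm | le_mj] := ltnP j m; first by rewrite (leq_ltn_trans le_ij lt_jm); ring.
rewrite (subSn (ltnW lt_jM)); have [lt_im | le_mi] := ltnP i m; last by ring.
by rewrite addSn !addnS; ring.
Qed.

(** An extra point before the first or after the last one is an end weight, which the series in t^j
    and s^j turn into [alpha] and [beta]; the rest of the end weight is [ends_error]. *)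
Lemma cyclic_sum_points k : (0 < size k)%N ->
  \sum_(1 <= i < (size k).+1) \sum_(0 <= j < nth 0%N k i.-1)
    lsum M pt_inv (j.+1 :: drop i k ++ take i.-1 k ++ [:: nth 0%N k i.-1 - j]%N) 0 (fun=> 1)
  = \sum_(1 <= i < (size k).+1)
      (\sum_(0 <= j < b.+1) t ^+ j * lsum M pt_inv (j.+1 :: rot i k) 0 (fun=> 1)
       + \sum_(0 <= j < a.+1) s ^+ j * lsum M pt_inv (rot i k ++ [:: j.+1]) 0 (fun=> 1))
    + (wt k)%:R * lsum M pt_inv [:: (wt k).+1] 0 (fun=> 1)
    + \sum_(1 <= i < (size k).+1) wsum M pt_inv (rot i k) ends_error.
Proof.
move=> k_gt0; rewrite (cyclic_sum_identity pt_invP pt_diff_invP pt_diff_inv0 k_gt0).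
rewrite [RHS]addrAC -big_split /=; congr (_ + _); apply: eq_bigr => i _.
have rot_gt0 : (0 < size (rot i k))%N by rewrite size_rot.
rewrite (eq_bigr _ (fun j _ => congr1 (fun z => t ^+ j * z) (lsum_cons_point M pt_inv j.+1
  rot_gt0))).
rewrite [in RHS](eq_bigr _ (fun j _ => congr1 (fun z => s ^+ j * z)
  (lsum_rcons_point M pt_inv j.+1 rot_gt0))).
under eq_bigr => j _ do rewrite -wsumZ.
under [X in _ + X + _]eq_bigr => j _ do rewrite -wsumZ.
rewrite -!wsum_sum -!wsumD; apply: eq_wsum => p q _.
rewrite /ends_error /alpha /beta.
have -> : \sum_(0 <= j < b.+1) t ^+ j * (\sum_(0 <= n < p.+1) pt_inv n ^+ j.+1)
   = \sum_(0 <= n < p.+1) \sum_(0 <= j < b.+1) t ^+ j * pt_inv n ^+ j.+1.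
  by rewrite exchange_big; apply: eq_bigr => j _; rewrite mulr_sumr.
have -> : \sum_(0 <= j < a.+1) s ^+ j * (\sum_(q <= n < M) pt_inv n ^+ j.+1)
   = \sum_(q <= n < M) \sum_(0 <= j < a.+1) s ^+ j * pt_inv n ^+ j.+1.
  by rewrite exchange_big; apply: eq_bigr => j _; rewrite mulr_sumr.
ring.
Qed.

End Points.

(** * Bounds on chain sums *)

Definition harm (R : realFieldType) (m : nat) : R := \sum_(1 <= i < m.+1) i%:R^-1.

Lemma harmE (R : realFieldType) m : harm R m = \sum_(0 <= i < m) i.+1%:R^-1.
Proof. by rewrite /harm big_add1. Qed.

Lemma harm_ge0 (R : realFieldType) m : 0 <= harm R m.
Proof. by apply: sumr_ge0 => i _; rewrite invr_ge0 ler0n. Qed.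

Lemma harm_reflect (R : realFieldType) m : \sum_(0 <= n < m) (m - n)%:R^-1 = harm R m.
Proof.
rewrite big_nat_rev harmE; apply: eq_big_nat => i /andP[_ lt_im].
by congr (_%:R^-1); lia.
Qed.

(** Partial fractions: 1/((n+1)(m-n)) = (1/(n+1) + 1/(m-n))/(m+1). *)
Lemma sum_harm_convolution (R : realFieldType) m :
  \sum_(0 <= n < m) n.+1%:R^-1 * (m - n)%:R^-1 = 2 * harm R m / m.+1%:R.
Proof.
transitivity (\sum_(0 <= n < m) (n.+1%:R^-1 + (m - n)%:R^-1) / m.+1%:R : R).
  apply: eq_big_nat => n /andP[_ lt_nm].
  have -> : m.+1%:R = n.+1%:R + (m - n)%:R :> R by rewrite -natrD; congr _%:R; lia.
  have n_neq0 : n.+1%:R != 0 :> R by rewrite pnatr_eq0.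
  have mn_neq0 : (m - n)%:R != 0 :> R by rewrite pnatr_eq0 -lt0n subn_gt0.
  have sum_neq0 : n.+1%:R + (m - n)%:R != 0 :> R by rewrite -natrD pnatr_eq0.
  move: n_neq0 mn_neq0 sum_neq0; move: (n.+1%:R) ((m - n)%:R) => x y x_neq0 y_neq0 xy_neq0.
  by field; rewrite x_neq0 y_neq0 xy_neq0.
by rewrite -mulr_suml big_split /= harm_reflect -harmE; ring.
Qed.

Section RealChains.
Variables (R : realFieldType) (M : nat) (u : nat -> R).
Hypothesis u01 : forall n, (n < M)%N -> 0 <= u n <= 1.

Lemma lsum_ge0 k p G : (forall n, 0 <= G n) -> (p < M)%N -> 0 <= lsum M u k p G.
Proof.
move=> G_ge0; elim: k p => //= a k IHk p lt_pM.
rewrite big_nat; apply: sumr_ge0 => n /andP[_ lt_nM].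
by rewrite mulr_ge0 ?IHk // exprn_ge0 //; case/andP: (u01 lt_nM).
Qed.

Lemma le_lsum k p G G' : (p < M)%N -> (forall n, (p <= n < M)%N -> G n <= G' n) ->
  lsum M u k p G <= lsum M u k p G'.
Proof.
elim: k p => /= [|a k IHk] p lt_pM leG; first by rewrite leG ?leqnn.
rewrite big_nat [leRHS]big_nat; apply: ler_sum => n /andP[le_pn lt_nM].
have /andP[un_ge0 _] := u01 lt_nM; rewrite ler_wpM2l ?exprn_ge0 // IHk // => j /andP[le_nj].
by apply: (fun h => leG _ (introT andP (conj (leq_trans le_pn le_nj) h))).
Qed.

Lemma lsum_le_ones k p G : is_index k -> (forall n, 0 <= G n) -> (p < M)%N ->
  lsum M u k p G <= lsum M u (nseq (size k) 1%N) p G.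
Proof.
move=> + G_ge0; elim: k p => //= a k IHk p /andP[a_gt0 k_idx] lt_pM.
rewrite big_nat [leRHS]big_nat; apply: ler_sum => n /andP[_ lt_nM].
have /andP[un_ge0 un_le1] := u01 lt_nM.
apply: ler_pM; rewrite ?exprn_ge0 ?lsum_ge0 ?IHk //.
by rewrite -(prednK a_gt0) exprS ler_piMr ?expr1 ?exprn_ile1.
Qed.

(* An exponent [>= 2] absorbs a factor [w n] of the end weight; this is where the
   hypothesis that the weight exceeds the depth is used. *)
Lemma lsum_absorb (w : nat -> R) k p G0 G : is_index k -> has (leq 2) k -> (p < M)%N ->
    (forall n, (n < M)%N -> u n * w n = 1) -> (forall n, 0 <= G n) ->
    (forall n, 0 <= G0 n) ->
    (forall n j, (p <= n <= j)%N -> (j < M)%N -> G0 j <= w n * G j) ->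
  lsum M u k p G0 <= lsum M u (nseq (size k) 1%N) p G.
Proof.
move=> + + + uw G_ge0 G0_ge0; elim: k p => //= a k IHk p /andP[a_gt0 k_idx] has2 lt_pM leG.
rewrite big_nat [leRHS]big_nat; apply: ler_sum => n /andP[le_pn lt_nM].
have /andP[un_ge0 un_le1] := u01 lt_nM; rewrite expr1.
have [a_gt1 | a_le1] := ltnP 1 a; last first.
  have -> : a = 1%N by lia.
  rewrite expr1 ler_wpM2l // IHk //; first by move: has2; rewrite ltnNge a_le1.
  by move=> q j /andP[le_nq le_qj]; apply: leG; rewrite (leq_trans le_pn).
have -> : u n * lsum M u (nseq (size k) 1%N) n G
    = u n ^+ 2 * lsum M u (nseq (size k) 1%N) n (fun j => w n * G j).
  by rewrite lsumZ expr2 mulrA -(mulrA (u n) (u n)) uw // mulr1.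
apply: ler_pM; rewrite ?exprn_ge0 ?lsum_ge0 //.
  by rewrite -(subnKC a_gt1) exprD ler_piMr ?exprn_ge0 ?exprn_ile1.
apply: (le_trans (lsum_le_ones k_idx G0_ge0 lt_nM)); apply: le_lsum => // j /andP[le_nj].
by apply: leG; rewrite le_pn le_nj.
Qed.

Let H := \sum_(0 <= n < M) u n.

Lemma sum_u_ge0 : 0 <= H.
Proof. by rewrite /H big_nat sumr_ge0 // => n /andP[_ /u01/andP[]]. Qed.

Lemma sum_tail_le (F : nat -> R) p : (forall n, (n < M)%N -> 0 <= F n) ->
  \sum_(p <= n < M) F n <= \sum_(0 <= n < M) F n.
Proof.
move=> F_ge0; have [le_pM | lt_Mp] := leqP p M; last first.
  by rewrite big_geq ?(ltnW lt_Mp) // big_nat sumr_ge0 // => n /andP[_ /F_ge0].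
rewrite (big_cat_nat (leq0n p) le_pM) /= lerDr big_nat sumr_ge0 // => n /andP[_ lt_np].
exact/F_ge0/(leq_trans lt_np).
Qed.

Lemma lsum_ones_const r p c : 0 <= c -> (p < M)%N ->
  lsum M u (nseq r 1%N) p (fun=> c) <= H ^+ r * c.
Proof.
move=> c_ge0; elim: r p => [|r IHr] p lt_pM /=; first by rewrite expr0 mul1r.
rewrite exprS -mulrA {1}/H mulr_suml; apply: le_trans (sum_tail_le p _); last first.
  by move=> n /u01/andP[un_ge0 _]; rewrite !mulr_ge0 ?exprn_ge0 ?sum_u_ge0.
rewrite [leLHS]/= big_nat [leRHS]big_nat; apply: ler_sum => n /andP[_ lt_nM].
by have /andP[un_ge0 _] := u01 lt_nM; rewrite expr1 ler_wpM2l // IHr.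
Qed.

Lemma lsum_ones_last r p G : (forall n, 0 <= G n) -> (p < M)%N ->
  lsum M u (nseq r.+1 1%N) p G <= H ^+ r * \sum_(0 <= n < M) u n * G n.
Proof.
move=> G_ge0; elim: r p => [|r IHr] p lt_pM.
  rewrite /= expr0 mul1r; apply: le_trans (sum_tail_le p _); last first.
    by move=> n /u01/andP[un_ge0 _]; rewrite mulr_ge0.
  by apply: ler_sum => n _; rewrite expr1.
have tot_ge0 : 0 <= \sum_(0 <= n < M) u n * G n.
  by rewrite big_nat sumr_ge0 // => n /andP[_ /u01/andP[un_ge0 _]]; rewrite mulr_ge0.
rewrite exprS -mulrA {1}/H mulr_suml; apply: le_trans (sum_tail_le p _); last first.
  by move=> n /u01/andP[un_ge0 _]; rewrite !mulr_ge0 ?exprn_ge0 ?sum_u_ge0.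
rewrite [leLHS]/= big_nat [leRHS]big_nat; apply: ler_sum => n /andP[_ lt_nM].
by have /andP[un_ge0 _] := u01 lt_nM; rewrite expr1 ler_wpM2l // IHr.
Qed.

(** An exponent at least 2 sits at some point n between the ends i and j, where one u n cancels w n.
    There remain chains with all exponents 1, weighted by [G] at one of the two ends (whence the
    factor 2), each other point costing a factor [H]. *)
Lemma wsum_absorb (w G : nat -> R) (F : nat -> nat -> R) k :
    is_index k -> has (leq 2) k ->
    (forall n, (n < M)%N -> u n * w n = 1) -> (forall n, 0 <= G n) ->
    (forall i j, 0 <= F i j) ->
    (forall i n j, (i <= n <= j)%N -> (j < M)%N -> F i j <= w n * (G i + G j)) ->
  wsum M u k F <= 2 * H ^+ (size k).-1 * \sum_(0 <= n < M) u n * G n.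
Proof.
case: k => // a k; rewrite /= => /andP[a_gt0 k_idx] has2 uw G_ge0 F_ge0 leF.
have step n : (n < M)%N -> u n ^+ a * lsum M u k n (F n)
    <= u n * lsum M u (nseq (size k) 1%N) n (fun j => G n + G j).
  move=> lt_nM; have /andP[un_ge0 un_le1] := u01 lt_nM.
  have GG_ge0 j : 0 <= G n + G j by rewrite addr_ge0.
  (* If the first exponent is 1, the absorbing one lies further along and [lsum_absorb] finds it;
     otherwise the first point itself absorbs [w n]. *)
  have [a_gt1 | a_le1] := ltnP 1 a; last first.
    have -> : a = 1%N by lia.
    rewrite expr1 ler_wpM2l // (@lsum_absorb w) //; first by move: has2; rewrite ltnNge a_le1.
    by move=> q j /andP[le_nq le_qj]; apply: leF; rewrite le_nq.
  have -> : u n * lsum M u (nseq (size k) 1%N) n (fun j => G n + G j)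
      = u n ^+ 2 * lsum M u (nseq (size k) 1%N) n (fun j => w n * (G n + G j)).
    by rewrite lsumZ expr2 mulrA -(mulrA (u n) (u n)) uw // mulr1.
  apply: ler_pM; rewrite ?exprn_ge0 ?lsum_ge0 //.
    by rewrite -(subnKC a_gt1) exprD ler_piMr ?exprn_ge0 ?exprn_ile1.
  apply: (le_trans (lsum_le_ones k_idx (F_ge0 n) lt_nM)).
  apply: le_lsum => // j /andP[le_nj].
  by apply: leF; rewrite leqnn le_nj.
rewrite big_nat; apply: le_trans (ler_sum _ (fun n H => step n (proj2 (andP H)))) _.
rewrite -big_nat; under eq_bigr => n _ do rewrite lsumD mulrDr.
rewrite big_split /= -mulrA mulr_natl mulr2n; apply: lerD.
  rewrite mulr_sumr big_nat [leRHS]big_nat; apply: ler_sum => n /andP[_ lt_nM].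
  by have /andP[un_ge0 _] := u01 lt_nM; rewrite mulrCA ler_wpM2l ?lsum_ones_const.
case: (posnP M) => [M0 | M_gt0]; first by rewrite !big_geq ?M0 // mulr0.
have /= := lsum_ones_last (size k) G_ge0 M_gt0; apply: le_trans.
by apply: ler_sum => n _; rewrite expr1.
Qed.

End RealChains.

Section NormChains.
Variables (R : realFieldType) (S : comNzRingType) (nu : S -> R).
Hypothesis nuP : submult_norm nu.
Hypothesis nu1 : nu 1 <= 1.
Variables (M : nat) (u : nat -> S) (u' : nat -> R).
Hypothesis le_u : forall n, (n < M)%N -> nu (u n) <= u' n.

Let nu_ge0 : forall x, 0 <= nu x := let: And5 h _ _ _ _ := nuP in h.
Let nuM : forall x y, nu (x * y) <= nu x * nu y := let: And5 _ _ _ _ h := nuP in h.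

Lemma norm_exp x n : nu (x ^+ n) <= nu x ^+ n.
Proof.
elim: n => [|n IHn]; first by rewrite !expr0.
by rewrite !exprS; apply: le_trans (nuM _ _) _; rewrite ler_wpM2l.
Qed.

Lemma norm_lsum k p G : (p < M)%N -> nu (lsum M u k p G) <= lsum M u' k p (nu \o G).
Proof.
elim: k p => //= a k IHk p lt_pM; apply: le_trans (submult_norm_sum _ _ _ nuP) _.
rewrite [leLHS]big_nat [leRHS]big_nat; apply: ler_sum => n /andP[_ lt_nM].
apply: le_trans (nuM _ _) _; apply: ler_pM; rewrite ?IHk //.
apply: le_trans (norm_exp _ _) _; apply: lerXn2r; rewrite ?nnegrE ?le_u //.
by rewrite (le_trans (nu_ge0 (u n)) (le_u lt_nM)).
Qed.

Lemma norm_wsum k F : nu (wsum M u k F) <= wsum M u' k (fun i j => nu (F i j)).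
Proof.
case: k => /= [|a k]; first by case: nuP => _ -> _ _ _.
apply: le_trans (submult_norm_sum _ _ _ nuP) _.
rewrite [leLHS]big_nat [leRHS]big_nat; apply: ler_sum => n /andP[_ lt_nM].
apply: le_trans (nuM _ _) _; apply: ler_pM; rewrite ?norm_lsum //.
apply: le_trans (norm_exp _ _) _; apply: lerXn2r; rewrite ?nnegrE ?le_u //.
by rewrite (le_trans (nu_ge0 (u n)) (le_u lt_nM)).
Qed.

End NormChains.

Lemma lsum_scale (S : comNzRingType) M (u : nat -> S) c k p G :
  lsum M (fun n => c * u n) k p G = c ^+ wt k * lsum M u k p G.
Proof.
elim: k p => [|a k IHk] p /=; first by rewrite mul1r.
rewrite mulr_sumr; apply: eq_bigr => n _.
by rewrite IHk exprMn /wt /= exprD; ring.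
Qed.

Lemma wsum_scale (S : comNzRingType) M (u : nat -> S) c k F :
  wsum M (fun n => c * u n) k F = c ^+ wt k * wsum M u k F.
Proof.
case: k => [|a k] /=; first by rewrite mulr0.
rewrite mulr_sumr; apply: eq_bigr => n _.
by rewrite lsum_scale exprMn /wt /= exprD; ring.
Qed.

(** * Norm of the error in the end weights *)

Section ErrorBound.
Variables (R : realFieldType) (a b : nat) (T : trunc_alg R a b).
Local Notation nu := (@ta_norm R a b T).

Let nuP : submult_norm nu := ta_normP T.
Let nu_ge0 : forall x, 0 <= nu x := let: And5 h _ _ _ _ := nuP in h.
Let nuN : forall x, nu (- x) = nu x := let: And5 _ _ h _ _ := nuP in h.
Let nuD : forall x y, nu (x + y) <= nu x + nu y := let: And5 _ _ _ h _ := nuP in h.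
Let nuM : forall x y, nu (x * y) <= nu x * nu y := let: And5 _ _ _ _ h := nuP in h.

Lemma ta_norm1 : nu 1 <= 1.
Proof. by have := ta_norm_in T 1; rewrite rmorph1 normr1. Qed.

Definition ninv_cst (e : ta_ring T) : R := \sum_(0 <= i < (a + b).+2) nu ((- e) ^+ i).

Lemma ninv_cst_ge0 e : 0 <= ninv_cst e.
Proof. by rewrite sumr_ge0. Qed.

Lemma norm_ninv e c : 1 <= `|c| -> nu (ninv e c) <= ninv_cst e / `|c|.
Proof.
move=> c_ge1; apply: le_trans (submult_norm_sum _ _ _ nuP) _.
rewrite mulr_suml; apply: ler_sum => i _; apply: le_trans (nuM _ _) _.
apply: ler_wpM2l => //; apply: le_trans (ta_norm_in T _) _.
have c_gt0 : 0 < `|c| := lt_le_trans ltr01 c_ge1.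
by rewrite normrX normfV exprS ler_piMr ?exprn_ile1 ?invr_ge0 ?invf_le1.
Qed.

(** One constant for all inverses in use; the summand 1 serves [hinv]. *)
Definition err_cst : R :=
  ninv_cst (ta_s T) + ninv_cst (ta_t T) + ninv_cst (ta_s T - ta_t T) + 1.

Lemma err_cst_ge e : [\/ e = ninv_cst (ta_s T), e = ninv_cst (ta_t T),
  e = ninv_cst (ta_s T - ta_t T) | e = 1] -> e <= err_cst.
Proof.
rewrite /err_cst; have := ninv_cst_ge0 (ta_s T); have := ninv_cst_ge0 (ta_t T).
by have := ninv_cst_ge0 (ta_s T - ta_t T); move=> ? ? ? [] ->; lra.
Qed.

Lemma err_cst_ge0 : 0 <= err_cst.
Proof. by apply: le_trans (err_cst_ge (Or44 _ _ _ (erefl 1))). Qed.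

Lemma norm_hinv n : nu (hinv T n) <= err_cst / n%:R.
Proof.
apply: le_trans (ta_norm_in T _) _; rewrite normfV ger0_norm //.
by rewrite ler_peMl ?invr_ge0 // err_cst_ge //; constructor 4.
Qed.

Lemma norm_winv n : (0 < n)%N -> nu (winv T n) <= err_cst / n%:R.
Proof.
move=> n_gt0; have n_ge1 : 1 <= `|n%:R : R| by rewrite ger0_norm // ler1n.
apply: le_trans (norm_ninv _ n_ge1) _; rewrite ger0_norm // ler_wpM2r ?invr_ge0 //.
by apply: err_cst_ge; constructor 3.
Qed.

Lemma norm_psumB (f : nat -> ta_ring T) p q c :
    (forall n, (0 < n)%N -> nu (f n) <= c / n%:R) -> 0 <= c -> (0 < p <= q)%N ->
  nu (psum f q - psum f p) <= (q - p)%:R * (c / p%:R).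
Proof.
move=> le_f c_ge0 /andP[p_gt0 le_pq]; rewrite -sum_psum //.
apply: le_trans (submult_norm_sum _ _ _ nuP) _.
apply: (@le_trans _ _ (\sum_(p <= i < q) c / p%:R)); last first.
  by rewrite sumr_const_nat mulr_natl.
rewrite [leLHS]big_nat [leRHS]big_nat; apply: ler_sum => n /andP[le_pn _].
have n_gt0 := leq_trans p_gt0 le_pn; apply: le_trans (le_f _ n_gt0) _.
by rewrite ler_wpM2l // lef_pV2 ?posrE ?ltr0n // ler_nat.
Qed.

Section Positions.
Variables (m m' : nat).
Local Notation M := (m + m')%N.

(* absolute value of the integer carried by a position *)
Definition pt_abs n : R := (if (n < m)%N then n.+1 else (M - n)%N)%:R.
(** Bounds a single summand of [hinv] plus a single summand of [winv] in the differences of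
    [ends_errorE]. *)
Definition err_weight n : R := err_cst *
  (if (n < m)%N then (m - n)%:R^-1 + m'.+1%:R^-1 else (n.+1 - m)%:R^-1 + m.+1%:R^-1).

Lemma err_weight_ge0 n : 0 <= err_weight n.
Proof. by rewrite mulr_ge0 ?err_cst_ge0 //; case: ifP => _; rewrite addr_ge0 ?invr_ge0. Qed.

Lemma pt_abs_ge1 n : (n < M)%N -> 1 <= pt_abs n.
Proof. by move=> lt_nM; rewrite /pt_abs ler1n; case: ifP => // _; rewrite subn_gt0. Qed.

Lemma norm_pt_inv n : (n < M)%N -> nu (pt_inv T m m' n) <= err_cst * (pt_abs n)^-1.
Proof.
move=> lt_nM; have := pt_abs_ge1 lt_nM; rewrite /pt_abs /pt_inv; case: ifP => _ ge1.
  apply: le_trans (norm_ninv _ _) _; rewrite ger0_norm // ler_wpM2r ?invr_ge0 //.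
  by apply: err_cst_ge; constructor 1.
apply: le_trans (norm_ninv _ _) _; rewrite normrN ger0_norm // ler_wpM2r ?invr_ge0 //.
by apply: err_cst_ge; constructor 2.
Qed.

(** The number of summands in each difference of [ends_errorE] is the smallest absolute value on the
    chain, hence at most [pt_abs n] for every n between the ends. *)
Lemma norm_ends_error i n j : (i <= n <= j)%N -> (j < M)%N ->
  nu (ends_error T m m' i j) <= pt_abs n * (err_weight i + err_weight j).
Proof.
case/andP=> le_in le_nj lt_jM; have le_ij := leq_trans le_in le_nj.
rewrite ends_errorE ?le_ij //; have c_ge0 := err_cst_ge0.
have abs_ge1 := pt_abs_ge1 (leq_ltn_trans le_nj lt_jM).
have hB p q := norm_psumB (fun n _ => norm_hinv n) c_ge0 (p := p) (q := q).
have wB p q := norm_psumB norm_winv c_ge0 (p := p) (q := q).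
have Ei := err_weight_ge0 i; have Ej := err_weight_ge0 j.
have [lt_jm | le_mj] := ltnP j m.
  have lt_im := leq_ltn_trans le_ij lt_jm.
  apply: (@le_trans _ _ (pt_abs n * err_weight i)); last by rewrite ler_pM2l ?lerDl //; lra.
  apply: (@le_trans _ _ (i.+1%:R * err_weight i)); last first.
    rewrite ler_wpM2r // /pt_abs ifT ?ler_nat ?ltnS //; lia.
  apply: le_trans (nuD _ _) _; rewrite /err_weight lt_im mulrDr mulrDr; apply: lerD.
    rewrite -nuN opprB; apply: le_trans (hB _ _ _) _; first by lia.
    by rewrite (_ : m.+1 - (m - i) = i.+1)%N //; lia.
  rewrite -nuN opprB; apply: le_trans (wB _ _ _) _; first by lia.
  by rewrite (_ : m'.+1 + i.+1 - m'.+1 = i.+1)%N //; lia.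
have [lt_im | le_mi] := ltnP i m.
  have nu0 : nu 0 = 0 by case: nuP.
  by rewrite nu0 mulr_ge0 ?addr_ge0 //; lra.
apply: (@le_trans _ _ (pt_abs n * err_weight j)); last by rewrite ler_pM2l ?lerDr //; lra.
apply: (@le_trans _ _ ((M - j)%:R * err_weight j)); last first.
  rewrite ler_wpM2r // /pt_abs ifF ?ler_nat ?leq_sub2l //; lia.
have jF : (j < m)%N = false by lia.
apply: le_trans (nuD _ _) _; rewrite /err_weight jF mulrDr mulrDr; apply: lerD.
  apply: le_trans (hB _ _ _) _; first by lia.
  by rewrite (_ : m'.+1 - (j.+1 - m) = M - j)%N //; lia.
apply: le_trans (wB _ _ _) _; first by lia.
by rewrite (_ : M - j + m.+1 - m.+1 = M - j)%N //; lia.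
Qed.

Lemma sum_pt_abs_inv (f g : nat -> R) :
  \sum_(0 <= n < M) (pt_abs n)^-1 * (if (n < m)%N then f n else g (M - n.+1)%N)
  = \sum_(0 <= n < m) n.+1%:R^-1 * f n + \sum_(0 <= n < m') n.+1%:R^-1 * g n.
Proof.
rewrite (big_cat_nat (leq0n m)) ?leq_addr //=; congr (_ + _).
  by apply: eq_big_nat => n /andP[_ lt_nm]; rewrite /pt_abs lt_nm.
rewrite -{1}[m]add0n big_addn addKn [RHS]big_nat_rev; apply: eq_big_nat => n /andP[_ lt_nm'].
rewrite /pt_abs !ifF; try lia.
have e1 : (M - (n + m) = (0 + m' - n.+1).+1)%N by lia.
have e2 : (M - (n + m).+1 = 0 + m' - n.+1)%N by lia.
by rewrite e1 e2.
Qed.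

Lemma sum_pt_abs : \sum_(0 <= n < M) (pt_abs n)^-1 = harm R m + harm R m'.
Proof.
have := sum_pt_abs_inv (fun=> 1) (fun=> 1).
under eq_bigr => n _ do rewrite if_same mulr1.
move=> ->; rewrite !harmE.
by congr (_ + _); apply: eq_bigr => n _; rewrite mulr1.
Qed.

Lemma sum_err_weight : \sum_(0 <= n < M) (pt_abs n)^-1 * err_weight n
  <= 3 * err_cst * (harm R m + harm R m') * (m.+1%:R^-1 + m'.+1%:R^-1).
Proof.
have := sum_pt_abs_inv (fun n => err_cst * ((m - n)%:R^-1 + m'.+1%:R^-1))
  (fun n => err_cst * ((m' - n)%:R^-1 + m.+1%:R^-1)).
rewrite (eq_big_nat _ _ (F2 := fun n => (pt_abs n)^-1 * err_weight n)); last first.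
  move=> n /andP[_ lt_nM]; congr (_ * _); rewrite /err_weight.
  case: ltnP => // le_mn; congr (_ * (_%:R^-1 + _)); lia.
move=> ->.
have conv p c : \sum_(0 <= n < p) n.+1%:R^-1 * (err_cst * ((p - n)%:R^-1 + c))
    = err_cst * (2 * harm R p / p.+1%:R + harm R p * c).
  rewrite -sum_harm_convolution harmE mulr_suml -big_split mulr_sumr.
  by apply: eq_bigr => n _ /=; ring.
rewrite !conv -subr_ge0.
(* Each sign contributes its harmonic sum twice over its own length and once over the other; with 3
   the excess is a nonnegative combination. *)
have -> : 3 * err_cst * (harm R m + harm R m') * (m.+1%:R^-1 + m'.+1%:R^-1) -
  (err_cst * (2 * harm R m / m.+1%:R + harm R m / m'.+1%:R) +
   err_cst * (2 * harm R m' / m'.+1%:R + harm R m' / m.+1%:R))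
  = err_cst * (harm R m * (m.+1%:R^-1 + 2 * m'.+1%:R^-1)
               + harm R m' * (m'.+1%:R^-1 + 2 * m.+1%:R^-1)).
  by ring.
by rewrite mulr_ge0 ?err_cst_ge0 // addr_ge0 // mulr_ge0 ?harm_ge0 ?addr_ge0 ?mulr_ge0 ?invr_ge0.
Qed.

(** 6 is 2 from [wsum_absorb] times 3 from [sum_err_weight]; [err_cst] enters once per unit of
    weight through [pt_inv], and once more through [err_weight]. *)
Lemma norm_wsum_error k : is_index k -> has (leq 2) k ->
  nu (wsum M (pt_inv T m m') k (ends_error T m m'))
  <= 6 * err_cst ^+ (wt k).+1 * (harm R m + harm R m') ^+ size k
     * (m.+1%:R^-1 + m'.+1%:R^-1).
Proof.
move=> k_idx has2; apply: le_trans (norm_wsum nuP ta_norm1 norm_pt_inv _ _) _.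
have U01 n : (n < M)%N -> 0 <= (pt_abs n)^-1 <= 1.
  move=> lt_nM; have := pt_abs_ge1 lt_nM => ge1.
  by rewrite invr_ge0 invf_le1 ?ge1 ?andbT; lra.
rewrite wsum_scale; apply: (@le_trans _ _ (err_cst ^+ wt k *
    (2 * (harm R m + harm R m') ^+ (size k).-1 *
     (\sum_(0 <= n < M) (pt_abs n)^-1 * err_weight n)))).
  rewrite ler_wpM2l ?exprn_ge0 ?err_cst_ge0 // -sum_pt_abs.
  apply: (wsum_absorb U01 (w := pt_abs)) => //.
  - by move=> n lt_nM; rewrite mulVf // gt_eqF // (lt_le_trans ltr01) ?pt_abs_ge1.
  - exact: err_weight_ge0.
  - exact: norm_ends_error.
have h_ge0 : 0 <= harm R m + harm R m' by rewrite addr_ge0 ?harm_ge0.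
have := sum_err_weight; case: k k_idx has2 => // c k _ _ /= le_sum.
have := ler_wpM2l (_ : 0 <= 2 * (err_cst ^+ wt (c :: k) * (harm R m + harm R m') ^+ size k)) le_sum.
rewrite mulr_ge0 ?mulr_ge0 ?exprn_ge0 ?err_cst_ge0 // => /(_ isT) le2.
rewrite mulrCA; apply: (le_trans _ (le_trans le2 _)); first by rewrite le_eqVlt; apply/orP;
  left; apply/eqP; ring.
by rewrite le_eqVlt !exprS; apply/orP; left; apply/eqP; ring.
Qed.

End Positions.

End ErrorBound.

(** * Coefficients of the truncated sums *)

(** This and the next two definitions repeat [shift_coef], [zetaS] and [zetaSstar] over any
    commutative ring, with independent families on the two sides, so that truncated sums and
    regularized values can be put into the same formula. *)
Definition gshift (V : comNzRingType) (Z : seq nat -> V) (k : seq nat) (c : nat) : V :=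
  \sum_(n <- comps (size k) c) (binomb k n)%:R * Z (oplus k n).

Definition gzetaS (V : comNzRingType) (Zl Zr : seq nat -> V) (k : seq nat) (a b : nat) : V :=
  \sum_(0 <= i < (size k).+1)
     (-1) ^+ wt (drop i k) *
     ((-1) ^+ a * gshift Zl (take i k) a * gshift Zr (rev (drop i k)) b).

Definition gzetaSstar (V : comNzRingType) (Zl Zr : seq nat -> V) (k : seq nat) (a b : nat) : V :=
  \sum_(l <- coarsenings k) gzetaS Zl Zr l a b.

Lemma comps_cons r c :
  comps r.+1 c = flatten [seq map (cons i) (comps r (c - i)) | i <- iota 0 c.+1].
Proof. by []. Qed.

Lemma gshift_cons (V : comNzRingType) (Z : seq nat -> V) k0 k c :
  gshift Z (k0 :: k) c = \sum_(0 <= i < c.+1)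
    'C(k0 + i - 1, i)%:R * gshift (fun l => Z ((k0 + i)%N :: l)) k (c - i).
Proof.
rewrite /gshift comps_cons big_flatten big_map /index_iota subn0.
apply: eq_bigr => i _; rewrite big_map mulr_sumr; apply: eq_bigr => n _.
by rewrite /binomb /= big_cons natrM mulrA.
Qed.

Lemma gshift_nil (V : comNzRingType) (Z : seq nat -> V) c :
  gshift Z [::] c = if c == 0%N then Z [::] else 0.
Proof.
rewrite /gshift /=; case: eqP => _; last by rewrite big_nil.
by rewrite big_seq1 /binomb big_nil mul1r.
Qed.

Lemma gshiftD (V : comNzRingType) (Z Z' : seq nat -> V) k c :
  gshift (fun l => Z l + Z' l) k c = gshift Z k c + gshift Z' k c.
Proof. by rewrite -big_split; apply: eq_bigr => n _; rewrite mulrDr. Qed.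

Lemma gshiftZ (V : comNzRingType) (z : V) (Z : seq nat -> V) k c :
  gshift (fun l => z * Z l) k c = z * gshift Z k c.
Proof. by rewrite mulr_sumr; apply: eq_bigr => n _; rewrite mulrCA. Qed.

(** * Expansion in powers of a nilpotent shift *)

Definition trunc_series (R S : comNzRingType) (f : {rmorphism R -> S}) (e : S) (n : nat)
  (c : nat -> R) : S := \sum_(0 <= i < n.+1) (- e) ^+ i * f (c i).

Section TruncSeries.
Variables (R S : comNzRingType) (f : {rmorphism R -> S}) (e : S) (n : nat).
Hypothesis e_nilp : e ^+ n.+1 = 0.
Local Notation ser := (trunc_series f e n).

Lemma eq_trunc_series c d : (forall i, (i <= n)%N -> c i = d i) -> ser c = ser d.
Proof. by move=> eqcd; apply: eq_big_nat => i /andP[_ lt_in]; rewrite eqcd. Qed.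

Lemma trunc_seriesD c d : ser (fun i => c i + d i) = ser c + ser d.
Proof. by rewrite -big_split; apply: eq_bigr => i _; rewrite rmorphD mulrDr. Qed.

Lemma trunc_series1 : ser (fun i => if i == 0%N then 1 else 0) = 1.
Proof.
rewrite /trunc_series big_nat_recl // rmorph1 mulr1 expr0 big1 ?addr0 // => i _.
by rewrite rmorph0 mulr0.
Qed.

Lemma trunc_series0 : ser (fun=> 0) = 0.
Proof. by apply: big1 => i _; rewrite rmorph0 mulr0. Qed.

Lemma nilpN i : (n < i)%N -> (- e) ^+ i = 0.
Proof.
move=> lt_ni; rewrite exprNn; have -> : e ^+ i = 0 by rewrite -(subnKC lt_ni) exprD e_nilp mul0r.
by rewrite mulr0.
Qed.

(** Both series are values at - e of polynomials of degree at most [n], and nilpotency kills the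
    excess degrees of the product. *)
Lemma trunc_seriesM c d :
  ser c * ser d = ser (fun i => \sum_(0 <= j < i.+1) c j * d (i - j)%N).
Proof.
pose P g := \poly_(i < n.+1) f (g i).
have serE g : ser g = (P g).[- e].
  rewrite (@horner_coef_wide _ n.+1) ?size_poly // /trunc_series big_mkord.
  by apply: eq_bigr => i _; rewrite coef_poly ltn_ord mulrC.
have le_sz : (size (P c * P d)%R <= n.+1 + n.+1)%N.
  by apply: leq_trans (size_polyMleq _ _) (leq_trans (leq_pred _) _); rewrite leq_add // size_poly.
rewrite !serE -hornerM (horner_coef_wide _ le_sz) big_split_ord /=.
rewrite [X in _ + X]big1 ?addr0 => [|i _]; last by rewrite nilpN ?mulr0 // ltnS leq_addr.
rewrite (@horner_coef_wide _ n.+1) ?size_poly //; apply: eq_bigr => i _; congr (_ * _).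
rewrite coefM coef_poly ltn_ord rmorph_sum big_mkord; apply: eq_bigr => j _.
rewrite !coef_poly rmorphM !ifT //; first exact: leq_ltn_trans (leq_subr _ _) (ltn_ord _).
exact: leq_trans (ltn_ord j) (ltn_ord i).
Qed.

End TruncSeries.

Section InverseSeries.
Variables (R : realFieldType) (a b : nat) (T : trunc_alg R a b).
Variables (e : ta_ring T) (n : nat).
Hypothesis e_nilp : e ^+ n.+1 = 0.
Hypothesis le_n : (n <= (a + b).+1)%N.
Local Notation inj := (ta_in T).
Local Notation ser := (trunc_series inj e n).

(** The binomial series of (c + e)^(-k), source of the coefficients b(k; n). The induction
    multiplies by c + e, where comparing coefficients amounts to Pascal's rule. *)
Lemma ninv_exp c k : c != 0 ->
  ninv e c ^+ k = ser (fun i => 'C(k + i - 1, i)%:R * c^-1 ^+ (k + i)).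
Proof.
move=> c_neq0; have e_nilp2 : e ^+ (a + b).+2 = 0.
  by rewrite -(subnKC (le_n : n.+1 <= (a + b).+2)%N) exprD e_nilp mul0r.
have invP := ninvP e_nilp2 c_neq0.
elim: k => [|k IHk].
  rewrite expr0 -(trunc_series1 inj e n); apply: eq_trunc_series => -[|i] _ /=.
    by rewrite mulr1.
  by rewrite add0n subn1 bin_small ?mul0r.
rewrite exprS IHk; set Q := RHS.
suff -> : ser (fun i => 'C(k + i - 1, i)%:R * c^-1 ^+ (k + i)) = Q * (inj c + e).
  by rewrite mulrCA invP mulr1.
rewrite mulrDr {}/Q.
have -> : ser (fun i => 'C(k.+1 + i - 1, i)%:R * c^-1 ^+ (k.+1 + i)) * inj c
    = ser (fun i => 'C(k + i, i)%:R * c^-1 ^+ (k + i)).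
  rewrite mulr_suml; apply: eq_bigr => i _; rewrite -mulrA -rmorphM addSn subn1 /=.
  by rewrite exprSr -!mulrA mulVf // mulr1.
have -> : ser (fun i => 'C(k.+1 + i - 1, i)%:R * c^-1 ^+ (k.+1 + i)) * e
    = - ser (fun i => if i is j.+1 then 'C(k + j, j)%:R * c^-1 ^+ (k + i) else 0).
  rewrite /trunc_series mulr_suml big_nat_recr //= [in RHS]big_nat_recl //= rmorph0 mulr0 add0r.
  rewrite mulrAC [X in _ + X * _](_ : _ = 0) ?mul0r ?addr0; last first.
    by rewrite -[X in _ * X]opprK mulrN -exprSr (nilpN e_nilp) // oppr0.
  rewrite -sumrN; apply: eq_bigr => i _; rewrite addSn subn1 addnS /= [(- e) ^+ i.+1]exprSr.
  by set z := inj _; ring.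
rewrite -[X in _ = _ + X]mulN1r -[X in X * ser _](rmorphN1 inj).
rewrite /trunc_series mulr_sumr -big_split; apply: eq_bigr => -[|i] _ /=.
  by rewrite !rmorph0 !mulr0 addr0 addn0 bin0 bin0.
rewrite mulrCA -rmorphM -mulrDr -rmorphD; congr (_ * inj _).
rewrite addnS subn1 /= binS natrD; ring.
Qed.

Lemma qsum_ninv (X : seq nat) k : all (leq 1) X ->
  qsum [seq ninv e i%:R | i <- X] k
  = ser (gshift (qsum [seq i%:R^-1 | i <- X]) k).
Proof.
elim: X k => [|x X IHX] [|k0 k] /=.
- move=> _; rewrite -(trunc_series1 inj e n); apply: eq_trunc_series => i _.
  by rewrite gshift_nil.
- move=> _; rewrite -[LHS](trunc_series0 inj e n); apply: eq_trunc_series => i _.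
  by rewrite gshift_cons big1 // => j _; rewrite /gshift big1 ?mulr0 // => ? _; rewrite mulr0.
- move=> _; rewrite -(trunc_series1 inj e n); apply: eq_trunc_series => i _.
  by rewrite gshift_nil.
case/andP=> x_gt0 X_gt0; rewrite !IHX // ninv_exp ?pnatr_eq0 -?lt0n //.
rewrite trunc_seriesM // -trunc_seriesD; apply: eq_trunc_series => i _.
rewrite !gshift_cons -big_split; apply: eq_bigr => j _ /=.
by rewrite gshiftD gshiftZ mulrDr mulrA.
Qed.

End InverseSeries.

(** The truncated zeta value, with the bound [m] included, whereas [mzv_partial] excludes its
    own. *)
Definition hval (R : realFieldType) (m : nat) (k : seq nat) : R :=
  qsum [seq i%:R^-1 | i <- iota 1 m] k.

Section SeriesCoefficients.
Variables (R : realFieldType) (a b : nat) (T : trunc_alg R a b) (m m' : nat).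
Local Notation inj := (ta_in T).
Local Notation s := (ta_s T).
Local Notation t := (ta_t T).
Local Notation M := (m + m')%N.

Lemma iota1_gt0 n : all (leq 1) (iota 1 n).
Proof. by apply/allP => i; rewrite mem_iota => /andP[]. Qed.

Lemma ninvN (e : ta_ring T) c : ninv e (- c) = -1 * ninv (- e) c.
Proof.
rewrite /ninv mulr_sumr; apply: eq_bigr => i _; rewrite opprK invrN.
rewrite [(- e) ^+ i]exprNn [(- c^-1) ^+ _]exprNn rmorphM.
rewrite rmorphXn rmorphN1 mulrACA; congr (_ * _).
by rewrite exprS mulrCA -expr2 sqrr_sign mulr1.
Qed.

(** In increasing order the negative points are 1 - t, ..., m' - t reversed and negated: hence the
    reversed index and the sign (-1)^wt in the zeta values. *)
Lemma iota_pt_inv : [seq pt_inv T m m' n | n <- iota 0 M]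
  = [seq ninv s i%:R | i <- iota 1 m]
    ++ [seq -1 * x | x <- rev [seq ninv (- t) i%:R | i <- iota 1 m']].
Proof.
rewrite iotaD map_cat; congr (_ ++ _).
  rewrite -[1%N]addn0 iotaDl -map_comp; apply/eq_in_map => i; rewrite mem_iota => /andP[_ lt_im].
  by rewrite /pt_inv ifT //= add1n.
rewrite -map_rev -map_comp; apply: (@eq_from_nth _ 0) => [|i].
  by rewrite !size_map size_rev !size_iota.
rewrite size_map size_iota => lt_im'.
rewrite !(nth_map 0%N) ?size_rev ?size_iota // nth_rev ?size_iota // !nth_iota //; last by lia.
rewrite /pt_inv ifF /=; last by lia.
rewrite ninvN; congr (-1 * ninv _ _%:R); lia.
Qed.

(** Weak chains regroup into strict ones, each strict chain is cut at the change of sign, and its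
    halves are expanded in [s] and [t]. *)
Lemma lsum_pt_inv k : lsum M (pt_inv T m m') k 0 (fun=> 1) =
  \sum_(0 <= c < a.+1) \sum_(0 <= d < b.+1)
     inj (gzetaSstar (hval R m) (hval R m') k c d) * s ^+ c * t ^+ d.
Proof.
rewrite -sum_coarsenings_qsum // subn0 iota_pt_inv /gzetaSstar.
have -> : \sum_(0 <= c < a.+1) \sum_(0 <= d < b.+1)
     inj (\sum_(l <- coarsenings k) gzetaS (hval R m) (hval R m') l c d) * s ^+ c * t ^+ d
  = \sum_(l <- coarsenings k) \sum_(0 <= c < a.+1) \sum_(0 <= d < b.+1)
     inj (gzetaS (hval R m) (hval R m') l c d) * s ^+ c * t ^+ d.
  rewrite [RHS]exchange_big; apply: eq_bigr => c _; rewrite [RHS]exchange_big;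
    apply: eq_bigr => d _.
  by rewrite rmorph_sum !mulr_suml.
apply: eq_bigr => l _; rewrite qsum_cat /gzetaS.
have -> : \sum_(0 <= c < a.+1) \sum_(0 <= d < b.+1)
     inj (\sum_(0 <= i < (size l).+1) (-1) ^+ wt (drop i l) *
     ((-1) ^+ c * gshift (hval R m) (take i l) c * gshift (hval R m') (rev (drop i l)) d))
      * s ^+ c * t ^+ d
  = \sum_(0 <= i < (size l).+1) \sum_(0 <= c < a.+1) \sum_(0 <= d < b.+1)
     inj ((-1) ^+ wt (drop i l) *
     ((-1) ^+ c * gshift (hval R m) (take i l) c * gshift (hval R m') (rev (drop i l)) d))
      * s ^+ c * t ^+ d.
  rewrite [RHS]exchange_big; apply: eq_bigr => c _; rewrite [RHS]exchange_big;
    apply: eq_bigr => d _.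
  by rewrite rmorph_sum !mulr_suml.
apply: eq_bigr => i _; rewrite qsum_scale -[in X in _ * (_ * X)](revK (drop i l)) qsum_rev.
have tN : (- t) ^+ b.+1 = 0 by rewrite exprNn (ta_t_nilp T) mulr0.
rewrite (qsum_ninv (ta_s_nilp T)) ?iota1_gt0 ?leqW ?leq_addr //.
rewrite (qsum_ninv tN) ?iota1_gt0 ?leqW ?leq_addl //.
rewrite /trunc_series mulr_suml; apply: eq_bigr => c _.
rewrite mulrCA ![in LHS]mulr_sumr; apply: eq_bigr => d _.
rewrite opprK !rmorphM !rmorphXn rmorphN1 [(- s) ^+ c]exprNn.
rewrite -[gshift (qsum _) (take i l) c]/(gshift (hval R m) (take i l) c).
rewrite -[gshift (qsum _) (rev _) d]/(gshift (hval R m') (rev (drop i l)) d).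
set z := inj _; set z' := inj _; ring.
Qed.

Local Notation top := (ta_top T).

(** Multiplying by s^i t^j moves the coefficient at (a - i, b - j) to the top, where the functional
    reads it. *)
Lemma top_lsum k i j : (i <= a)%N -> (j <= b)%N ->
  top (s ^+ i * t ^+ j * lsum M (pt_inv T m m') k 0 (fun=> 1))
  = gzetaSstar (hval R m) (hval R m') k (a - i) (b - j).
Proof.
move=> le_ia le_jb; rewrite lsum_pt_inv mulr_sumr raddf_sum /=.
under eq_bigr => c _.
  rewrite mulr_sumr raddf_sum /=.
  under eq_bigr => d _.
    have -> : s ^+ i * t ^+ j * (inj (gzetaSstar (hval R m) (hval R m') k c d) * s ^+ c * t ^+ d)
      = inj (gzetaSstar (hval R m) (hval R m') k c d) * s ^+ (i + c) * t ^+ (j + d).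
      by rewrite !exprD; ring.
    rewrite ta_top_monom; over.
  over.
rewrite big_mkord (bigD1 (@inord a (a - i))) //= inordK ?ltnS ?leq_subr //.
rewrite [X in X + _]big_mkord [X in X + _](bigD1 (@inord b (b - j))) //= inordK ?ltnS ?leq_subr //.
rewrite !subnKC // !eqxx /= !big1 ?addr0 // => c neq_c.
  apply: big1 => d _; case: eqP => //= eq_ic; case/eqP: neq_c; apply: val_inj.
  rewrite /= inordK ?ltnS ?leq_subr //; lia.
case: eqP => //= eq_jd; case/eqP: neq_c; apply: val_inj.
rewrite /= inordK ?ltnS ?leq_subr //; lia.
Qed.

End SeriesCoefficients.

(* the difference of the two sides of the cyclic sum formula, for arbitrary values
   [Zl], [Zr] in place of the regularized zeta values in [T_1] and [T_2] *)
Definition cyclic_defect (V : comNzRingType) (Zl Zr : seq nat -> V) (k : seq nat)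
    (a b : nat) : V :=
  \sum_(1 <= i < (size k).+1) \sum_(0 <= j < nth 0%N k i.-1)
    gzetaSstar Zl Zr (j.+1 :: drop i k ++ take i.-1 k ++ [:: nth 0%N k i.-1 - j]%N) a b
  - (\sum_(1 <= i < (size k).+1)
       (\sum_(0 <= j < b.+1) gzetaSstar Zl Zr (j.+1 :: drop i k ++ take i k) a (b - j)%N
        + \sum_(0 <= j < a.+1) gzetaSstar Zl Zr (drop i k ++ take i k ++ [:: j.+1]) (a - j)%N b)
     + (wt k)%:R * gzetaSstar Zl Zr [:: (wt k).+1] a b).

Lemma cyclic_defect_trunc (R : realFieldType) (a b : nat) (T : trunc_alg R a b) m m' k :
  (0 < size k)%N ->
  cyclic_defect (hval R m) (hval R m') k a b
  = ta_top T (\sum_(1 <= i < (size k).+1)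
      wsum (m + m') (pt_inv T m m') (rot i k) (ends_error T m m')).
Proof.
move=> k_gt0; have := congr1 (ta_top T) (cyclic_sum_points T m m' k_gt0).
have top0 l : ta_top T (lsum (m + m') (pt_inv T m m') l 0 (fun=> 1))
    = gzetaSstar (hval R m) (hval R m') l a b.
  by have := top_lsum T m m' l (leq0n a) (leq0n b); rewrite !expr0 !mul1r !subn0.
rewrite !(raddfD (ta_top T)) mulr_natl (raddfMn (ta_top T)) top0 -mulr_natl.
rewrite (_ : ta_top T (\sum_(1 <= i < (size k).+1) \sum_(0 <= j < nth 0%N k i.-1) _)
  = \sum_(1 <= i < (size k).+1) \sum_(0 <= j < nth 0%N k i.-1)
    gzetaSstar (hval R m) (hval R m')
      (j.+1 :: drop i k ++ take i.-1 k ++ [:: nth 0%N k i.-1 - j]%N) a b); last first.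
  rewrite raddf_sum; apply: eq_bigr => i _; rewrite raddf_sum.
  by apply: eq_bigr => j _; rewrite top0.
rewrite (_ : ta_top T (\sum_(1 <= i < (size k).+1) (_ + _)) = \sum_(1 <= i < (size k).+1)
    (\sum_(0 <= j < b.+1)
       gzetaSstar (hval R m) (hval R m') (j.+1 :: drop i k ++ take i k) a (b - j)%N
     + \sum_(0 <= j < a.+1)
       gzetaSstar (hval R m) (hval R m') (drop i k ++ take i k ++ [:: j.+1]) (a - j)%N b)).
  by rewrite /cyclic_defect => ->; rewrite [X in X - _]addrC addrK.
rewrite raddf_sum; apply: eq_bigr => i _; rewrite raddfD !raddf_sum.
congr (_ + _); apply: eq_big_nat => j /andP[_ le_j].
  by rewrite -[_ ^+ j]mul1r -(expr0 (ta_s T)) top_lsum ?subn0.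
by rewrite -[_ ^+ j]mulr1 -(expr0 (ta_t T)) top_lsum // subn0 /rot catA.
Qed.

Lemma cyclic_defect_bound (R : realFieldType) (k : seq nat) (a b : nat) :
  is_index k -> (0 < size k)%N -> (size k < wt k)%N ->
  exists2 K : R, 0 <= K & forall m m',
    `|cyclic_defect (hval R m) (hval R m') k a b|
    <= K * (harm R m + harm R m') ^+ size k * (m.+1%:R^-1 + m'.+1%:R^-1).
Proof.
move=> k_idx k_gt0 lt_sz; have [T] := trunc_alg_exists R a b.
have has2 : has (leq 2) k.
  apply: contraTT lt_sz => /hasPn no2; rewrite -leqNgt /wt.
  elim: k k_idx no2 {k_gt0} => //= c k IHk /andP[_ k_idx] no2.
  rewrite -add1n leq_add ?IHk // => [|d d_in]; last by rewrite no2 // inE d_in orbT.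
  by have := no2 c (mem_head _ _); rewrite -ltnNge.
exists ((size k)%:R * (6 * err_cst T ^+ (wt k).+1)).
  by rewrite !mulr_ge0 ?exprn_ge0 ?err_cst_ge0.
move=> m m'; rewrite (cyclic_defect_trunc T) //; apply: le_trans (ta_top_le _) _.
apply: le_trans (submult_norm_sum _ _ _ (ta_normP T)) _.
have -> : (size k)%:R * (6 * err_cst T ^+ (wt k).+1) * (harm R m + harm R m') ^+ size k
     * (m.+1%:R^-1 + m'.+1%:R^-1)
   = \sum_(1 <= i < (size k).+1) (6 * err_cst T ^+ (wt k).+1
     * (harm R m + harm R m') ^+ size k * (m.+1%:R^-1 + m'.+1%:R^-1)).
  by rewrite sumr_const_nat subn1 /= -[RHS]mulr_natl !mulrA.
apply: ler_sum => i _.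
have := @norm_wsum_error _ _ _ T m m' (rot i k); rewrite wt_rot size_rot; apply.
  by rewrite /is_index (perm_all _ (permEl (perm_rot i k))).
by rewrite (perm_has _ (permEl (perm_rot i k))).
Qed.

(** * Asymptotics of truncated multiple harmonic sums *)

Section Growth.
Variable R : realFieldType.
Implicit Types (f g : nat -> R).

(** [harm R m] stands for log m; the summand 1 keeps the base at least 1, so that exponents can be
    raised. *)
Definition tame f := exists K q, 0 <= K /\ forall m, `|f m| <= K * (1 + harm R m) ^+ q.
Definition small f :=
  exists K q, 0 <= K /\ forall m, `|f m| <= K * (1 + harm R m) ^+ q / m.+1%:R.

Lemma lam_ge1 m : 1 <= 1 + harm R m.
Proof. by rewrite lerDl harm_ge0. Qed.

Lemma lam_exp_le m p q : (p <= q)%N -> (1 + harm R m) ^+ p <= (1 + harm R m) ^+ q.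
Proof. by move=> le_pq; apply: ler_weXn2l; rewrite ?lam_ge1. Qed.

Lemma lam_exp_ge0 m q : 0 <= (1 + harm R m) ^+ q.
Proof. by rewrite exprn_ge0 // (le_trans ler01) ?lam_ge1. Qed.

Lemma eq_small f g : f =1 g -> small f -> small g.
Proof. by move=> eqfg [K [q [K0 le]]]; exists K, q; split=> // m; rewrite -eqfg. Qed.

Lemma small0 : small (fun=> 0).
Proof. by exists 0, 0%N; split=> // m; rewrite normr0 !mul0r. Qed.

Lemma smallD f g : small f -> small g -> small (fun m => f m + g m).
Proof.
move=> [K [q [K0 lef]]] [K' [q' [K0' leg]]]; exists (K + K'), (q + q')%N.
split=> [|m]; first exact: addr_ge0.
apply: le_trans (ler_normD _ _) _; rewrite mulrDl mulrDl; apply: lerD.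
  apply: le_trans (lef m) _; rewrite ler_wpM2r ?invr_ge0 // ler_wpM2l // lam_exp_le //.
  exact: leq_addr.
apply: le_trans (leg m) _; rewrite ler_wpM2r ?invr_ge0 // ler_wpM2l // lam_exp_le //.
exact: leq_addl.
Qed.

Lemma small_tame f g : small f -> tame g -> small (fun m => f m * g m).
Proof.
move=> [K [q [K0 lef]]] [K' [q' [K0' leg]]]; exists (K * K'), (q + q')%N.
split=> [|m]; first exact: mulr_ge0.
rewrite normrM exprD; apply: le_trans (ler_pM _ _ (lef m) (leg m)) _ => //.
by rewrite le_eqVlt; apply/orP; left; apply/eqP; ring.
Qed.

Lemma tame_cst c : tame (fun=> c).
Proof. by exists `|c|, 0%N; split=> // m; rewrite expr0 mulr1. Qed.

Lemma tameD f g : tame f -> tame g -> tame (fun m => f m + g m).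
Proof.
move=> [K [q [K0 lef]]] [K' [q' [K0' leg]]]; exists (K + K'), (q + q')%N.
split=> [|m]; first exact: addr_ge0.
apply: le_trans (ler_normD _ _) _; rewrite mulrDl; apply: lerD.
  apply: le_trans (lef m) _; rewrite ler_wpM2l // lam_exp_le //; exact: leq_addr.
apply: le_trans (leg m) _; rewrite ler_wpM2l // lam_exp_le //; exact: leq_addl.
Qed.

Lemma tameM f g : tame f -> tame g -> tame (fun m => f m * g m).
Proof.
move=> [K [q [K0 lef]]] [K' [q' [K0' leg]]]; exists (K * K'), (q + q')%N.
split=> [|m]; first exact: mulr_ge0.
rewrite normrM exprD; apply: le_trans (ler_pM _ _ (lef m) (leg m)) _ => //.
by rewrite le_eqVlt; apply/orP; left; apply/eqP; ring.
Qed.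

Lemma tame_sum I (r : seq I) (F : I -> nat -> R) :
  (forall i, tame (F i)) -> tame (fun m => \sum_(i <- r) F i m).
Proof.
move=> tameF; elim: r => [|i r IHr].
  have [K [q H]] := tame_cst 0; exists K, q; split; first by case: H.
  by case: H => _ H m; rewrite big_nil.
have [K [q [K0 H]]] := tameD (tameF i) IHr; exists K, q; split=> // m.
by rewrite big_cons.
Qed.

End Growth.

Section TruncatedValues.
Variable R : realFieldType.
Implicit Types (k : seq nat).

Lemma hvalS m k a :
  hval R m.+1 (rcons k a) = hval R m (rcons k a) + hval R m k * m.+1%:R^-1 ^+ a.
Proof.
rewrite /hval; have -> : iota 1 m.+1 = iota 1 m ++ [:: m.+1] by rewrite -(addn1 m) iotaD add1n
  addn1.
by rewrite map_cat cats1 qsum_rcons.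
Qed.

Lemma hval0 k a : hval R 0 (rcons k a) = 0.
Proof. by case: k. Qed.

Lemma hval_nil m : hval R m [::] = 1.
Proof. exact: qsum_nil. Qed.

Lemma hval_rcons m k a : hval R m (rcons k a) = \sum_(0 <= i < m) hval R i k * i.+1%:R^-1 ^+ a.
Proof.
elim: m => [|m IHm]; first by rewrite hval0 big_geq.
by rewrite hvalS IHm big_nat_recr.
Qed.

Lemma hval_ge0 m k : 0 <= hval R m k.
Proof.
elim/last_ind: k m => [|k a IHk] m; first by rewrite hval_nil.
by rewrite hval_rcons sumr_ge0 // => i _; rewrite mulr_ge0 ?exprn_ge0 ?invr_ge0.
Qed.

Lemma hval_le m m' k : (m <= m')%N -> hval R m k <= hval R m' k.
Proof.
case/lastP: k => [|k a] le_mm'; first by rewrite !hval_nil.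
rewrite !hval_rcons (big_cat_nat (leq0n m) le_mm') /= lerDl sumr_ge0 // => i _.
by rewrite mulr_ge0 ?hval_ge0 ?exprn_ge0 ?invr_ge0.
Qed.

Lemma is_index_rcons k a : is_index (rcons k a) = (0 < a)%N && is_index k.
Proof. exact: all_rcons. Qed.

Lemma hval_le_harm m k : is_index k -> hval R m k <= harm R m ^+ size k.
Proof.
elim/last_ind: k => [|k a IHk]; first by rewrite hval_nil.
rewrite is_index_rcons => /andP[a_gt0 k_idx]; rewrite size_rcons exprSr hval_rcons.
rewrite [X in _ * X]harmE mulr_sumr big_nat [leRHS]big_nat; apply: ler_sum => i /andP[_ lt_im].
apply: ler_pM; rewrite ?hval_ge0 ?exprn_ge0 ?invr_ge0 //.
  exact: le_trans (hval_le _ (ltnW lt_im)) (IHk k_idx).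
by rewrite -(prednK a_gt0) exprS ler_piMr ?invr_ge0 ?exprn_ile1 ?invr_ge0 ?invf_le1 ?ltr0n ?ler1n.
Qed.

Lemma hval_le_lam m k : is_index k -> hval R m k <= (1 + harm R m) ^+ size k.
Proof.
move=> k_idx; apply: le_trans (hval_le_harm m k_idx) _.
by apply: lerXn2r; rewrite ?nnegrE ?addr_ge0 ?harm_ge0 // lerDr.
Qed.

Lemma tame_hval k : is_index k -> tame (fun m => hval R m k).
Proof.
move=> k_idx; exists 1, (size k); split=> // m.
by rewrite mul1r ger0_norm ?hval_ge0 ?hval_le_lam.
Qed.

Lemma is_index_ones j : is_index (nseq j 1%N).
Proof. by rewrite /is_index all_nseq orbT. Qed.

Lemma nseq_rcons (U : Type) j (x : U) : nseq j.+1 x = rcons (nseq j x) x.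
Proof. by elim: j => //= j <-. Qed.

Lemma hval_le_ones m k : is_index k -> hval R m k <= hval R m (nseq (size k) 1%N).
Proof.
elim/last_ind: k m => [|k a IHk] m //.
rewrite is_index_rcons => /andP[a_gt0 k_idx]; rewrite size_rcons nseq_rcons !hval_rcons.
apply: ler_sum => i _; apply: ler_pM; rewrite ?hval_ge0 ?exprn_ge0 ?invr_ge0 ?IHk //.
by rewrite -(prednK a_gt0) exprS ler_piMr ?invr_ge0 ?exprn_ile1 ?invr_ge0 ?invf_le1 ?ltr0n ?ler1n.
Qed.

(* Summation by parts, using [1/((m+1)(m+2)) = 1/(m+1) - 1/(m+2)]. *)
Lemma hval_ones_tail p m m' : (m <= m')%N ->
  \sum_(m <= i < m') hval R i (nseq p 1%N) * (i.+1%:R * i.+2%:R)^-1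
  <= p.+1%:R * (1 + harm R m) ^+ p / m.+1%:R.
Proof.
move=> le_mm'; have tele q : \sum_(m <= i < m') (hval R i (nseq q 1%N) / i.+1%:R
    - hval R i.+1 (nseq q 1%N) / i.+2%:R) <= (1 + harm R m) ^+ q / m.+1%:R.
  pose f i := - (hval R i (nseq q 1%N) / i.+1%:R).
  have -> : \sum_(m <= i < m') (hval R i (nseq q 1%N) / i.+1%:R
      - hval R i.+1 (nseq q 1%N) / i.+2%:R) = \sum_(m <= i < m') (f i.+1 - f i).
    by apply: eq_bigr => i _; rewrite /f opprK addrC.
  rewrite telescope_sumr // {}/f.
  rewrite opprK addrC; apply: (@le_trans _ _ (hval R m (nseq q 1%N) / m.+1%:R)).
    by rewrite gerDl oppr_le0 divr_ge0 ?hval_ge0.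
  rewrite ler_wpM2r ?invr_ge0 //; have := hval_le_lam m (is_index_ones q).
  by rewrite size_nseq.
have split i : (i.+1%:R * i.+2%:R)^-1 = i.+1%:R^-1 - i.+2%:R^-1 :> R.
  have n1 : i.+1%:R != 0 :> R by rewrite pnatr_eq0.
  have n2 : i.+2%:R != 0 :> R by rewrite pnatr_eq0.
  have e : i.+2%:R = i.+1%:R + 1 :> R by rewrite -natr1.
  by rewrite e in n2 *; move: n1 n2; move: (i.+1%:R) => x n1 n2; field; rewrite n1 n2.
elim: p => [|p IHp].
  rewrite mul1r; apply: le_trans (tele 0%N); rewrite le_eqVlt; apply/orP; left; apply/eqP.
  by apply: eq_bigr => i _; rewrite !hval_nil split; ring.
have -> : \sum_(m <= i < m') hval R i (nseq p.+1 1%N) * (i.+1%:R * i.+2%:R)^-1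
   = \sum_(m <= i < m') (hval R i (nseq p.+1 1%N) / i.+1%:R
       - hval R i.+1 (nseq p.+1 1%N) / i.+2%:R)
   + \sum_(m <= i < m') hval R i (nseq p 1%N) * (i.+1%:R * i.+2%:R)^-1.
  rewrite nseq_rcons -big_split /=; apply: eq_bigr => i _.
  by rewrite hvalS expr1 {1}split invfM; ring.
apply: le_trans (lerD (tele p.+1) IHp) _.
rewrite [p.+2%:R]mulrS !mulrDl mul1r lerD2l ler_wpM2r ?invr_ge0 // ler_wpM2l //.
exact: lam_exp_le.
Qed.

(** The last exponent gives at most 1/(i+1)^2 <= 2/((i+1)(i+2)), whence the factor 2; the others are
    lowered to 1 and [hval_ones_tail] applies. *)
Lemma hval_tail k m m' : is_index k -> (1 < last 0%N k)%N -> (m <= m')%N ->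
  hval R m' k - hval R m k <= 2 * (size k)%:R * (1 + harm R m) ^+ size k / m.+1%:R.
Proof.
case/lastP: k => // k a; rewrite is_index_rcons last_rcons => /andP[_ k_idx] a_gt1 le_mm'.
rewrite !hval_rcons (big_cat_nat (leq0n m) le_mm') /= addrAC subrr add0r.
apply: (@le_trans _ _ (2 * \sum_(m <= i < m') hval R i (nseq (size k) 1%N)
    * (i.+1%:R * i.+2%:R)^-1)).
  rewrite mulr_sumr; apply: ler_sum => i _; rewrite mulrCA.
  apply: ler_pM; rewrite ?hval_ge0 ?exprn_ge0 ?invr_ge0 ?hval_le_ones //.
  apply: (@le_trans _ _ (i.+1%:R^-1 ^+ 2)).
    by rewrite -(subnKC a_gt1) exprD ler_piMr ?exprn_ge0 ?exprn_ile1 ?invr_ge0 ?invf_le1 ?ltr0n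
      ?ler1n.
  rewrite expr2 invfM mulrCA ler_wpM2l ?invr_ge0 // ler_pdivlMr ?ltr0n //.
  rewrite ler_pdivrMl ?ltr0n // -natrM ler_nat; lia.
rewrite -!mulrA ler_wpM2l // size_rcons.
apply: le_trans (hval_ones_tail _ le_mm') _; rewrite -mulrA ler_wpM2l //.
by rewrite ler_wpM2r ?invr_ge0 // lam_exp_le.
Qed.

End TruncatedValues.

(** * Rate of convergence to multiple zeta values *)

Section Limit.
Variable R : realType.

Lemma mzv_partialE k m : mzv_partial R k m.+1 = hval R m k.
Proof.
rewrite /mzv_partial -[k in RHS]revK; elim: (rev k) m => [|a l IHl] m /=.
  by rewrite hval_nil.
rewrite rev_cons hval_rcons big_add1; apply: eq_bigr => i _.
by rewrite IHl exprVn.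
Qed.

Lemma small_hval_mzv k : admissible k -> small (fun m => hval R m k - mzv R k).
Proof.
case/andP=> k_idx /orP[/eqP-> | last_gt1].
  apply: eq_small (small0 R) => m; rewrite hval_nil /mzv.
  have -> : mzv_partial R [::] = fun=> 1 by [].
  by rewrite lim_cst // subrr.
have bound m m' : hval R m' k <= hval R m k
    + 2 * (size k)%:R * (1 + harm R m) ^+ size k / m.+1%:R.
  rewrite -lerBlDl; have [le_mm' | lt_m'm] := leqP m m'; first exact: hval_tail.
  apply: le_trans (_ : 0 <= _); first by rewrite subr_le0 hval_le // ltnW.
  by rewrite !mulr_ge0 ?lam_exp_ge0 ?invr_ge0.
have part_nd : nondecreasing_seq (mzv_partial R k).
  move=> [|N] [|N'] // le_NN'; rewrite !mzv_partialE; last exact: hval_le.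
  have rev_neq0 : rev k != [::] by rewrite -size_eq0 size_rev; case: (k) last_gt1.
  by rewrite /mzv_partial; case: (rev k) rev_neq0 => //= c l _; rewrite big_geq // hval_ge0.
(* Monotone convergence, with [bound] taken at m = 0. *)
have part_cvg : cvgn (mzv_partial R k).
  apply: nondecreasing_is_cvgn => //.
  exists (hval R 0 k + 2 * (size k)%:R * (1 + harm R 0) ^+ size k / 1%:R) => _ [N _ <-].
  have := part_nd _ _ (leqnSn N); move/le_trans; apply; rewrite mzv_partialE.
  exact: bound.
exists (2 * (size k)%:R), (size k); split=> [|m]; first by rewrite mulr_ge0.
have lower : hval R m k <= mzv R k.
  by rewrite -mzv_partialE; apply: nondecreasing_cvgn_le.
rewrite distrC ger0_norm ?subr_ge0 // lerBlDl; apply: limr_le => //.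
near=> N; have := part_nd _ _ (leqnSn N); move/le_trans; apply; rewrite mzv_partialE.
exact: bound.
Unshelve. all: by end_near. Qed.

End Limit.

(** * The shuffle product of truncated sums *)

#[local] Arguments shuffle : simpl never.

Section ShuffleSums.
Variable (V : comNzRingType).
Implicit Types (u v w : seq bool) (F : seq bool -> V).

Definition shuffle_sum u v F : V := \sum_(w <- shuffle u v) F w.

Lemma shuffle_nilr u : shuffle u [::] = [:: u]. Proof. by case: u. Qed.

Lemma shuffle_cons a u b v : shuffle (a :: u) (b :: v) =
  map (cons a) (shuffle u (b :: v)) ++ map (cons b) (shuffle (a :: u) v).
Proof. by []. Qed.

Lemma shuffle_sum_nill v F : shuffle_sum [::] v F = F v.
Proof. exact: big_seq1. Qed.

Lemma shuffle_sum_nilr u F : shuffle_sum u [::] F = F u.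
Proof. by rewrite /shuffle_sum shuffle_nilr big_seq1. Qed.

Lemma shuffle_sum_cons a u b v F : shuffle_sum (a :: u) (b :: v) F =
  shuffle_sum u (b :: v) (F \o cons a) + shuffle_sum (a :: u) v (F \o cons b).
Proof. by rewrite /shuffle_sum shuffle_cons big_cat !big_map. Qed.

(** The recursion of [shuffle] peels first letters; peeling last letters too shows that shuffling
    commutes with reversal, as [wcoef] reads words backwards. *)
Lemma shuffle_sum_rcons a u b v F : shuffle_sum (rcons u a) (rcons v b) F =
  shuffle_sum u (rcons v b) (fun w => F (rcons w a))
  + shuffle_sum (rcons u a) v (fun w => F (rcons w b)).
Proof.
elim: u v F => [|d u IHu] v F; elim: v F => [|c v IHv] F /=;
  rewrite ?shuffle_sum_cons ?shuffle_sum_nill ?shuffle_sum_nilr /= ?shuffle_sum_nill //.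
- by rewrite addrC.
- by rewrite IHv /= shuffle_sum_nill; ring.
- by have /= -> := IHu [::] (F \o cons d); rewrite shuffle_sum_nilr /=; ring.
- by have /= -> := IHu (c :: v) (F \o cons d); rewrite IHv /=; ring.
Qed.

Lemma shuffle_sum_rev u v F :
  shuffle_sum u v (fun w => F (rev w)) = shuffle_sum (rev u) (rev v) F.
Proof.
elim: u v F => [|a u IHu] v F; first by rewrite !shuffle_sum_nill.
elim: v F => [|b v IHv] F; first by rewrite !shuffle_sum_nilr.
rewrite shuffle_sum_cons !rev_cons shuffle_sum_rcons -!rev_cons -IHu -IHv.
by congr (_ + _); apply: eq_bigr => w _; rewrite /= rev_cons.
Qed.

End ShuffleSums.

(** * Coefficients of multiple polylogarithms *)

Section Convolution.
Variable R : realFieldType.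
Implicit Types (f g : nat -> R).

Definition conv f g n : R := \sum_(0 <= i < n.+1) f i * g (n - i)%N.

Lemma convC f g n : conv f g n = conv g f n.
Proof.
rewrite /conv big_nat_rev; apply: eq_big_nat => i /andP[_ le_in].
by rewrite mulrC add0n subSS subKn.
Qed.

(** On generating functions [psum] is multiplication by z/(1 - z), so it moves out of a Cauchy
    product. *)
Lemma conv_psumr f g n : conv f (psum g) n = psum (conv f g) n.
Proof.
elim: n => [|n IHn]; first by rewrite /conv big_nat1 /psum !big_geq ?mulr0.
rewrite /conv big_nat_recr //= subnn [psum g 0]big_geq // mulr0 addr0.
rewrite [RHS]big_nat_recr //= -[X in _ = X + _]IHn -big_split;
  apply: eq_big_nat => i /andP[_ le_in].
by rewrite subSn // [psum g _]big_nat_recr //= mulrDr.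
Qed.

Lemma conv_psuml f g n : conv (psum f) g n = psum (conv f g) n.
Proof.
by rewrite convC conv_psumr; apply: eq_bigr => i _; rewrite convC.
Qed.

(* [wcoef (rev w)] is the coefficient sequence of the multiple polylogarithm attached to
   the word [w]: its last letter is the outermost integration, [dz/z] for [false] (divide
   by [n]) and [dz/(1-z)] for [true] (take partial sums, then divide by [n]). *)
Fixpoint wcoef (w : seq bool) (n : nat) : R :=
  match w with
  | [::] => (n == 0%N)%:R
  | b :: w' => (if b then psum (wcoef w') n else wcoef w' n) / n%:R
  end.

Lemma wcoef_ge0 w n : 0 <= wcoef w n.
Proof.
elim: w n => [|b w IHw] n //=.
by case: b; rewrite divr_ge0 // sumr_ge0.
Qed.

Lemma wcoef0 b w : wcoef (b :: w) 0 = 0.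
Proof. by rewrite /= invr0 mulr0. Qed.

Lemma wcoef_cons b w n : last true (b :: w) ->
  n%:R * wcoef (b :: w) n = if b then psum (wcoef w) n else wcoef w n.
Proof.
case: n => [|n] last_w; last by rewrite /= mulrC divfK // pnatr_eq0.
rewrite mul0r; case: b last_w => //=; first by rewrite /psum big_geq.
by case: w => // c w _; rewrite wcoef0.
Qed.

(** Multiplying by [n] is applying z d/dz to the polylogarithms: Leibniz's rule splits the product,
    and the derivative strips an outermost letter. The conditions on [last] say that the words, read
    forwards, are empty or start with e_1. *)
Lemma shuffle_wcoef u v n : last true u -> last true v ->
  shuffle_sum u v (fun w => wcoef w n) = conv (wcoef u) (wcoef v) n.
Proof.
elim: u v n => [|a u IHu] v n last_u last_v.
  rewrite shuffle_sum_nill /conv big_nat_recl // mul1r subn0 big1 ?addr0 // => i _.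
  by rewrite mul0r.
elim: v n last_v => [|b v IHv] n last_v.
  rewrite shuffle_sum_nilr convC /conv big_nat_recl // mul1r subn0 big1 ?addr0 // => i _.
  by rewrite mul0r.
case: n => [|n].
  rewrite /conv big_nat1 wcoef0 mul0r /shuffle_sum shuffle_cons big_cat !big_map.
  by rewrite !big1 /= ?addr0 // => w _; exact: wcoef0.
have n_neq0 : n.+1%:R != 0 :> R by rewrite pnatr_eq0.
apply: (mulfI n_neq0); rewrite shuffle_sum_cons.
have last_tl (c : bool) w : last true (c :: w) -> last true w by case: w.
have -> : n.+1%:R * conv (wcoef (a :: u)) (wcoef (b :: v)) n.+1
    = conv (fun i => i%:R * wcoef (a :: u) i) (wcoef (b :: v)) n.+1
    + conv (wcoef (a :: u)) (fun i => i%:R * wcoef (b :: v) i) n.+1.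
  rewrite mulr_sumr -big_split; apply: eq_big_nat => i /andP[_ le_in] /=.
  by rewrite -{1}(subnKC (le_in : i <= n.+1)%N) natrD; ring.
have lhs c x y : n.+1%:R * shuffle_sum x y (fun w => wcoef (c :: w) n.+1)
   = if c then psum (fun i => shuffle_sum x y (fun w => wcoef w i)) n.+1
     else shuffle_sum x y (fun w => wcoef w n.+1).
  rewrite mulr_sumr; case: c.
    rewrite /psum exchange_big; apply: eq_bigr => w _.
    by rewrite /= mulrC divfK.
  by apply: eq_bigr => w _; rewrite /= mulrC divfK.
rewrite mulrDr !lhs; congr (_ + _).
  have -> : conv (fun i => i%:R * wcoef (a :: u) i) (wcoef (b :: v)) n.+1
      = conv (if a then psum (wcoef u) else wcoef u) (wcoef (b :: v)) n.+1.
    by apply: eq_bigr => i _; rewrite (wcoef_cons _ last_u); case: (a).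
  have IHu' m := IHu (b :: v) m (last_tl _ _ last_u) last_v.
  case: (a); last exact: IHu'.
  by rewrite conv_psuml; apply: eq_bigr => i _; exact: IHu'.
have -> : conv (wcoef (a :: u)) (fun i => i%:R * wcoef (b :: v) i) n.+1
    = conv (wcoef (a :: u)) (if b then psum (wcoef v) else wcoef v) n.+1.
  by apply: eq_bigr => i _; rewrite (wcoef_cons _ last_v); case: (b).
have IHv' m := IHv m (last_tl _ _ last_v).
case: (b); last exact: IHv'.
by rewrite conv_psumr; apply: eq_bigr => i _; exact: IHv'.
Qed.

Lemma word_of_index_rcons k a : (0 < a)%N ->
  rev (word_of_index (rcons k a)) = nseq a.-1 false ++ true :: rev (word_of_index k).
Proof.
move=> a_gt0; rewrite /word_of_index map_rcons flatten_rcons rev_cat rev_cons.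
by rewrite cat_rcons rev_nseq.
Qed.

Lemma last_rev_word k : last true (rev (word_of_index k)).
Proof. by case: k => // a k; rewrite /= rev_cons last_rcons. Qed.

Lemma wcoef_block c w n :
  wcoef (nseq c false ++ true :: w) n = psum (wcoef w) n * n%:R^-1 ^+ c.+1.
Proof.
elim: c => [|c IHc] /=; first by rewrite expr1.
by rewrite IHc -mulrA -exprSr.
Qed.

Lemma psum_wcoef k m : is_index k ->
  psum (wcoef (rev (word_of_index k))) m.+1 = hval R m k.
Proof.
elim/last_ind: k m => [|k a IHk] m.
  by rewrite hval_nil /psum big_nat_recl //= big1 ?addr0.
rewrite is_index_rcons => /andP[a_gt0 k_idx]; rewrite hval_rcons word_of_index_rcons //.
rewrite /psum big_nat_recl // wcoef_block invr0 exprS mul0r mulr0 add0r.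
by apply: eq_bigr => i _; rewrite wcoef_block IHk // prednK.
Qed.

Lemma wcoef_index k a i : is_index k -> (0 < a)%N ->
  wcoef (rev (word_of_index (rcons k a))) i.+1 = hval R i k * i.+1%:R^-1 ^+ a.
Proof.
by move=> k_idx a_gt0; rewrite word_of_index_rcons // wcoef_block psum_wcoef // prednK.
Qed.

(* [H_m(k) e_j(m)] and the sum over the shuffle are both sums of products of coefficients,
   over the square [0, m]^2 and over the triangle below its antidiagonal. *)
Lemma small_shuffle_trunc k j : is_index k -> (1 < last 0%N k)%N ->
  small (fun m => hval R m k * hval R m (nseq j 1%N)
    - psum (conv (wcoef (rev (word_of_index k)))
                 (wcoef (rev (word_of_index (nseq j 1%N))))) m.+1).
Proof.
case/lastP: k => // k a; rewrite is_index_rcons last_rcons => /andP[a_gt0 k_idx] a_gt1.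
set f := wcoef (rev (word_of_index (rcons k a))).
set g := wcoef (rev (word_of_index (nseq j 1%N))).
exists 2, (size k + j).+1; split=> // m.
have f0 : f 0%N = 0 by rewrite /f word_of_index_rcons // wcoef_block invr0 exprS mul0r mulr0.
have -> : hval R m (rcons k a) * hval R m (nseq j 1%N) - psum (conv f g) m.+1
    = \sum_(0 <= i < m) f i.+1 * (psum g m.+1 - psum g (m - i)).
  rewrite -!psum_wcoef ?is_index_rcons ?a_gt0 ?is_index_ones // -/f -/g.
  have -> : psum f m.+1 = \sum_(0 <= i < m) f i.+1 by rewrite /psum big_nat_recl // f0 add0r.
  have -> : psum (conv f g) m.+1 = \sum_(0 <= i < m) f i.+1 * psum g (m - i).
    rewrite -conv_psumr /conv big_nat_recr //= subnn [psum g 0]big_geq // mulr0 addr0.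
    by rewrite big_nat_recl // f0 mul0r add0r.
  by rewrite mulr_suml -sumrB; apply: eq_bigr => i _; rewrite mulrBr.
have le_g n : (0 < n <= m)%N -> g n <= (1 + harm R m) ^+ j / n%:R.
  case: n => // n /andP[_ lt_nm]; rewrite /g; case: (j) => [|j'].
    by rewrite /= divr_ge0 ?lam_exp_ge0.
  rewrite nseq_rcons wcoef_index ?is_index_ones // expr1 ler_wpM2r ?invr_ge0 //.
  apply: (@le_trans _ _ ((1 + harm R m) ^+ j')); last exact: lam_exp_le.
  apply: le_trans (hval_le _ _ (ltnW lt_nm)) _.
  by have := hval_le_lam R m (is_index_ones j'); rewrite size_nseq.
have le_f i : (i < m)%N -> f i.+1 <= (1 + harm R m) ^+ size k * i.+1%:R^-1 ^+ 2.
  move=> lt_im; rewrite /f wcoef_index //; apply: ler_pM; rewrite ?hval_ge0 ?exprn_ge0 ?invr_ge0 //.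
    exact: le_trans (hval_le _ _ (ltnW lt_im)) (hval_le_lam _ _ k_idx).
  by rewrite -(subnKC a_gt1) exprD ler_piMr ?exprn_ge0 ?exprn_ile1 ?invr_ge0 ?invf_le1 ?ltr0n
    ?ler1n.
(* The window has i + 1 terms; this factor cancels one of the two powers of 1/(i+1) in [le_f],
   leaving a harmonic convolution. *)
have le_gap i : (i < m)%N ->
    psum g m.+1 - psum g (m - i) <= i.+1%:R * ((1 + harm R m) ^+ j / (m - i)%:R).
  move=> lt_im; rewrite -sum_psum; last by lia.
  apply: (@le_trans _ _ (\sum_(m - i <= n < m.+1) ((1 + harm R m) ^+ j / (m - i)%:R))).
    rewrite big_nat [leRHS]big_nat; apply: ler_sum => n /andP[le_n lt_nm].
    apply: le_trans (le_g n _) _; first by lia.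
    by rewrite ler_wpM2l ?lam_exp_ge0 // lef_pV2 ?posrE ?ltr0n ?ler_nat //; lia.
  rewrite sumr_const_nat mulr_natl (_ : m.+1 - (m - i) = i.+1)%N //; lia.
have gap_ge0 i : 0 <= psum g m.+1 - psum g (m - i).
  rewrite -sum_psum; last by lia.
  by rewrite sumr_ge0 // => n _; exact: wcoef_ge0.
rewrite ger0_norm; last by rewrite sumr_ge0 // => i _; rewrite mulr_ge0 ?wcoef_ge0.
apply: (@le_trans _ _ (\sum_(0 <= i < m) (1 + harm R m) ^+ (size k + j)
    * (i.+1%:R^-1 * (m - i)%:R^-1))).
  rewrite big_nat [leRHS]big_nat; apply: ler_sum => i /andP[_ lt_im].
  apply: le_trans (ler_pM _ _ (le_f i lt_im) (le_gap i lt_im)) _; rewrite ?wcoef_ge0 //.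
  rewrite le_eqVlt; apply/orP; left; apply/eqP.
  have i_neq0 : i.+1%:R != 0 :> R by rewrite pnatr_eq0.
  rewrite exprD expr2; move: i_neq0; move: (i.+1%:R) => x x_neq0.
  transitivity ((x * x^-1) * ((1 + harm R m) ^+ size k * (1 + harm R m) ^+ j *
    (x^-1 / (m - i)%:R))); first by ring.
  by rewrite mulfV // mul1r.
rewrite -mulr_sumr sum_harm_convolution.
rewrite exprSr -!mulrA mulrCA ler_wpM2l // ler_wpM2l ?lam_exp_ge0 // ler_wpM2r ?invr_ge0 //.
by rewrite lerDr.
Qed.

End Convolution.

(** * Regularization *)

#[local] Arguments shuffle : simpl never.
#[local] Arguments stuffle : simpl never.

Section Trail.
Variables (U : eqType) (o : U).
Implicit Types (w : seq U).

(** The length of the final run of [o], on which the regularization recursion descends. *)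
Definition trail w := find (predC1 o) (rev w).

Lemma trail_cons x w : has (predC1 o) w -> trail (x :: w) = trail w.
Proof. by move=> has_w; rewrite /trail rev_cons -cats1 find_cat has_rev has_w. Qed.

Lemma trail_cat_nseq w j : last o w != o -> trail (w ++ nseq j o) = j.
Proof.
case/lastP: w => [|w x]; first by rewrite eqxx.
rewrite last_rcons /trail rev_cat rev_nseq rev_rcons => x_neq.
elim: j => [|j IHj] /=; first by rewrite x_neq.
by rewrite eqxx /= IHj.
Qed.

Lemma has_last w : last o w != o -> has (predC1 o) w.
Proof.
case/lastP: w => [|w x]; first by rewrite eqxx.
by rewrite last_rcons has_rcons /= => ->.
Qed.

Lemma trailP w : exists2 w', w = w' ++ nseq (trail w) o & (w' == [::]) || (last o w' != o).
Proof.
elim/last_ind: w => [|w x [w' eq_w cond]]; first by exists [::].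
rewrite /trail rev_rcons /=; case: (eqVneq x o) => [-> | x_neq] /=; last first.
  by exists (rcons w x); rewrite ?cats0 ?last_rcons ?x_neq ?orbT.
by exists w' => //; rewrite -/(trail w) -[_ :: _]/(nseq _.+1 o) nseq_rcons -rcons_cat -eq_w.
Qed.

End Trail.

Lemma is_index_cat k l : is_index (k ++ l) = is_index k && is_index l.
Proof. exact: all_cat. Qed.

(** Only [k] followed by all the ones keeps [j] of them at the end: in any other term some 1
    precedes the last entry of [k] or merges with an entry. The clause on [has] feeds [trail_cons]
    in the induction. *)
Lemma stuffle_ones k j : is_index k -> last 1%N k != 1%N ->
  exists2 L, perm_eq (stuffle k (nseq j 1%N)) ((k ++ nseq j 1%N) :: L)
    & forall w, w \in L -> (trail 1%N w < j)%N && has (predC1 1%N) w.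
Proof.
have all_le k' j' L : last 1%N k' != 1%N ->
    perm_eq (stuffle k' (nseq j' 1%N)) ((k' ++ nseq j' 1%N) :: L) ->
    (forall w, w \in L -> (trail 1%N w < j')%N && has (predC1 1%N) w) ->
    forall w, w \in stuffle k' (nseq j' 1%N) -> (trail 1%N w <= j')%N && has (predC1 1%N) w.
  move=> last_k' eqL HL w; rewrite (perm_mem eqL) inE => /orP[/eqP-> | /HL/andP[/ltnW-> ->//]].
  by rewrite trail_cat_nseq // leqnn has_cat has_last.
elim: k j => [|a k IHk] j //= /andP[a_gt0 k_idx] last_k; elim: j => [|j [L eqL HL]].
  by exists [::]; rewrite ?stuffle_nilr ?cats0.
have all_kj := all_le (a :: k) j L last_k eqL HL.
have all_cons x w : w \in map (cons x) (stuffle (a :: k) (nseq j 1%N)) ->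
    (trail 1%N w < j.+1)%N && has (predC1 1%N) w.
  by case/mapP => w' /all_kj/andP[le_j has_w'] ->; rewrite trail_cons //= ltnS le_j has_w' orbT.
rewrite [nseq j.+1 _]/= stuffle_cons; case: k IHk k_idx last_k {eqL HL all_kj} all_cons
    => [|b k] IHk k_idx last_k all_cons.
  rewrite !stuffle_nill /=; eexists; first exact: perm_refl.
  move=> w; rewrite mem_cat => /orP[/all_cons // | ]; rewrite inE => /eqP->.
  have neq1 : (a + 1 != 1)%N by rewrite addn1 eqSS -lt0n.
  have := @trail_cat_nseq _ 1%N [:: (a + 1)%N] j; rewrite /= => -> //.
  by rewrite ltnSn neq1.
have [L1 eqL1 HL1] := IHk j.+1 k_idx last_k; have [L2 eqL2 HL2] := IHk j k_idx last_k.
exists (map (cons a) L1 ++ map (cons 1%N) (stuffle [:: a, b & k] (nseq j 1%N))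
   ++ map (cons (a + 1)%N) (stuffle (b :: k) (nseq j 1%N))).
  by rewrite -cat_cons perm_cat2r -[_ :: map _ _]/(map (cons a) (_ :: L1)) perm_map.
move=> w; rewrite !mem_cat => /or3P[/mapP[w' /HL1/andP[lt_j has_w'] ->] | /all_cons // | ].
  by rewrite trail_cons //= lt_j has_w' orbT.
case/mapP => w' /(all_le (b :: k) j _ last_k eqL2 HL2)/andP[le_j has_w'] ->.
by rewrite trail_cons //= ltnS le_j has_w' orbT.
Qed.

Lemma shuffle_ones u j : last true u != true ->
  exists2 L, perm_eq (shuffle u (nseq j true)) ((u ++ nseq j true) :: L)
    & forall w, w \in L -> (trail true w < j)%N && has (predC1 true) w.
Proof.
have all_le u' j' L : last true u' != true ->
    perm_eq (shuffle u' (nseq j' true)) ((u' ++ nseq j' true) :: L) ->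
    (forall w, w \in L -> (trail true w < j')%N && has (predC1 true) w) ->
    forall w, w \in shuffle u' (nseq j' true) -> (trail true w <= j')%N && has (predC1 true) w.
  move=> last_u' eqL HL w; rewrite (perm_mem eqL) inE => /orP[/eqP-> | /HL/andP[/ltnW-> ->//]].
  by rewrite trail_cat_nseq // leqnn has_cat has_last.
elim: u j => [|a u IHu] j //= last_u; elim: j => [|j [L eqL HL]].
  by exists [::]; rewrite ?shuffle_nilr ?cats0.
have all_uj := all_le (a :: u) j L last_u eqL HL.
have all_cons x w : w \in map (cons x) (shuffle (a :: u) (nseq j true)) ->
    (trail true w < j.+1)%N && has (predC1 true) w.
  by case/mapP => w' /all_uj/andP[le_j has_w'] ->; rewrite trail_cons //= ltnS le_j has_w' orbT.
rewrite [nseq j.+1 _]/= shuffle_cons; case: u IHu last_u {eqL HL all_uj} all_cons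
    => [|b u] IHu last_u all_cons.
  by eexists; [exact: perm_refl | exact: all_cons].
have [L1 eqL1 HL1] := IHu j.+1 last_u.
exists (map (cons a) L1 ++ map (cons true) (shuffle [:: a, b & u] (nseq j true))).
  by rewrite -cat_cons perm_cat2r -[_ :: map _ _]/(map (cons a) (_ :: L1)) perm_map.
move=> w; rewrite mem_cat => /orP[/mapP[w' /HL1/andP[lt_j has_w'] ->] | /all_cons //].
by rewrite trail_cons //= lt_j has_w' orbT.
Qed.

Lemma stuffle_index k l w : w \in stuffle k l -> is_index k -> is_index l ->
  is_index w && (size w <= size k + size l)%N.
Proof.
elim: k l w => [|a k IHk] l w.
  by rewrite stuffle_nill inE => /eqP-> _ ->; rewrite leqnn.
elim: l w => [|b l IHl] w.
  by rewrite stuffle_nilr inE => /eqP-> -> _; rewrite addn0 leqnn.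
rewrite stuffle_cons !mem_cat => /or3P[] /mapP[w' w'_in ->] /= /andP[a_gt0 k_idx] /andP[b_gt0
  l_idx].
- have /andP[-> le_sz] : is_index w' && (size w' <= size k + (size l).+1)%N.
    by apply: (IHk (b :: l)); rewrite //= b_gt0.
  by rewrite a_gt0 addSn ltnS.
- have /andP[-> le_sz] := IHl _ w'_in (introT andP (conj a_gt0 k_idx)) l_idx.
  by rewrite b_gt0 addnS ltnS.
have /andP[-> le_sz] := IHk _ _ w'_in k_idx l_idx.
by rewrite addn_gt0 a_gt0 /= addSn addnS !ltnS leqW.
Qed.

Lemma shuffle_word u v w : w \in shuffle u v ->
  (count id w == count id u + count id v)%N && (head true u && head true v ==> head true w).
Proof.
elim: u v w => [|a u IHu] v w.
  by rewrite inE => /eqP->; rewrite eqxx /= implybb.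
elim: v w => [|b v IHv] w.
  by rewrite shuffle_nilr inE => /eqP->; rewrite addn0 eqxx andbT implybb.
rewrite shuffle_cons mem_cat => /orP[] /mapP[w' w'_in ->] /=.
  by have /andP[/eqP-> _] := IHu _ _ w'_in; rewrite /= addnA eqxx; case: (a); case: (b).
have /andP[/eqP-> _] := IHv _ w'_in; rewrite /= addnCA eqxx.
by case: (a); case: (b).
Qed.

Lemma word_of_indexK w : head true w -> word_of_index (index_of_word w) = w.
Proof.
rewrite /index_of_word; set fld := foldr _ _; move=> head_w.
have H : nseq (fld w).1 false ++ word_of_index (fld w).2 = w.
  by elim: (w) => //= b w' IHw; case: b; rewrite -[in RHS]IHw.
have : (fld w).1 = 0%N by case: (w) head_w => // -[].
by move=> e; rewrite -[RHS]H e.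
Qed.

Lemma index_of_wordK k : is_index k -> index_of_word (word_of_index k) = k.
Proof.
rewrite /index_of_word; set fld := foldr _ _ => k_idx.
suff -> : fld (word_of_index k) = (0%N, k) by [].
elim: k k_idx => //= a k IHk /andP[a_gt0 k_idx].
rewrite /word_of_index /= -/(word_of_index k) /fld foldr_cat -/fld IHk //.
have -> c : foldr (fun b zl => if b then (0%N, zl.1.+1 :: zl.2) else (zl.1.+1, zl.2))
    (0%N, k) (nseq c false) = (c, k).
  by elim: c => //= c ->.
by rewrite prednK.
Qed.

Lemma index_of_word_index w : is_index (index_of_word w).
Proof.
rewrite /index_of_word; elim: w => //= b w; set zl := foldr _ _ w.
by case: b.
Qed.

Lemma size_index_of_word w : size (index_of_word w) = count id w.
Proof.
rewrite /index_of_word; elim: w => //= b w; set zl := foldr _ _ w.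
by case: b => //= ->.
Qed.

Lemma trail_word_of_index k : is_index k -> trail true (word_of_index k) = trail 1%N k.
Proof.
rewrite /trail; elim/last_ind: k => // k a IHk; rewrite is_index_rcons => /andP[a_gt0 k_idx].
rewrite word_of_index_rcons // rev_rcons /=; case: a a_gt0 => [|[|a]] //= _.
by rewrite IHk.
Qed.

Lemma word_of_index_cat k l : word_of_index (k ++ l) = word_of_index k ++ word_of_index l.
Proof. by rewrite /word_of_index map_cat flatten_cat. Qed.

Lemma word_of_index_ones j : word_of_index (nseq j 1%N) = nseq j true.
Proof. by elim: j => //= j IHj; rewrite /word_of_index /= -/(word_of_index _) IHj. Qed.

Lemma head_word_of_index k : head true (word_of_index k).
Proof. by case: k. Qed.

Lemma last_word_of_index k : is_index k -> last 1%N k != 1%N ->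
  last true (word_of_index k) != true.
Proof.
case/lastP: k => // k a; rewrite is_index_rcons last_rcons => /andP[a_gt0 _] a_neq1.
rewrite -[word_of_index _]revK word_of_index_rcons // -[last _ _]/(last true _).
case: a a_gt0 a_neq1 => [|[|a]] //= _ _.
by rewrite rev_cons last_rcons.
Qed.

(** Triangularity of both products with respect to trailing ones; on words the letter e_1 takes the
    role of the entry 1. *)
Lemma bprod_ones bl k j : is_index k -> last 1%N k != 1%N ->
  exists2 L, perm_eq (bprod bl k (nseq j 1%N)) ((k ++ nseq j 1%N) :: L)
    & forall w, w \in L -> [/\ is_index w, (size w <= size k + j)%N & (trail 1%N w < j)%N].
Proof.
move=> k_idx last_k; have ones_idx := is_index_ones j; case: bl => /=.
  have [L eqL HL] := stuffle_ones j k_idx last_k; exists L => // w w_in.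
  have w_in' : w \in stuffle k (nseq j 1%N) by rewrite (perm_mem eqL) inE w_in orbT.
  have /andP[lt_j _] := HL w w_in.
  by have /andP[-> ] := stuffle_index w_in' k_idx ones_idx; rewrite size_nseq; split.
have [L eqL HL] := shuffle_ones j (last_word_of_index k_idx last_k).
exists (map index_of_word L).
  rewrite /shuffle_index word_of_index_ones.
  have -> : k ++ nseq j 1%N = index_of_word (word_of_index k ++ nseq j true).
    by rewrite -word_of_index_ones -word_of_index_cat index_of_wordK // is_index_cat k_idx.
  by rewrite -map_cons perm_map.
move=> _ /mapP[w w_in ->]; have /andP[lt_j _] := HL w w_in.
have w_in' : w \in shuffle (word_of_index k) (nseq j true).
  by rewrite (perm_mem eqL) inE w_in orbT.
have /andP[/eqP cnt] := shuffle_word w_in'; rewrite head_word_of_index /=.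
have -> : head true (nseq j true) by case: (j).
move=> /= head_w; split; first exact: index_of_word_index.
  rewrite size_index_of_word cnt leq_add //; last by rewrite count_nseq mul1n.
  by rewrite -size_index_of_word index_of_wordK.
by rewrite -trail_word_of_index ?index_of_word_index // word_of_indexK.
Qed.

Lemma sum_shuffle_hval (R : realFieldType) m k l : is_index k -> is_index l ->
  \sum_(w <- shuffle_index k l) hval R m w
  = psum (conv (wcoef R (rev (word_of_index k))) (wcoef R (rev (word_of_index l)))) m.+1.
Proof.
move=> k_idx l_idx; rewrite /shuffle_index big_map.
transitivity (\sum_(w <- shuffle (word_of_index k) (word_of_index l))
    psum (wcoef R (rev w)) m.+1).
  apply: eq_big_seq => w /shuffle_word/andP[_]; rewrite !head_word_of_index /= => head_w.
  by rewrite -psum_wcoef ?index_of_word_index // word_of_indexK.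
rewrite exchange_big; apply: eq_bigr => n _.
by rewrite -shuffle_wcoef ?last_rev_word // -shuffle_sum_rev.
Qed.

(** * Coordinates of regularized values *)

Section Decomposition.
Variables (R : realType) (bl : bullet) (zr : seq nat -> {poly R}).
Hypothesis zrP : is_reg_zeta bl zr.

Lemma small_bprod_hval k j : is_index k -> (1 < last 0%N k)%N ->
  small (fun m => \sum_(w <- bprod bl k (nseq j 1%N)) hval R m w
                  - mzv R k * hval R m (nseq j 1%N)).
Proof.
move=> k_idx last_k; have ones_idx := is_index_ones j.
have adm : admissible k by rewrite /admissible k_idx last_k orbT.
have small1 := small_tame (small_hval_mzv R adm) (tame_hval R ones_idx).
case: bl => /=.
  by apply: eq_small small1 => m; rewrite sum_stuffle_qsum mulrBl.
have small2 := small_shuffle_trunc R j k_idx last_k.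
have small3 := small_tame small2 (tame_cst (-1)).
apply: eq_small (smallD small1 small3) => m; rewrite sum_shuffle_hval //; ring.
Qed.

Variable J : nat.

(** Coordinates refer to the values at (1, ..., 1) rather than to powers of T, which keeps Euler's
    constant out and treats both products alike. *)
Definition same_coords (z : {poly R}) (f : nat -> R) := exists d : nat -> R,
  z = \sum_(0 <= j < J.+1) (d j)%:P * zr (nseq j 1%N) /\
  small (fun m => f m - \sum_(0 <= j < J.+1) d j * hval R m (nseq j 1%N)).

Lemma same_coordsD z z' f f' c : same_coords z f -> same_coords z' f' ->
  same_coords (z + c%:P * z') (fun m => f m + c * f' m).
Proof.
move=> [d [-> small_d]] [d' [-> small_d']]; exists (fun j => d j + c * d' j); split.
  rewrite mulr_sumr -big_split; apply: eq_bigr => j _.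
  by rewrite polyCD polyCM /= mulrDl mulrA.
apply: eq_small (smallD small_d (small_tame small_d' (tame_cst c))) => m.
rewrite [in RHS](eq_bigr (fun j => d j * hval R m (nseq j 1%N) + c * (d' j * hval R m (nseq j
  1%N)))).
  by rewrite big_split /= -mulr_sumr; ring.
by move=> j _; rewrite mulrDl mulrA.
Qed.

Lemma same_coords0 : same_coords 0 (fun=> 0).
Proof.
exists (fun=> 0); split; first by rewrite big1 // => j _; rewrite mul0r.
by apply: eq_small (small0 R) => m; rewrite big1 ?subr0 // => j _; rewrite mul0r.
Qed.

Lemma same_coords_eq z f g : same_coords z f -> small (fun m => g m - f m) -> same_coords z g.
Proof.
move=> [d [eqz small_d]] small_fg; exists d; split=> //.
by apply: eq_small (smallD small_d small_fg) => m; ring.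
Qed.

Lemma same_coords_ones j : (j <= J)%N -> same_coords (zr (nseq j 1%N)) (fun m => hval R m (nseq
  j 1%N)).
Proof.
move=> le_jJ; exists (fun i => (i == j)%:R); split.
  rewrite big_mkord (bigD1 (@inord J j)) //= inordK ?ltnS // eqxx mul1r big1 ?addr0 // => i.
  move=> neq_ij; case: eqP => [e | _]; last by rewrite mul0r.
  by case/eqP: neq_ij; apply: val_inj; rewrite /= inordK.
apply: eq_small (small0 R) => m.
rewrite big_mkord (bigD1 (@inord J j)) //= inordK ?ltnS // eqxx mul1r big1 ?addr0 ?subrr // => i.
move=> neq_ij; case: eqP => [e | _]; last by rewrite mul0r.
by case/eqP: neq_ij; apply: val_inj; rewrite /= inordK.
Qed.

Lemma same_coords_sum (L : seq (seq nat)) :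
  (forall w, w \in L -> same_coords (zr w) (fun m => hval R m w)) ->
  same_coords (\sum_(w <- L) zr w) (fun m => \sum_(w <- L) hval R m w).
Proof.
elim: L => [|w L IHL] HL.
  rewrite big_nil; apply: same_coords_eq same_coords0 _.
  by apply: eq_small (small0 R) => m; rewrite big_nil subrr.
rewrite big_cons; have IH := IHL (fun w' h => HL w' (mem_behead (s := w :: L) h)).
have := same_coordsD 1 (HL w (mem_head _ _)) IH; rewrite mul1r => H.
by apply: same_coords_eq H _; apply: eq_small (small0 R) => m; rewrite big_cons; ring.
Qed.

(** Induction on the number j of trailing ones. In the product of the convergent part k' with (1,
    ..., 1), [k] is the only index with j trailing ones; solving for it gives the same recursion for
    [zr] and, up to small errors, for truncated sums. *)
Lemma same_coords_reg k : is_index k -> (size k <= J)%N ->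
  same_coords (zr k) (fun m => hval R m k).
Proof.
have [n] := ubnP (trail 1%N k); elim: n k => // n IHn k lt_tr k_idx le_sz.
have [k' eq_k cond] := trailP 1%N k; move: (trail 1%N k) lt_tr eq_k => j lt_jn eq_k.
have [k'0 | k'_neq0] := eqVneq k' [::].
  rewrite eq_k k'0; apply: same_coords_ones.
  by move: le_sz; rewrite eq_k k'0 size_nseq.
have last_k' : last 1%N k' != 1%N by move: cond; rewrite (negPf k'_neq0).
have k'_idx : is_index k' by move: k_idx; rewrite eq_k is_index_cat => /andP[].
have last_k'1 : (1 < last 0%N k')%N.
  case/lastP: k' k'_neq0 last_k' k'_idx {eq_k cond} => // k' x _.
  by rewrite is_index_rcons !last_rcons; case: x => [|[|x]].
have sz_k : size k = (size k' + j)%N by rewrite eq_k size_cat size_nseq.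
have [L eqL HL] := bprod_ones bl j k'_idx last_k'.
have coordsL : same_coords (\sum_(w <- L) zr w) (fun m => \sum_(w <- L) hval R m w).
  apply: same_coords_sum => w /HL[w_idx le_w lt_w]; apply: IHn => //.
    exact: leq_trans lt_w _.
  by rewrite (leq_trans le_w) // -sz_k.
have [_ _ zr_adm zrM] := zrP.
have zr_k : zr k = 0 + (mzv R k')%:P * zr (nseq j 1%N) + (-1)%:P * \sum_(w <- L) zr w.
  have := zrM k' (nseq j 1%N) k'_idx (is_index_ones j).
  rewrite (perm_big _ eqL) big_cons /= -eq_k zr_adm => [->|]; last first.
    by rewrite /admissible k'_idx last_k'1 orbT.
  by rewrite polyCN polyC1; ring.
have ones : same_coords (zr (nseq j 1%N)) (fun m => hval R m (nseq j 1%N)).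
  by apply: same_coords_ones; rewrite (leq_trans _ le_sz) // sz_k leq_addl.
rewrite zr_k; apply: same_coords_eq (same_coordsD _ (same_coordsD _ same_coords0 ones) coordsL) _.
apply: eq_small (small_bprod_hval j k'_idx last_k'1) => m.
by rewrite (perm_big _ eqL) big_cons /= -eq_k; ring.
Qed.

End Decomposition.

(** * Independence of the values at (1, ..., 1) *)

(** With q the quotient of [x] by [p], x + 1 <= p (q + 1) and q + 1 <= 2^q. *)
Lemma expn_le_exp2 p x : (0 < p)%N -> (x.+1 ^ p <= p ^ p * 2 ^ x)%N.
Proof.
move=> p_gt0; apply: (@leq_trans ((p * (x %/ p).+1) ^ p)).
  by rewrite leq_exp2r // mulnC ltn_ceil.
rewrite expnMn leq_pmul2l ?expn_gt0 ?p_gt0 //.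
apply: (@leq_trans ((2 ^ (x %/ p)) ^ p)); first by rewrite leq_exp2r // ltn_expl.
by rewrite -expnM leq_exp2l // leq_divM.
Qed.

Lemma ffact_ge j x : (j.*2 <= x)%N -> (x ^ j <= 2 ^ j * x ^_ j)%N.
Proof.
move=> le_jx; suff H i : (i <= j)%N -> (x ^ i <= 2 ^ i * x ^_ i)%N by exact: H.
elim: i => [|i IHi] le_ij //; rewrite !expnSr ffactnSr.
rewrite -mulnA [(2 * _)%N]mulnCA mulnA; apply: leq_mul; first exact/IHi/ltnW.
by rewrite mul2n; lia.
Qed.

(** * Growth of the sums at (1, ..., 1) along powers of 2 *)

Section Dyadic.
Variable R : realFieldType.
Local Notation ones j := (nseq j 1%N).
Local Notation dy x := (2 ^ x).-1.

Lemma dyS x : dy x.+1 = (dy x + 2 ^ x)%N.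
Proof. by have := expn_gt0 2 x; rewrite expnS; lia. Qed.

Lemma harm_dyadic x : harm R (dy x) <= x%:R.
Proof.
elim: x => [|x IHx]; first by rewrite harmE big_geq.
rewrite harmE dyS (big_cat_nat (leq0n (dy x))) ?leq_addr //= -harmE -natr1.
apply: lerD => //; apply: (@le_trans _ _ (\sum_(dy x <= i < dy x + 2 ^ x) (2 ^ x)%:R^-1)).
  rewrite big_nat [leRHS]big_nat; apply: ler_sum => i /andP[le_i _].
  by rewrite lef_pV2 ?posrE ?ltr0n ?expn_gt0 // ler_nat; move: (expn_gt0 2 x); lia.
by rewrite sumr_const_nat addKn -[leLHS]mulr_natl mulfV // pnatr_eq0 -lt0n expn_gt0.
Qed.

Lemma hval_dyadic_le j x : hval R (dy x) (ones j) <= x%:R ^+ j.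
Proof.
apply: le_trans (hval_le_harm R _ (is_index_ones j)) _; rewrite size_nseq.
by apply: lerXn2r; rewrite ?nnegrE ?harm_ge0 ?harm_dyadic.
Qed.

(** The integers from 2^x to 2^(x+1) - 1 contribute at least 1/2 to the harmonic sum, and there are
    binomially many ways to take [j] distinct such blocks; the induction is Pascal's rule. *)
Lemma hval_dyadic_ge_bin j x : 'C(x, j)%:R <= 2 ^+ j * hval R (dy x) (ones j).
Proof.
elim: x j => [|x IHx] [|j].
- by rewrite bin0 hval_nil expr0 mulr1.
- by rewrite bin0n /= mulr_ge0 ?exprn_ge0 ?hval_ge0.
- by rewrite bin0 hval_nil expr0 mulr1.
rewrite binS natrD nseq_rcons hval_rcons dyS (big_cat_nat (leq0n (dy x))) ?leq_addr //=.
rewrite -hval_rcons -nseq_rcons mulrDr; apply: lerD; first exact: IHx.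
apply: le_trans (IHx j) _; rewrite exprSr -mulrA ler_wpM2l ?exprn_ge0 //.
apply: (@le_trans _ _ (2 * \sum_(dy x <= i < dy x + 2 ^ x)
    hval R (dy x) (ones j) * (2 ^ x.+1)%:R^-1)); last first.
  rewrite ler_wpM2l // [leLHS]big_nat [leRHS]big_nat; apply: ler_sum => i /andP[le_i lt_i].
  rewrite expr1; apply: ler_pM; rewrite ?hval_ge0 ?invr_ge0 ?hval_le //.
  by rewrite lef_pV2 ?posrE ?ltr0n ?expn_gt0 // ler_nat expnS; move: (expn_gt0 2 x); lia.
rewrite sumr_const_nat addKn -[X in 2 * X]mulr_natl expnS natrM invfM.
have e : (2 ^ x)%:R != 0 :> R by rewrite pnatr_eq0 -lt0n expn_gt0.
have e2 : 2%:R != 0 :> R by rewrite pnatr_eq0.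
rewrite [X in _ <= X](_ : _ = (2%:R / 2%:R) * ((2 ^ x)%:R / (2 ^ x)%:R)
  * hval R (dy x) (ones j)); first by rewrite !mulfV // !mul1r.
by ring.
Qed.

(** 4^j is 2^j from [hval_dyadic_ge_bin] times 2^j from [ffact_ge]. *)
Lemma hval_dyadic_ge j x : (j.*2 <= x)%N ->
  (4 ^ j * j`!)%:R^-1 * x%:R ^+ j <= hval R (dy x) (ones j).
Proof.
move=> le_jx; have den_gt0 : 0 < (4 ^ j * j`!)%:R :> R.
  by rewrite ltr0n muln_gt0 expn_gt0 fact_gt0.
rewrite mulrC ler_pdivrMr // -natrX; apply: (@le_trans _ _ (2 ^ j * x ^_ j)%:R).
  by rewrite ler_nat ffact_ge.
rewrite -bin_ffact mulnCA natrM.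
apply: le_trans (ler_wpM2r _ (hval_dyadic_ge_bin j x)) _ => //.
by rewrite (_ : 4 = 2 * 2)%N // expnMn !natrM !natrX le_eqVlt; apply/orP; left; apply/eqP; ring.
Qed.

End Dyadic.

Section Independence.
Variable R : realType.
Local Notation ones j := (nseq j 1%N).

Definition small2 (f : nat -> nat -> R) := exists K q, 0 <= K /\ forall m m',
  `|f m m'| <= K * ((1 + harm R m) * (1 + harm R m')) ^+ q * (m.+1%:R^-1 + m'.+1%:R^-1).

(* Along [m + 1 = 2^x], [m' + 1 = 2^(x^D)] with [D] large the products
   [hval m (ones i) * hval m' (ones j)] grow like [x^(i + D j)], with distinct exponents. *)
Lemma ones_independent (C : nat -> nat -> R) J :
  small2 (fun m m' => \sum_(0 <= i < J.+1) \sum_(0 <= j < J.+1)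
    C i j * (hval R m (ones i) * hval R m' (ones j))) ->
  forall i j, (i <= J)%N -> (j <= J)%N -> C i j = 0.
Proof.
move=> [K [q [K0 bound]]]; pose D := J.+1.
pose P (ij : 'I_D * 'I_D) := C ij.1 ij.2 != 0.
(* Both entries are digits in base D, so distinct pairs have distinct exponents. *)
pose ex (ij : 'I_D * 'I_D) := (ij.1 + D * ij.2)%N.
have [/forallP all0 i j le_i le_j | ] := boolP [forall ij, ~~ P ij].
  by have := all0 (@Ordinal D i le_i, @Ordinal D j le_j); rewrite negbK => /eqP.
rewrite negb_forall => /existsP[ij1]; rewrite negbK => Pij1; exfalso.
(* Among the nonzero coefficients, take the one whose product grows fastest. *)
case: (arg_maxnP ex Pij1) => ij0 Pij0 max_ij0 {ij1 Pij1}.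
pose dy x := (2 ^ x).-1.
pose F (ij : 'I_D * 'I_D) x := hval R (dy x) (ones ij.1) * hval R (dy (x ^ D)%N) (ones ij.2).
have F_le ij x : 0 <= F ij x <= x%:R ^+ ex ij.
  rewrite /F mulr_ge0 ?hval_ge0 //= /ex exprD exprM -[x%:R ^+ D]natrX.
  by apply: ler_pM; rewrite ?hval_ge0 ?hval_dyadic_le.
have ex_inj ij : P ij -> ij != ij0 -> (ex ij < ex ij0)%N.
  move=> Pij neq_ij; rewrite ltn_neqAle (max_ij0 ij Pij : ex ij <= ex ij0)%N andbT;
    apply: contraNneq neq_ij => eq_ex.
  have e2 : (ij.2 : nat) = ij0.2.
    have := congr1 (divn^~ D) eq_ex.
    by rewrite /ex /= !(addnC (nat_of_ord _)) !(mulnC D) !divnMDl // !divn_small ?addn0 ?ltn_ord.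
  have e1 : (ij.1 : nat) = ij0.1 by move: eq_ex; rewrite /ex e2 => /addIn.
  by case: ij ij0 {Pij0 max_ij0 Pij eq_ex} e1 e2 => i j [i0 j0] /= /val_inj-> /val_inj->.
pose c : R := (4 ^ ij0.1 * (ij0.1)`!)%:R^-1 * (4 ^ ij0.2 * (ij0.2)`!)%:R^-1.
have c_gt0 : 0 < c by rewrite mulr_gt0 // invr_gt0 ltr0n muln_gt0 expn_gt0 fact_gt0.
have F_ge x : (J.*2.+1 <= x)%N -> c * x%:R ^+ ex ij0 <= F ij0 x.
  move=> le_x; have le_xD : (x <= x ^ D)%N by rewrite -{1}(expn1 x) leq_pexp2l //; lia.
  have lt_i := ltn_ord ij0.1; have lt_j := ltn_ord ij0.2.
  have c1 : ((nat_of_ord ij0.1).*2 <= x)%N by rewrite (leq_trans _ (ltnW le_x)) // leq_double -ltnS.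
  have c2 : ((nat_of_ord ij0.2).*2 <= x ^ D)%N by rewrite (leq_trans _ le_xD) // (leq_trans _
    (ltnW le_x)) // leq_double -ltnS.
  apply: le_trans (ler_pM _ _ (hval_dyadic_ge R c1) (hval_dyadic_ge R c2));
    rewrite ?mulr_ge0 ?invr_ge0 ?exprn_ge0 //.
  by rewrite le_eqVlt /c /ex exprD exprM natrX; apply/orP; left; apply/eqP; ring.
(* The error is at most a constant times (x+1)^((D+1) q) / 2^x; one more power accounts for the
   extra factor [x] in [err_le]. *)
pose p := (D.+1 * q).+1.
pose A : R := 2 * K * (p ^ p)%:R.
have err_le x : (0 < x)%N -> x%:R * `|\sum_(ij : 'I_D * 'I_D) C ij.1 ij.2 * F ij x| <= A.
  move=> x_gt0; have := bound (dy x) (dy (x ^ D)%N).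
  have -> : \sum_(0 <= i < D) \sum_(0 <= j < D)
      C i j * (hval R (dy x) (ones i) * hval R (dy (x ^ D)%N) (ones j))
      = \sum_(ij : 'I_D * 'I_D) C ij.1 ij.2 * F ij x.
    rewrite big_mkord; under eq_bigr => i _ do rewrite big_mkord.
    by rewrite pair_big.
  move=> le_b; apply: le_trans (ler_wpM2l _ le_b) _ => //.
  have dyK y : (dy y).+1 = (2 ^ y)%N by rewrite prednK ?expn_gt0.
  rewrite !dyK.
  have lam1 : 1 + harm R (dy x) <= x.+1%:R by rewrite -natr1 addrC lerD2r harm_dyadic.
  have lam2 : 1 + harm R (dy (x ^ D)%N) <= x.+1%:R ^+ D.
    apply: (@le_trans _ _ (x ^ D).+1%:R); first by rewrite -natr1 addrC lerD2r harm_dyadic.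
    by rewrite -natrX ler_nat ltn_exp2r.
  have le_q : ((1 + harm R (dy x)) * (1 + harm R (dy (x ^ D)%N))) ^+ q <= x.+1%:R ^+ (D.+1 * q).
    rewrite exprM exprS; apply: lerXn2r;
      rewrite ?nnegrE ?mulr_ge0 ?exprn_ge0 ?addr_ge0 ?harm_ge0 //.
    by apply: ler_pM; rewrite ?addr_ge0 ?harm_ge0.
  have le_inv : (2 ^ x)%:R^-1 + (2 ^ (x ^ D))%:R^-1 <= 2 * (2 ^ x)%:R^-1 :> R.
    rewrite mulr_natl mulr2n lerD2l lef_pV2 ?posrE ?ltr0n ?expn_gt0 // ler_nat leq_exp2l //.
    by rewrite -{1}(expn1 x) leq_pexp2l.
  apply: (@le_trans _ _ (x.+1%:R * (K * x.+1%:R ^+ (D.+1 * q) * (2 * (2 ^ x)%:R^-1)))).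
    apply: ler_pM; rewrite ?ler_nat //.
      by rewrite !mulr_ge0 ?exprn_ge0 ?mulr_ge0 ?addr_ge0 ?harm_ge0 ?invr_ge0.
    apply: ler_pM => //; rewrite ?mulr_ge0 ?exprn_ge0 ?mulr_ge0 ?addr_ge0 ?harm_ge0 ?invr_ge0 //.
    by rewrite ler_wpM2l.
  have -> : x.+1%:R * (K * x.+1%:R ^+ (D.+1 * q) * (2 * (2 ^ x)%:R^-1))
      = 2 * K * (x.+1%:R ^+ p / (2 ^ x)%:R) by rewrite /p exprS; ring.
  rewrite /A ler_wpM2l ?mulr_ge0 // ler_pdivrMr ?ltr0n ?expn_gt0 //.
  by rewrite -natrX -natrM ler_nat expn_le_exp2.
pose B : R := \sum_(ij | ij != ij0) `|C ij.1 ij.2|.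
have B_ge0 : 0 <= B by rewrite sumr_ge0.
have A_ge0 : 0 <= A by rewrite !mulr_ge0.
(* The other exponents are smaller by at least one, so even times [x] their terms stay below a
   multiple of x^(ex ij0); only the dominant term gains a factor [x]. *)
have main x : (J.*2.+1 <= x)%N -> `|C ij0.1 ij0.2| * c * x%:R <= B + A.
  move=> le_x; have x_gt0 : (0 < x)%N := leq_trans (ltn0Sn _) le_x.
  have x_ge1 : 1 <= x%:R :> R by rewrite ler1n.
  have xe_gt0 : 0 < x%:R ^+ ex ij0 :> R by rewrite exprn_gt0 // ltr0n.
  rewrite -(ler_pM2r xe_gt0).
  apply: (@le_trans _ _ (x%:R * `|C ij0.1 ij0.2 * F ij0 x|)).
    have F0 : 0 <= F ij0 x by case/andP: (F_le ij0 x).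
    rewrite normrM (ger0_norm F0) [leRHS]mulrCA.
    have -> : `|C ij0.1 ij0.2| * c * x%:R * x%:R ^+ ex ij0
      = `|C ij0.1 ij0.2| * (x%:R * (c * x%:R ^+ ex ij0)) by ring.
    by rewrite ler_wpM2l // ler_wpM2l // F_ge.
  have tri (y z : R) : `|y| <= `|y + z| + `|z| by rewrite -{1}(addrK z y) ler_normB.
  have := err_le x x_gt0; rewrite (bigD1 ij0) //=; set z := \sum_(_ | _) _ => le_err.
  apply: le_trans (ler_wpM2l _ (tri _ z)) _ => //; rewrite mulrDr addrC mulrDl.
  apply: lerD; last by apply: le_trans le_err _; rewrite ler_peMr // exprn_ege1.
  apply: le_trans (ler_wpM2l _ (ler_norm_sum _ _ _)) _ => //.
  rewrite mulr_sumr mulr_suml; apply: ler_sum => ij neq_ij.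
  have [-> | Cij] := eqVneq (C ij.1 ij.2) 0; first by rewrite mul0r normr0 mulr0 mul0r.
  have /andP[F0 F1] := F_le ij x; rewrite normrM (ger0_norm F0) mulrCA ler_wpM2l //.
  apply: le_trans (ler_wpM2l _ F1) _ => //; rewrite -exprS.
  exact: (ler_weXn2l x_ge1 (ex_inj _ Cij neq_ij)).
have C0_gt0 : 0 < `|C ij0.1 ij0.2| * c by rewrite mulr_gt0 ?normr_gt0.
pose y := (B + A) / (`|C ij0.1 ij0.2| * c).
have y_ge0 : 0 <= y by rewrite divr_ge0 ?addr_ge0 // ltW.
have := main _ (leq_addl (Num.bound y) J.*2.+1).
rewrite leNgt => /negP; apply; rewrite mulrC -ltr_pdivrMr //.
apply: lt_le_trans (archi_boundP y_ge0) _.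
by rewrite ler_nat leq_addr.
Qed.

End Independence.

(** * Bilinearity and conclusion *)

(* [F] is an integral combination of products [Zl u * Zr v], with indices of depth at
   most [J], and with coefficients that do not depend on the ring of values. *)
Definition bilinear (J : nat)
    (F : forall V : comNzRingType, (seq nat -> V) -> (seq nat -> V) -> V) :=
  exists L : seq (int * (seq nat * seq nat)),
    (forall p, p \in L -> [/\ is_index p.2.1, (size p.2.1 <= J)%N, is_index p.2.2
                            & (size p.2.2 <= J)%N]) /\
    forall (V : comNzRingType) (Zl Zr : seq nat -> V),
      F V Zl Zr = \sum_(p <- L) p.1%:~R * (Zl p.2.1 * Zr p.2.2).

Section Bilinear.
Variable J : nat.
Local Notation form := (forall V : comNzRingType, (seq nat -> V) -> (seq nat -> V) -> V).
Implicit Types (F G : form).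

Lemma eq_bilinear F G : (forall V Zl Zr, F V Zl Zr = G V Zl Zr) -> bilinear J F -> bilinear J G.
Proof. by move=> eqFG [L [idx eqF]]; exists L; split=> // V Zl Zr; rewrite -eqFG. Qed.

Lemma bilinear0 : bilinear J (fun V _ _ => 0).
Proof. by exists [::]; split=> // V Zl Zr; rewrite big_nil. Qed.

Lemma bilinear_pair u v : is_index u -> (size u <= J)%N -> is_index v -> (size v <= J)%N ->
  bilinear J (fun V Zl Zr => Zl u * Zr v).
Proof.
move=> u_idx le_u v_idx le_v; exists [:: (1, (u, v))]; split.
  by move=> p; rewrite inE => /eqP->.
by move=> V Zl Zr; rewrite big_seq1 mul1r.
Qed.

Lemma bilinearD F G : bilinear J F -> bilinear J G ->
  bilinear J (fun V Zl Zr => F V Zl Zr + G V Zl Zr).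
Proof.
move=> [L [idx eqF]] [L' [idx' eqG]]; exists (L ++ L'); split.
  by move=> p; rewrite mem_cat => /orP[/idx | /idx'].
by move=> V Zl Zr; rewrite big_cat eqF eqG.
Qed.

Lemma bilinearZ (z : int) F : bilinear J F -> bilinear J (fun V Zl Zr => z%:~R * F V Zl Zr).
Proof.
move=> [L [idx eqF]]; exists [seq (z * p.1, p.2) | p <- L]; split.
  by move=> _ /mapP[p /idx p_idx ->].
move=> V Zl Zr; rewrite big_map eqF mulr_sumr; apply: eq_bigr => p _.
by rewrite intrM mulrA.
Qed.

Lemma bilinear_sum (I : eqType) (r : seq I) (F : I -> form) :
  (forall i, i \in r -> bilinear J (F i)) ->
  bilinear J (fun V Zl Zr => \sum_(i <- r) F i V Zl Zr).
Proof.
elim: r => [|i r IHr] bilF.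
  by apply: eq_bilinear bilinear0 => V Zl Zr; rewrite big_nil.
have bil_r := IHr (fun j h => bilF j (mem_behead (s := i :: r) h)).
apply: eq_bilinear (bilinearD (bilF i (mem_head _ _)) bil_r) => V Zl Zr.
by rewrite big_cons.
Qed.

Lemma bilinear_sum_nat m n (F : nat -> form) :
  (forall i, (m <= i < n)%N -> bilinear J (F i)) ->
  bilinear J (fun V Zl Zr => \sum_(m <= i < n) F i V Zl Zr).
Proof. by move=> bilF; apply: bilinear_sum => i; rewrite mem_index_iota; apply: bilF. Qed.

Lemma oplus_index k n : is_index k -> is_index (oplus k n).
Proof.
rewrite /oplus; elim: k n => [|a k IHk] [|b n] //= /andP[a_gt0 k_idx].
by rewrite addn_gt0 a_gt0 IHk.
Qed.

Lemma size_oplus k n : (size (oplus k n) <= size k)%N.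
Proof. by rewrite size_map size_zip geq_minl. Qed.

Lemma bilinear_gzetaS k a b : is_index k -> (size k <= J)%N ->
  bilinear J (fun V Zl Zr => gzetaS Zl Zr k a b).
Proof.
move=> k_idx le_k; pose F i n n' : form := fun V Zl Zr =>
  ((-1) ^+ wt (drop i k) * (-1) ^+ a * (binomb (take i k) n)%:Z
    * (binomb (rev (drop i k)) n')%:Z)%:~R
  * (Zl (oplus (take i k) n) * Zr (oplus (rev (drop i k)) n')).
apply: (@eq_bilinear (fun V Zl Zr => \sum_(0 <= i < (size k).+1)
    \sum_(n <- comps (size (take i k)) a) \sum_(n' <- comps (size (rev (drop i k))) b)
      F i n n' V Zl Zr)).
  move=> V Zl Zr; apply: eq_bigr => i _.
  rewrite /gshift [(-1) ^+ a * _]mulr_sumr mulr_suml mulr_sumr; apply: eq_bigr => n _.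
  rewrite !mulr_sumr; apply: eq_bigr => n' _.
  by rewrite /F !intrM !rmorphXn !rmorphN1 /=; ring.
apply: bilinear_sum_nat => i _; apply: bilinear_sum => n _; apply: bilinear_sum => n' _.
have idx_take : is_index (take i k) /\ is_index (drop i k).
  by apply/andP; rewrite -is_index_cat cat_take_drop.
apply: bilinearZ; apply: bilinear_pair.
- exact/oplus_index/(proj1 idx_take).
- rewrite (leq_trans (size_oplus _ _)) // size_take_min (leq_trans (geq_minr _ _)) //.
- by apply: oplus_index; rewrite /is_index all_rev; case: idx_take.
- rewrite (leq_trans (size_oplus _ _)) // size_rev size_drop (leq_trans (leq_subr _ _)) //.
Qed.

Lemma coarsenings_index k l : l \in coarsenings k -> is_index k ->
  is_index l && (size l <= size k)%N.
Proof.
elim: k l => [|a k IHk] l; first by rewrite inE => /eqP->.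
case: k IHk => [|b k] IHk; first by rewrite inE => /eqP-> ->.
rewrite -[coarsenings _]/(flatten _) => /flatten_mapP[l' l'_in] l_in /= /andP[a_gt0 k_idx].
have := IHk l' l'_in k_idx; case: l' {l'_in} l_in => [|c l'] /=.
  by rewrite inE => /eqP-> _; rewrite /= a_gt0.
rewrite !inE => /orP[] /eqP-> /andP[/andP[c_gt0 l'_idx] le_sz] /=.
  by rewrite a_gt0 c_gt0 l'_idx.
by rewrite addn_gt0 a_gt0 /= -/(is_index l') l'_idx ltnS ltnW.
Qed.

Lemma bilinear_gzetaSstar k a b : is_index k -> (size k <= J)%N ->
  bilinear J (fun V Zl Zr => gzetaSstar Zl Zr k a b).
Proof.
move=> k_idx le_k; apply: bilinear_sum => l /coarsenings_index-/(_ k_idx)/andP[l_idx le_l].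
exact/bilinear_gzetaS/(leq_trans le_l le_k).
Qed.

End Bilinear.

(** Every index in the formula has at most one entry more than [k]. *)
Lemma bilinear_cyclic_defect k a b : is_index k -> (0 < size k)%N ->
  bilinear (size k).+1 (fun V Zl Zr => cyclic_defect Zl Zr k a b).
Proof.
move=> k_idx k_gt0; have td i : is_index (take i k) && is_index (drop i k).
  by rewrite -is_index_cat cat_take_drop.
have [take_idx drop_idx] : (forall i, is_index (take i k)) /\ (forall i, is_index (drop i k)).
  by split=> i; case/andP: (td i).
pose F : forall V : comNzRingType, (seq nat -> V) -> (seq nat -> V) -> V := fun V Zl Zr =>
  \sum_(1 <= i < (size k).+1) \sum_(0 <= j < nth 0%N k i.-1)
    gzetaSstar Zl Zr (j.+1 :: drop i k ++ take i.-1 k ++ [:: nth 0%N k i.-1 - j]%N) a b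
  + (-1)%:~R * (\sum_(1 <= i < (size k).+1)
       (\sum_(0 <= j < b.+1) gzetaSstar Zl Zr (j.+1 :: drop i k ++ take i k) a (b - j)%N
        + \sum_(0 <= j < a.+1) gzetaSstar Zl Zr (drop i k ++ take i k ++ [:: j.+1]) (a - j)%N b)
     + (wt k)%:~R * gzetaSstar Zl Zr [:: (wt k).+1] a b).
apply: (@eq_bilinear _ F) => [V Zl Zr|]; first by rewrite /F /cyclic_defect mulN1r.
apply: bilinearD.
  apply: bilinear_sum_nat => i /andP[i_gt0 le_i]; apply: bilinear_sum_nat => j /andP[_ lt_j].
  apply: bilinear_gzetaSstar.
    by rewrite -cat1s !is_index_cat drop_idx take_idx /is_index /= subn_gt0 lt_j.
  rewrite /= !size_cat /= size_drop size_take; case: ifP => H; lia.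
apply/bilinearZ/bilinearD; last first.
  by apply/bilinearZ/bilinear_gzetaSstar.
apply: bilinear_sum_nat => i /andP[i_gt0 le_i]; apply: bilinearD; apply: bilinear_sum_nat => j _.
  apply: bilinear_gzetaSstar.
    by rewrite -cat1s !is_index_cat drop_idx take_idx.
  rewrite /= !size_cat /= size_drop size_take; case: ifP => H; lia.
apply: bilinear_gzetaSstar.
  by rewrite !is_index_cat drop_idx take_idx.
rewrite !size_cat /= size_drop size_take; case: ifP => H; lia.
Qed.

(** * Error terms in two truncation parameters *)

Section Small2.
Variable R : realType.
Implicit Types (f g : nat -> nat -> R).

Lemma eq_small2 f g : (forall m m', f m m' = g m m') -> small2 f -> small2 g.
Proof. by move=> eqfg [K [q [K0 le]]]; exists K, q; split=> // m m'; rewrite -eqfg. Qed.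

Lemma lam2_exp_le m m' p q : (p <= q)%N ->
  ((1 + harm R m) * (1 + harm R m')) ^+ p <= ((1 + harm R m) * (1 + harm R m')) ^+ q.
Proof. by move=> le_pq; apply: ler_weXn2l => //; apply: mulr_ege1; exact: lam_ge1. Qed.

Lemma small2D f g : small2 f -> small2 g -> small2 (fun m m' => f m m' + g m m').
Proof.
move=> [K [q [K0 lef]]] [K' [q' [K0' leg]]]; exists (K + K'), (q + q')%N.
split=> [|m m']; first exact: addr_ge0.
have inv_ge0 : 0 <= m.+1%:R^-1 + m'.+1%:R^-1 :> R by rewrite addr_ge0 ?invr_ge0.
apply: le_trans (ler_normD _ _) _; rewrite [(K + K') * _]mulrDl mulrDl; apply: lerD.
  apply: le_trans (lef m m') _; rewrite ler_wpM2r // ler_wpM2l // lam2_exp_le //.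
  exact: leq_addr.
apply: le_trans (leg m m') _; rewrite ler_wpM2r // ler_wpM2l // lam2_exp_le //.
exact: leq_addl.
Qed.

Lemma small2Z c f : small2 f -> small2 (fun m m' => c * f m m').
Proof.
move=> [K [q [K0 lef]]]; exists (`|c| * K), q; split=> [|m m']; first by rewrite mulr_ge0.
by rewrite normrM -!mulrA ler_wpM2l // mulrA.
Qed.

Lemma small2_0 : small2 (fun _ _ => 0 : R).
Proof. by exists 0, 0%N; split=> // m m'; rewrite normr0 !mul0r. Qed.

Lemma small2_sum (I : eqType) (r : seq I) (F : I -> nat -> nat -> R) :
  (forall i, i \in r -> small2 (F i)) -> small2 (fun m m' => \sum_(i <- r) F i m m').
Proof.
elim: r => [|i r IHr] smallF; first by apply: eq_small2 small2_0 => m m'; rewrite big_nil.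
have small_r := IHr (fun j h => smallF j (mem_behead (s := i :: r) h)).
apply: eq_small2 (small2D (smallF i (mem_head _ _)) small_r) => m m'.
by rewrite big_cons.
Qed.

Lemma small2_swap f : small2 f -> small2 (fun m m' => f m' m).
Proof.
move=> [K [q [K0 lef]]]; exists K, q; split=> // m m'.
by rewrite [X in K * X ^+ _]mulrC [m.+1%:R^-1 + _]addrC.
Qed.

Lemma small_tame2 (f g : nat -> R) : small f -> tame g -> small2 (fun m m' => f m * g m').
Proof.
move=> [K [q [K0 lef]]] [K' [q' [K0' leg]]]; exists (K * K'), (q + q')%N.
split=> [|m m']; first exact: mulr_ge0.
rewrite normrM; apply: le_trans (ler_pM _ _ (lef m) (leg m')) _ => //.
have h1 := lam_exp_le R m (leq_addr q' q); have h2 := lam_exp_le R m' (leq_addl q q').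
rewrite exprMn.
have -> : K * (1 + harm R m) ^+ q / m.+1%:R * (K' * (1 + harm R m') ^+ q')
  = K * K' * ((1 + harm R m) ^+ q * (1 + harm R m') ^+ q') * m.+1%:R^-1 by ring.
apply: ler_pM; rewrite ?lerDl ?mulr_ge0 ?lam_exp_ge0 ?invr_ge0 //.
by rewrite ler_wpM2l ?mulr_ge0 // ler_pM ?lam_exp_ge0.
Qed.

End Small2.

(** * Vanishing of the defect for regularized values *)

Section Main.
Variables (R : realType) (bl : bullet) (zr : seq nat -> {poly R}).
Hypothesis zrP : is_reg_zeta bl zr.

Lemma zetaSstar_gzetaSstar k a b :
  zetaSstar zr k a b = gzetaSstar (fun l => (zr l)%:P) (fun l => (zr l)^:P) k a b.
Proof.
apply: eq_bigr => l _; apply: eq_bigr => i _; congr (_ * (_ * _)).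
  rewrite polyCM rmorphXn rmorphN1 /shift_coef rmorph_sum; congr (_ * _).
  by apply: eq_bigr => n _; rewrite rmorphM rmorph_nat.
rewrite /shift_coef rmorph_sum; apply: eq_bigr => n _.
by rewrite rmorphM rmorph_nat.
Qed.

Lemma cyclic_defect_eq0 k a b : is_index k -> (0 < size k)%N -> (size k < wt k)%N ->
  cyclic_defect (fun l => (zr l)%:P) (fun l => (zr l)^:P) k a b = 0.
Proof.
move=> k_idx k_gt0 lt_wt; have [L [L_idx defectE]] := bilinear_cyclic_defect a b k_idx k_gt0.
set J := (size k).+1 in L_idx.
(* Coordinates are chosen once for each index, arbitrarily outside the depths that occur. *)
have /choice [dd ddP] : forall u, exists d : nat -> R, is_index u && (size u <= J)%N ->
    zr u = \sum_(0 <= j < J.+1) (d j)%:P * zr (nseq j 1%N) /\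
    small (fun m => hval R m u - \sum_(0 <= j < J.+1) d j * hval R m (nseq j 1%N)).
  move=> u; have [/andP[u_idx le_u] | _] := boolP (is_index u && (size u <= J)%N); last first.
    by exists (fun=> 0).
  by have [d dP] := same_coords_reg zrP u_idx le_u; exists d.
pose approx u m := \sum_(0 <= j < J.+1) dd u j * hval R m (nseq j 1%N).
pose C i j : R := \sum_(p <- L) p.1%:~R * (dd p.2.1 i * dd p.2.2 j).
have tame_approx u : tame (approx u).
  by apply: tame_sum => j; apply: tameM (tame_cst _) (tame_hval R (is_index_ones j)).
have C_eq0 : forall i j, (i <= J)%N -> (j <= J)%N -> C i j = 0.
  apply: ones_independent.
  have small_defect : small2 (fun m m' => cyclic_defect (hval R m) (hval R m') k a b).
    have [K K0 bound] := cyclic_defect_bound R a b k_idx k_gt0 lt_wt.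
    exists K, (size k); split=> // m m'; apply: le_trans (bound m m') _.
    rewrite ler_wpM2r ?addr_ge0 ?invr_ge0 // ler_wpM2l //; apply: lerXn2r;
      rewrite ?nnegrE ?mulr_ge0 ?addr_ge0 ?harm_ge0 //.
    have h_ge0 := harm_ge0 R m; have h'_ge0 := harm_ge0 R m'.
    by rewrite mulrDl mul1r mulrDr mulr1; have := mulr_ge0 h_ge0 h'_ge0; lra.
  have small_diff : small2 (fun m m' => \sum_(p <- L) p.1%:~R *
      (approx p.2.1 m * approx p.2.2 m' - hval R m p.2.1 * hval R m' p.2.2)).
    apply: small2_sum => p /L_idx[u_idx le_u v_idx le_v]; apply: small2Z.
    have [_ small_u] := ddP p.2.1 (introT andP (conj u_idx le_u)).
    have [_ small_v] := ddP p.2.2 (introT andP (conj v_idx le_v)).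
    have S1 := small_tame2 small_u (tame_approx p.2.2).
    have S2 := small2_swap (small_tame2 small_v (tame_hval R u_idx)).
    apply: eq_small2 (small2Z (-1) (small2D S1 S2)) => m m' /=.
    by rewrite -/(approx _ _) -/(approx _ _); ring.
  apply: eq_small2 (small2D small_defect small_diff) => m m'; rewrite defectE -big_split /=.
  have -> : \sum_(0 <= i < J.+1) \sum_(0 <= j < J.+1)
      C i j * (hval R m (nseq i 1%N) * hval R m' (nseq j 1%N))
    = \sum_(p <- L) p.1%:~R * (approx p.2.1 m * approx p.2.2 m').
    transitivity (\sum_(0 <= i < J.+1) \sum_(0 <= j < J.+1) \sum_(p <- L)
       p.1%:~R * (dd p.2.1 i * hval R m (nseq i 1%N) * (dd p.2.2 j * hval R m' (nseq j 1%N)))).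
      apply: eq_bigr => i _; apply: eq_bigr => j _; rewrite /C mulr_suml.
      by apply: eq_bigr => p _; ring.
    under eq_bigr => i _ do rewrite exchange_big.
    rewrite exchange_big; apply: eq_bigr => p _; rewrite /approx mulr_suml mulr_sumr.
    apply: eq_bigr => i _; rewrite !mulr_sumr; apply: eq_bigr => j _; ring.
  by apply: eq_bigr => p _; ring.
(* The coefficients [C], which vanish because the truncated defect is small, are also the
   coordinates of the defect of the regularized values. *)
rewrite defectE; transitivity (\sum_(0 <= i < J.+1) \sum_(0 <= j < J.+1)
    (C i j)%:P%:P * ((zr (nseq i 1%N))%:P * (zr (nseq j 1%N))^:P) : {poly {poly R}}).
  transitivity (\sum_(0 <= i < J.+1) \sum_(0 <= j < J.+1) \sum_(p <- L)
     p.1%:~R * ((dd p.2.1 i)%:P%:P * (zr (nseq i 1%N))%:P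
                * ((dd p.2.2 j)%:P%:P * (zr (nseq j 1%N))^:P)) : {poly {poly R}}).
    under [RHS]eq_bigr => i _ do rewrite exchange_big.
    rewrite [RHS]exchange_big; apply: eq_big_seq => p /L_idx[u_idx le_u v_idx le_v].
    have [eq_u _] := ddP p.2.1 (introT andP (conj u_idx le_u)).
    have [eq_v _] := ddP p.2.2 (introT andP (conj v_idx le_v)).
    rewrite eq_u eq_v !rmorph_sum /= mulr_suml mulr_sumr; apply: eq_bigr => i _.
    rewrite !mulr_sumr; apply: eq_bigr => j _.
    by rewrite !rmorphM /= map_polyC.
  apply: eq_bigr => i _; apply: eq_bigr => j _; rewrite /C !rmorph_sum mulr_suml.
  by apply: eq_bigr => p _; rewrite !rmorphM !rmorph_int /=; ring.
rewrite big_nat big1 // => i /andP[_ le_i]; rewrite big_nat big1 // => j /andP[_ le_j].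
by rewrite C_eq0 // !rmorph0 mul0r.
Qed.

End Main.

(** The identity is read at the coefficient of s^a t^b: a factor t^j or s^j lowers [b] or [a] by
    [j], which ends the infinite sums at [b] and [a]. *)
Theorem theorem6p1 (R : realType) (bl : bullet) (zr : seq nat -> {poly R})
  (k : seq nat) :
  is_reg_zeta bl zr ->
  is_index k -> (1 <= size k)%N -> (size k < wt k)%N ->
  forall a b : nat,
    \sum_(1 <= i < (size k).+1) \sum_(0 <= j < nth 0%N k i.-1)
       zetaSstar zr (j.+1 :: drop i k ++ take i.-1 k ++ [:: nth 0%N k i.-1 - j]%N) a b
  = \sum_(1 <= i < (size k).+1)
       (\sum_(0 <= j < b.+1) zetaSstar zr (j.+1 :: drop i k ++ take i k) a (b - j)%N
        + \sum_(0 <= j < a.+1) zetaSstar zr (drop i k ++ take i k ++ [:: j.+1]) (a - j)%N b)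
    + (wt k)%:R * zetaSstar zr [:: (wt k).+1] a b.
Proof.
move=> zrP k_idx k_gt0 lt_wt a b; apply/eqP; rewrite -subr_eq0; apply/eqP.
rewrite -[RHS](cyclic_defect_eq0 zrP a b k_idx k_gt0 lt_wt) /cyclic_defect.
rewrite zetaSstar_gzetaSstar; congr (_ - (_ + _)).
  by apply: eq_bigr => i _; apply: eq_bigr => j _; rewrite zetaSstar_gzetaSstar.
apply: eq_bigr => i _; congr (_ + _); apply: eq_bigr => j _; exact: zetaSstar_gzetaSstar.
Qed.
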